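(* Let $d\ge1$ be an integer and $0<s<d$. There exists a constant $c>0$ depending only on $d$ and $s$ such that for every compact set $E\subset\mathbb{R}^d$, $$\gamma_{s,+}(E)\ge c\cdot C_{\frac23(d-s),\frac32}(E).$$
   Context: For a compact set $E\subset\mathbb{R}^d$, $M_+(E)$ is the class of positive Radon measures supported by $E$, and $\|\mu\|=\mu(E)$ is the total mass of $\mu$. For $\mu\in M_+(E)$, $$R^s_\mu(x)=\lim_{\varepsilon\to0+}\int_{|y-x|>\varepsilon}\frac{y-x}{|y-x|^{s+1}}\,d\mu(y),$$ which for $0<s<d$ exists for Lebesgue-almost every $x\in\mathbb{R}^d$. The capacity $\gamma_{s,+}$ is $$\gamma_{s,+}(E)=\sup\{\|\mu\|:\ \mu\in M_+(E),\ \|R^s_\mu\|_\infty\le1\},$$ where $\|\cdot\|_\infty$ is the $L^\infty$ norm with respect to Lebesgue measure on $\mathbb{R}^d$. For $1<p<\infty$ and $0<\alpha p\le d$, the Riesz capacity is $$C_{\alpha,p}(E)=\sup_{\mu\in M_+(E)}\bigg(\frac{\mu(E)}{\|I_\alpha\ast\mu\|_{p'}}\bigg)^p,\qquad I_\alpha(x)=\frac{A_{d,\alpha}}{|x|^{d-\alpha}},\qquad \frac1{p'}+\frac1p=1,$$ where the supremum is over nonzero $\mu$, $\|\cdot\|_{p'}$ is the $L^{p'}$ norm with respect to Lebesgue measure in $\mathbb{R}^d$ (a quotient with infinite denominator is $0$; the supremum over the empty family is $0$), and $A_{d,\alpha}>0$ is a fixed normalizing constant depending only on $d$ and $\alpha$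 (the standard Riesz kernel normalization). *)

(* Defs.v *)
From HB Require Import structures.
From mathcomp Require Import all_boot all_order all_algebra.
From mathcomp Require Import all_classical all_reals all_analysis.
From mathcomp Require Import measurable_realfun.

Set Implicit Arguments.
Unset Strict Implicit.
Unset Printing Implicit Defensive.

Import Order.TTheory GRing.Theory Num.Def Num.Theory.
Import numFieldNormedType.Exports.

Local Open Scope classical_set_scope.
Local Open Scope ring_scope.

HB.instance Definition _ (R : realType) (n : nat) :=
  @isMeasurable.Build (sigma_display (@open 'rV[R]_n)) 'rV[R]_n
    <<s (@open 'rV[R]_n) >> (@sigma_algebra0 _ setT _) (@sigma_algebraC _ _)
    (@sigma_algebra_bigcup _ setT _).

Section borel_rV.
Context {R : realType} {n : nat}.

Lemma open_measurable_rV (U : set 'rV[R]_n) : open U -> measurable U.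
Proof. by move=> oU; exact: sub_gen_smallest. Qed.

Lemma measurable_coord (i : 'I_n) :
  measurable_fun [set: 'rV[R]_n] (fun v => v ord0 i).
Proof.
apply: (measurability _ (RGenOpens.measurableE R)) => //.
move=> _ [_ [a [b ->]] <-]; rewrite setTI; apply: open_measurable_rV.
apply: open_comp; last exact: interval_open.
by move=> v _; exact: coord_continuous.
Qed.

Lemma measurable_rV d (T : measurableType d) (f : T -> 'rV[R]_n) :
  (forall i, measurable_fun [set: T] (fun t => f t ord0 i)) ->
  measurable_fun [set: T] f.
Proof.
move=> mf.
apply: (@measurability _ _ _ _ _ _ (@open 'rV[R]_n)) => //.
move=> _ [U oU <-]; rewrite setTI.
pose box (q : 'rV[rat]_n) (r : rat) :=
  [set v : 'rV[R]_n | forall i, `|ratr (q ord0 i) - v ord0 i| < ratr r].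
have -> : U = \bigcup_(qr : 'rV[rat]_n * rat)
    (if pselect (box qr.1 qr.2 `<=` U) then box qr.1 qr.2 else set0).
  apply/seteqP; split => [v Uv|v [[q r] _ /=]]; last first.
    by case: pselect => // qrU; exact: qrU.
  have /nbhs_ballP[e /= e0 eU] : nbhs v U by apply: open_nbhs_nbhs.
  have /rat_in_itvoo[r] : (0 < e / 2) by rewrite divr_gt0.
  rewrite in_itv/= => /andP[r0 re].
  have /choice[q qP] : forall i, exists q : rat, `|ratr q - v ord0 i| < ratr r :> R.
    move=> i; have /rat_in_itvoo[q] : v ord0 i - ratr r < v ord0 i + ratr r.
      by rewrite ltrD2l gtrN.
    rewrite in_itv/= => /andP[q1 q2]; exists q; rewrite ltr_norml.
    by rewrite ltrBrDl q1/= ltrBlDl.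
  exists (\row_i q i, r) => //=; case: pselect => [_ i|]; first by rewrite !mxE.
  move=> nU; exfalso; apply: nU => w wb; apply: eU; split => // i j.
  rewrite /ball /= ord1 (splitr e).
  have := wb j; rewrite mxE => h1.
  apply: le_lt_trans (ler_distD (ratr (q j)) _ _) _.
  by rewrite ltrD// ?(distrC (v ord0 j)); apply: lt_trans re.
rewrite preimage_bigcup; apply: countable_bigcupT_measurable => [|[q r]].
  exact: countableP.
case: pselect => [_|_] /=; last by rewrite preimage_set0.
have -> : f @^-1` box q r = \bigcap_(i in [set: 'I_n])
   ((fun t => f t ord0 i) @^-1` ball (ratr (q ord0 i) : R) (ratr r)).
  by apply/seteqP; split => [t h i _|t h i]; [exact: h|exact: (h i I)].
apply: fin_bigcap_measurable => [|i _]; first exact: finite_finset.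
by rewrite -[X in measurable X]setTI; apply: mf => //; exact: measurable_ball.
Qed.

End borel_rV.

Section rV_cons.
Context {R : realType} {n : nat}.

Definition rV_cons (p : R * 'rV[R]_n) : 'rV[R]_n.+1 :=
  \row_i (if unlift ord0 i is Some j then p.2 ord0 j else p.1).

Definition rV_uncons (v : 'rV[R]_n.+1) : R * 'rV[R]_n :=
  (v ord0 ord0, \row_i v ord0 (lift ord0 i)).

Lemma rV_consK : cancel rV_cons rV_uncons.
Proof.
case=> x v; rewrite /rV_uncons; congr (_, _); first by rewrite mxE unlift_none.
by apply/rowP => i; rewrite !mxE liftK.
Qed.

Lemma measurable_rV_cons : measurable_fun [set: R * 'rV[R]_n] rV_cons.
Proof.
apply: measurable_rV => i; under eq_fun do rewrite mxE.
case: (unliftP ord0 i) => [j|] _; last exact: measurable_fst.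
exact: measurableT_comp (measurable_coord j) measurable_snd.
Qed.

Lemma measurable_rV_uncons : measurable_fun [set: 'rV[R]_n.+1] rV_uncons.
Proof.
apply: measurable_fun_pair; first exact: measurable_coord.
apply: measurable_rV => i; under eq_fun do rewrite mxE.
exact: measurable_coord.
Qed.

End rV_cons.

Section lebesgue_step.
Local Open Scope ereal_scope.
Context {R : realType} {n : nat}.
Variable mu : {sigma_finite_measure set 'rV[R]_n -> \bar R}.

Definition lebesgue_step : set 'rV[R]_n.+1 -> \bar R :=
  pushforward (@lebesgue_measure R \x mu) rV_cons.

#[local] Hint Extern 0 (measurable_fun _ rV_cons) =>
  solve [exact: measurable_rV_cons] : core.

Let lebesgue_step0 : lebesgue_step set0 = 0.
Proof. exact: measure0. Qed.

Let lebesgue_step_ge0 A : 0 <= lebesgue_step A.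
Proof. exact: measure_ge0. Qed.

Let lebesgue_step_sigma_additive : semi_sigma_additive lebesgue_step.
Proof. exact: measure_semi_sigma_additive. Qed.

HB.instance Definition _ := isMeasure.Build _ _ _ lebesgue_step
  lebesgue_step0 lebesgue_step_ge0 lebesgue_step_sigma_additive.

Let lebesgue_step_sigma_finite : sigma_finite setT lebesgue_step.
Proof.
have /sigma_finiteP[F [FT ndF Foo]] := sigma_finiteT (@lebesgue_measure R).
have /sigma_finiteP[G [GT ndG Goo]] := sigma_finiteT mu.
exists (fun k => rV_uncons @^-1` (F k `*` G k)) => [|k].
  apply/esym/seteqP; split => // v _ /=.
  have [i _ Fi] : (\bigcup_i F i) (rV_uncons v).1 by rewrite -FT.
  have [j _ Gj] : (\bigcup_i G i) (rV_uncons v).2 by rewrite -GT.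
  exists (maxn i j) => //=; split.
  - by move: Fi; exact/subsetPset/ndF/leq_maxl.
  - by move: Gj; exact/subsetPset/ndG/leq_maxr.
have [mF Fky] := Foo k; have [mG Gky] := Goo k; split.
  rewrite -[X in measurable X]setTI; apply: measurable_rV_uncons => //.
  exact: measurableX.
rewrite /lebesgue_step /pushforward -comp_preimage.
rewrite (_ : rV_uncons \o rV_cons = id); last first.
  by apply/funext => p /=; exact: rV_consK.
by rewrite preimage_id product_measure1E// lte_mul_pinfty// ge0_fin_numE.
Qed.

HB.instance Definition _ := Measure_isSigmaFinite.Build _ _ _
  lebesgue_step lebesgue_step_sigma_finite.

End lebesgue_step.

Section lebesgue_rV.
Context {R : realType}.
Local Open Scope ereal_scope.

Fixpoint lebesgue_rV (n : nat) : {sigma_finite_measure set 'rV[R]_n -> \bar R} :=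
  match n with
  | 0%N => dirac (0%R : 'rV[R]_0)
  | n'.+1 => lebesgue_step (lebesgue_rV n')
  end.

Lemma lebesgue_rV_box n (a b : 'rV[R]_n) :
  (forall i, a ord0 i <= b ord0 i)%R ->
  lebesgue_rV n [set v : 'rV[R]_n | forall i, a ord0 i <= v ord0 i <= b ord0 i]%R =
  (\prod_(i < n) (b ord0 i - a ord0 i)%R)%:E.
Proof.
elim: n a b => [|n IH] a b ab.
  by rewrite big_ord0 /= diracE mem_set// => -[].
pose tl (v : 'rV[R]_n.+1) : 'rV[R]_n := \row_i v ord0 (lift ord0 i).
change ((@lebesgue_measure R \x lebesgue_rV n) (rV_cons @^-1`
    [set v : 'rV[R]_n.+1 | forall i, a ord0 i <= v ord0 i <= b ord0 i]%R) =
  (\prod_(i < n.+1) (b ord0 i - a ord0 i)%R)%:E).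
have -> : rV_cons @^-1` [set v : 'rV[R]_n.+1 | forall i, a ord0 i <= v ord0 i <= b ord0 i]%R =
    `[a ord0 ord0, b ord0 ord0] `*`
    [set v : 'rV[R]_n | forall i, tl a ord0 i <= v ord0 i <= tl b ord0 i]%R.
  apply/seteqP; split => -[x v] /=.
    move=> h; split; first by have := h ord0; rewrite mxE unlift_none in_itv.
    by move=> i; have := h (lift ord0 i); rewrite !mxE liftK.
  move=> [xab h] i; rewrite mxE; case: unliftP => [j|] ->.
    by have := h j; rewrite !mxE.
  by move: xab; rewrite in_itv.
rewrite product_measure1E//; last first.
  have -> : [set v : 'rV[R]_n | forall i, tl a ord0 i <= v ord0 i <= tl b ord0 i]%R =
      \bigcap_(i in [set: 'I_n])
        ((fun v : 'rV[R]_n => v ord0 i) @^-1` `[tl a ord0 i, tl b ord0 i]).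
    apply/seteqP; split => [v h i _|v h i] /=; first by rewrite in_itv/=; exact: h.
    by have := h i I; rewrite /= in_itv.
  apply: fin_bigcap_measurable => [|i _]; first exact: finite_finset.
  by rewrite -[X in measurable X]setTI; apply: measurable_coord.
rewrite IH; last by move=> i; rewrite !mxE.
rewrite big_ord_recl EFinM; congr (_ * _%:E); last first.
  by apply: eq_bigr => i _; rewrite !mxE.
transitivity (@lebesgue_measure R `[a ord0 ord0, b ord0 ord0]%classic) => //.
rewrite lebesgue_measure_itv /= lte_fin.
have := ab ord0; rewrite le_eqVlt => /predU1P[->|->] //.
by rewrite ltxx subrr.
Qed.

End lebesgue_rV.

Section capacities.
Context {R : realType} {d : nat}.
Local Open Scope ereal_scope.

Implicit Types (mu : {measure set 'rV[R]_d -> \bar R}) (E : set 'rV[R]_d).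
Implicit Types x y : 'rV[R]_d.

(* The library norm on ['rV[R]_d] is the sup norm. *)
Definition enorm x : R := Num.sqrt (\sum_(i < d) x ord0 i ^+ 2)%R.

(* A locally finite Borel measure on R^d is automatically regular. *)
Definition radon mu := forall K : set 'rV[R]_d, compact K -> mu K < +oo.

(* For closed [E], [mu (~` E) = 0] says that the support of [mu] lies in [E]. *)
Definition Mplus E : set {measure set 'rV[R]_d -> \bar R} :=
  [set mu | radon mu /\ mu (~` E) = 0].

Definition riesz_truncated (s : R) mu (eps : R) x : 'rV[R]_d :=
  (\row_i \int[mu]_(y in [set y | eps < enorm (y - x)])
            ((y - x) ord0 i / enorm (y - x) `^ (s + 1)))%R.

(* [lim] is [point] where there is no limit; for [0 < s < d] and [mu] in
   [Mplus E] with [E] compact this only happens on a Lebesgue-null set. *)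
Definition riesz_transform (s : R) mu x : 'rV[R]_d :=
  lim (riesz_truncated s mu eps x @[eps --> 0^'+])%R.

Definition gamma_plus (s : R) E : \bar R :=
  ereal_sup [set mu E | mu in
    [set mu | Mplus E mu /\
      'N[lebesgue_rV d]_(+oo)[EFin \o enorm \o riesz_transform s mu]
        <= 1]].

(* [powR] sends [0] to [0] for every nonzero exponent, so the value [+oo] at
   the origin has to be given separately. *)
Definition riesz_kernel (A alpha : R) x : \bar R :=
  if x == 0%R then +oo else (A / enorm x `^ (d%:R - alpha))%:E.

Definition riesz_potential (A alpha : R) mu x : \bar R :=
  \int[mu]_y riesz_kernel A alpha (x - y)%R.

(* In [\bar R], [(+oo)^-1 = 0]. Adding [0] only matters when there is no
   nonzero measure in [Mplus E], i.e. when [E] is empty. *)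
Definition riesz_capacity (A alpha p : R) E : \bar R :=
  ereal_sup ([set 0] `|`
    [set (mu E / 'N[lebesgue_rV d]_(hoelder_conjugate p%:E)
                   [riesz_potential A alpha mu]) `^ p
      | mu in [set mu | Mplus E mu /\ mu E != 0]]).

End capacities.

(* Main.v *)
Require Import Defs.
From HB Require Import structures.
From mathcomp Require Import all_boot all_order all_algebra.
From mathcomp Require Import all_classical all_reals all_analysis.
From mathcomp Require Import measurable_realfun ess_sup_inf.
From mathcomp Require Import ring lra.

(** The idea is to build, inside the support of a measure mu admissible for the
Riesz capacity, a measure that is admissible for the other capacity and has
comparable mass.

Energy.  With p = 3/2 the dual exponent is 3, and the cube of the Riesz potential
dominates a sum over the dyadic scales r_k of the cubes of
mu(B(x,r_k)) r_k^(alpha-d), because the cube of a sum of nonnegative numbers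
exceeds the sum of the cubes.  Integrating over boxes around the points of the
support turns one factor mu(B) into an integral against mu, and since
3(d-alpha) = d+2s this leaves the Wolff energy, the integral of
W = sum_k (mu(B(x,r_k))/r_k^s)^2 ([energy_le_potential]).  By Chebyshev W is
bounded on a set carrying half of the mass ([good_set]); restricting mu to it and
rescaling gives a measure, still called mu, with W <= 1 on a set that carries it.

Quadratic estimates.  Let K be the operator with kernel k, a Riesz kernel
regularized at a dyadic scale.  As k is antisymmetric, the cyclic sum of
k(x,y)k(x,z) is much smaller than its terms can be (the mechanism behind Menger
curvature): it is bounded by a dyadic kernel whose integral is controlled by W.
Hence the integral of f(Kf)^2 is at most C times that of f for 0 <= f <= 2
([energy_bound]), and a comparison of f with f+g gives the same kind of bound for
f(Kg)^2 ([cross_energy_bound]).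

From quadratic to uniform bounds.  An L^2 bound alone does not produce a density
h with K(h mu) bounded at every point and every scale; a minimax argument does.
First, points x_j with weights a_j of sum at most 1 are given, and h may depend
on them: h is what is left of mu after removing the mass m a_j/2 nearest
to each x_j in turn, m being the total mass.  Near x_j nothing is left at small
scales, so |Kh(x_j)| is at most a constant plus the average of |Kh| over a ball
around x_j on which mu is doubling ([potential_le_average]).  The removed pieces
add up to at most mu, which bounds the overlap of these balls in
L^2 ([ball_overlap]), and with the quadratic estimate
sum_j a_j |Kh(x_j)| <= C ([greedy_response]).  Second, densities with values in
[0,1] and mass at least m/2 form a convex set, so a response to every system of
weights gives one density good for all of finitely many constraints; this
minimax step is done by Blackwell's approachability recursion ([approach]).
Passing from finitely to countably many constraints uses almost minimal L^2 norms
and the parallelogram identity ([countable_constraints]).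

Conclusion.  The constraints are the coordinates of the potentials at the points
with rational coordinates and at all dyadic scales; Lipschitz continuity of the
regularized potentials extends them to all points
([everywhere_bounded_density]).  The sharp truncation at scale r differs from the
regularized one by at most r^(-s) mu(B(x,r)), which is bounded.  So a fixed multiple
of h mu has all its truncated transforms, at all dyadic scales, in the unit ball,
and therefore also their limit wherever it exists ([gamma_plus_ge]).  Keeping track of
the masses gives the power 3/2 ([finite_comparison]). *)

Set Implicit Arguments.
Unset Strict Implicit.
Unset Printing Implicit Defensive.

Import Order.TTheory GRing.Theory Num.Theory.
Import numFieldNormedType.Exports.

Local Open Scope classical_set_scope.
Local Open Scope ring_scope.

(** * Integrals of bounded measurable functions *)

Section bounded_measurable.
Context {R : realType}.

(** The class in which all test functions and kernels below live: it is an algebra,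
its members are integrable for every finite measure, and it is stable under
partial integration, so that Fubini applies without further conditions. *)
Definition bmf d (T : measurableType d) (f : T -> R) : Prop :=
  measurable_fun [set: T] f /\ exists M, forall x, `|f x| <= M.

Context d (T : measurableType d).
Implicit Types (f g : T -> R).

Lemma bmf_cst c : bmf (fun _ : T => c).
Proof. by split; [exact: measurable_cst|exists `|c|]. Qed.

Lemma bmfD f g : bmf f -> bmf g -> bmf (fun x => f x + g x).
Proof.
move=> [mf [M fM]] [mg [N gN]]; split; first exact: measurable_funD.
by exists (M + N) => x; rewrite (le_trans (ler_normD _ _))// lerD.
Qed.

Lemma bmfM f g : bmf f -> bmf g -> bmf (fun x => f x * g x).
Proof.
move=> [mf [M fM]] [mg [N gN]]; split; first exact: measurable_funM.
by exists (M * N) => x; rewrite normrM ler_pM.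
Qed.

Lemma bmfZ c f : bmf f -> bmf (fun x => c * f x).
Proof. by move=> bf; apply: bmfM => //; exact: bmf_cst. Qed.

Lemma bmfN f : bmf f -> bmf (fun x => - f x).
Proof.
move=> bf; rewrite (_ : (fun _ => _) = (fun x => (-1) * f x)); first exact: bmfZ.
by apply/funext => x; rewrite mulN1r.
Qed.

Lemma bmfB f g : bmf f -> bmf g -> bmf (fun x => f x - g x).
Proof. by move=> bf bg; apply: bmfD => //; exact: bmfN. Qed.

Lemma bmf_sqr f : bmf f -> bmf (fun x => f x ^+ 2).
Proof. by move=> bf; under eq_fun do rewrite expr2; exact: bmfM. Qed.

Lemma bmf_norm f : bmf f -> bmf (fun x => `|f x|).
Proof.
move=> [mf [M fM]]; split; first exact: measurableT_comp.
by exists M => x; rewrite normr_id.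
Qed.

Lemma bmf_sum (I : Type) (s : seq I) (P : pred I) (F : I -> T -> R) :
  (forall i, bmf (F i)) -> bmf (fun x => \sum_(i <- s | P i) F i x).
Proof.
move=> bF; elim: s => [|i s IH].
  by under eq_fun do rewrite big_nil; exact: bmf_cst.
under eq_fun do rewrite big_cons.
by case: (P i) => //; apply: bmfD.
Qed.

Lemma bmf_bool (b : T -> bool) :
  measurable_fun [set: T] b -> bmf (fun x => (b x)%:R : R).
Proof.
move=> mb; split.
  rewrite (_ : (fun _ => _) = (fun x => if b x then 1 else 0 : R)); last first.
    by apply/funext => x; case: (b x).
  by apply: measurable_fun_ifT => //; exact: measurable_cst.
by exists 1 => x; case: (b x); rewrite ?normr1 ?normr0.
Qed.

Lemma bmf_comp d' (S : measurableType d') (f : T -> R) (g : S -> T) :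
  measurable_fun [set: S] g -> bmf f -> bmf (fun x => f (g x)).
Proof.
by move=> mg [mf [M fM]]; split; [exact: measurableT_comp|exists M].
Qed.

Lemma bmf_le (f : T -> R) M : measurable_fun [set: T] f ->
  (forall x, `|f x| <= M) -> bmf f.
Proof. by move=> mf fM; split => //; exists M. Qed.

End bounded_measurable.

Section bounded_integral.
Context d (T : measurableType d) (R : realType).
Variable mu : {finite_measure set T -> \bar R}.
Implicit Types (f g : T -> R).

Lemma bmf_integrable f : bmf f -> mu.-integrable [set: T] (EFin \o f).
Proof.
move=> [mf [M fM]]; apply: measurable_bounded_integrable => //.
  exact: fin_num_fun_lty (fin_num_measure mu).
exists M; split; first exact: num_real.
by move=> N MN x _ /=; rewrite (le_trans (fM x))// ltW.
Qed.

Lemma IntD f g : bmf f -> bmf g ->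
  \int[mu]_x (f x + g x) = \int[mu]_x f x + \int[mu]_x g x.
Proof. by move=> bf bg; rewrite RintegralD//; exact: bmf_integrable. Qed.

Lemma IntB f g : bmf f -> bmf g ->
  \int[mu]_x (f x - g x) = \int[mu]_x f x - \int[mu]_x g x.
Proof. by move=> bf bg; rewrite RintegralB//; exact: bmf_integrable. Qed.

Lemma IntZ c f : bmf f -> \int[mu]_x (c * f x) = c * \int[mu]_x f x.
Proof. by move=> bf; rewrite RintegralZl//; exact: bmf_integrable. Qed.

Lemma Int0 : \int[mu]_x (0 : R) = 0.
Proof. by rewrite Rintegral_cst// mul0r. Qed.

Lemma Int_sum (I : Type) (s : seq I) (P : pred I) (F : I -> T -> R) :
  (forall i, bmf (F i)) ->
  \int[mu]_x (\sum_(i <- s | P i) F i x) =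
  \sum_(i <- s | P i) \int[mu]_x F i x.
Proof.
move=> bF; elim: s => [|i s IH].
  by rewrite big_nil -[RHS]Int0; apply: eq_Rintegral => x _; rewrite big_nil.
under eq_Rintegral do rewrite big_cons.
rewrite big_cons; case: (P i) => //.
by rewrite IntD ?IH//; exact: bmf_sum.
Qed.

Lemma Int_ge0 f : (forall x, 0 <= f x) -> 0 <= \int[mu]_x f x.
Proof. by move=> f0; apply: Rintegral_ge0. Qed.

Lemma Int_le f g : bmf f -> bmf g -> (forall x, f x <= g x) ->
  \int[mu]_x f x <= \int[mu]_x g x.
Proof. by move=> bf bg fg; apply: le_Rintegral => //; exact: bmf_integrable. Qed.

(** A measure concentrated on [G] only sees inequalities on [G]; this is how bounds
available on the support alone are used. *)
Lemma Int_le_on (G : set T) f g : measurable G -> mu (~` G) = 0%E ->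
  bmf f -> bmf g -> (forall x, G x -> f x <= g x) ->
  \int[mu]_x f x <= \int[mu]_x g x.
Proof.
move=> mG G0 bf bg fg.
have E (h : T -> R) : bmf h -> \int[mu]_x h x = \int[mu]_(x in G) h x.
  move=> bh; rewrite /Rintegral; congr fine.
  rewrite (@negligible_integral _ _ _ mu setT (~` G))//.
  - by rewrite setDE setCK setTI.
  - exact: measurableC.
  - exact: bmf_integrable.
rewrite E// E//; apply: le_Rintegral => //.
  by apply: (@integrableS _ _ _ mu setT) => //; exact: bmf_integrable.
by apply: (@integrableS _ _ _ mu setT) => //; exact: bmf_integrable.
Qed.

Lemma Int_norm f : bmf f -> `|\int[mu]_x f x| <= \int[mu]_x `|f x|.
Proof. by move=> bf; apply: le_normr_Rintegral => //; exact: bmf_integrable. Qed.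

Lemma Int_EFin f : bmf f -> (\int[mu]_x f x)%:E = (\int[mu]_x (f x)%:E)%E.
Proof.
move=> bf; rewrite /Rintegral fineK//.
by apply: integrable_fin_num => //; exact: (bmf_integrable bf).
Qed.

End bounded_integral.

Section bounded_fubini.
Context d1 d2 (S : measurableType d1) (T : measurableType d2) (R : realType).

Lemma bmf_section (F : S * T -> R) x : bmf F -> bmf (fun y => F (x, y)).
Proof. by move=> bF; apply: bmf_comp => //; exact: pair1_measurable. Qed.

Lemma bmf_section2 (F : S * T -> R) y : bmf F -> bmf (fun x => F (x, y)).
Proof. by move=> bF; apply: bmf_comp => //; exact: pair2_measurable. Qed.

Lemma bmf_integrable2 (m1 : {finite_measure set S -> \bar R})
    (m2 : {finite_measure set T -> \bar R}) (F : S * T -> R) :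
  bmf F -> (m1 \x m2)%E.-integrable [set: S * T] (EFin \o F).
Proof.
move=> bF; have [mF [M FM]] := bF.
apply/integrable12ltyP; first exact/measurable_EFinP.
apply: (@le_lt_trans _ _ (\int[m1]_x \int[m2]_y M%:E)%E).
  apply: ge0_le_integral => //.
  - by move=> x _; exact: integral_ge0.
  - apply: (@measurable_fun_fubini_tonelli_F _ _ _ _ _ m2 (fun z => `|(F z)%:E|%E)) => //.
    by apply: measurableT_comp => //; exact/measurable_EFinP.
  - move=> x _; apply: ge0_le_integral => //.
    + apply: measurableT_comp => //; apply/measurable_EFinP.
      by have [] := bmf_section x bF.
    + by move=> y _; rewrite /= lee_fin; exact: FM.
under eq_integral do rewrite integral_cst//.
rewrite integral_cst// ltey_eq; apply/orP; left.
by rewrite !fin_numM// fin_num_measure.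
Qed.

Lemma bmf_int (mu : {finite_measure set T -> \bar R}) (F : S * T -> R) :
  bmf F -> bmf (fun x => \int[mu]_y F (x, y)).
Proof.
move=> bF; have [mF [M FM]] := bF; split.
  have [[x]|/forallNP noS] := pselect (exists x : S, True); last first.
    move=> _ Y mY; rewrite setTI [X in measurable X](_ : _ = set0)//.
    by rewrite -subset0 => x; have := noS x.
  move=> _; apply: (measurableT_comp (fine_measurable measurableT)) => //.
  (* Measurability in x involves no measure on S; the Dirac mass only serves to
     state it on a product of measure spaces. *)
  exact: (measurable_fubini_F (bmf_integrable2 (dirac x) mu bF)).
exists (\int[mu]_y M) => x.
have bx := bmf_section x bF.
rewrite (le_trans (Int_norm mu bx))//; apply: Int_le => //.
  exact: bmf_norm.
exact: bmf_cst.
Qed.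

Lemma Int_swap (m1 : {finite_measure set S -> \bar R})
    (m2 : {finite_measure set T -> \bar R}) (F : S * T -> R) : bmf F ->
  \int[m1]_x \int[m2]_y F (x, y) = \int[m2]_y \int[m1]_x F (x, y).
Proof.
move=> bF; rewrite /Rintegral; congr fine.
transitivity (\int[m1]_x \int[m2]_y (F (x, y))%:E)%E.
  by apply: eq_integral => x _; rewrite -Int_EFin//; exact: bmf_section.
rewrite (Fubini (bmf_integrable2 m1 m2 bF)) /=.
by apply: eq_integral => y _; rewrite -(Int_EFin m1 (bmf_section2 y bF)).
Qed.

End bounded_fubini.

Section triple_integral.
Context d (T : measurableType d) (R : realType).
Variable mu : {finite_measure set T -> \bar R}.

Definition Int3 (F : T -> T -> T -> R) :=
  \int[mu]_x \int[mu]_y \int[mu]_z F x y z.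

(** The two exchanges of Fubini realizing a 3-cycle of the variables. *)
Lemma Int3_cycle (F : T -> T -> T -> R) :
  bmf (fun p : T * T * T => F p.1.1 p.1.2 p.2) ->
  Int3 (fun x y z => F y z x) = Int3 F.
Proof.
move=> bF.
rewrite /Int3 (@Int_swap _ _ _ _ _ mu mu
  (fun p => \int[mu]_z F p.2 z p.1)); last first.
  apply: (@bmf_int _ _ _ _ _ mu (fun q : (T * T) * T => F q.1.2 q.2 q.1.1)).
  apply: (bmf_comp (g := fun q : (T * T) * T => (q.1.2, q.2, q.1.1)) _ bF).
  by do !apply: measurable_fun_pair => //=; exact: measurableT_comp.
apply: eq_Rintegral => y _ /=.
rewrite (@Int_swap _ _ _ _ _ mu mu (fun p => F y p.2 p.1))//.
apply: (bmf_comp (g := fun q : T * T => (y, q.2, q.1)) _ bF).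
by do !apply: measurable_fun_pair => //=.
Qed.

End triple_integral.

(** * Symmetrization of triple integrals *)

Section real_lemmas.
Context {R : realType}.

Lemma geometric_half_le (n : nat) : \sum_(i < n) (2^-1 : R) ^+ i <= 2.
Proof.
have -> : \sum_(i < n) (2^-1 : R) ^+ i = 2 - 2 * 2^-1 ^+ n.
  elim: n => [|n IH]; first by rewrite big_ord0 expr0; lra.
  by rewrite big_ord_recr/= IH exprS; lra.
by rewrite gerBl mulr_ge0// exprn_ge0// invr_ge0.
Qed.

(** Schur's test for the matrix 2^-(k-j), whose row and column sums are at most 2:
it decouples the product of two scales into a sum over a single one. *)
Lemma schur_half (n : nat) (a : nat -> R) :
  \sum_(j < n) \sum_(k < n | (j <= k)%N) (2^-1) ^+ (k - j) * (a k * a j) <=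
  2 * \sum_(k < n) a k ^+ 2.
Proof.
pose w (j k : nat) : R := (2^-1) ^+ (k - j).
have w0 j k : 0 <= w j k by rewrite exprn_ge0// invr_ge0.
have row (j : 'I_n) : \sum_(k < n | (j <= k)%N) w j k <= 2.
  apply: le_trans (geometric_half_le (n - j)).
  rewrite -(big_mkord (fun k => (j <= k)%N) (w j)) -(big_mkord xpredT (fun i => 2^-1 ^+ i)).
  rewrite (big_cat_nat (n := j))//=; last exact/ltnW.
  rewrite big_nat_cond big_pred0 ?add0r; last first.
    by move=> i; rewrite leq0n/=; case: ltnP => //= /ltn_geF ->.
  rewrite -{1}(add0n (nat_of_ord j)) big_addn.
  rewrite big_mkcond/=; apply: ler_sum => i _; rewrite /w.
  by rewrite leq_addl addnK.
have col (k : 'I_n) : \sum_(j < n | (j <= k)%N) w j k <= 2.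
  apply: le_trans (geometric_half_le k.+1).
  rewrite (eq_bigl (fun j : 'I_n => (j < k.+1)%N))//.
  rewrite -(big_ord_widen_cond _ xpredT (w^~ k))//.
  rewrite (reindex_inj rev_ord_inj)/=.
  by apply: ler_sum => i _; rewrite /w subSS subKn// -ltnS.
(* Each product is split by the inequality of the means: one half is summed
   along columns, the other along rows. *)
have amgm x y : x * y <= 2^-1 * x ^+ 2 + 2^-1 * y ^+ 2 :> R.
  have : 0 <= (x - y) ^+ 2 by exact: sqr_ge0.
  by rewrite sqrrB mulr2n; lra.
apply: (@le_trans _ _ (\sum_(j < n) \sum_(k < n | (j <= k)%N)
   (w j k * (2^-1 * a k ^+ 2) + w j k * (2^-1 * a j ^+ 2)))).
  apply: ler_sum => j _; apply: ler_sum => k _.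
  by rewrite -mulrDr; apply: ler_wpM2l => //; exact: amgm.
under eq_bigr do rewrite big_split/=.
rewrite big_split/=.
have -> : 2 * \sum_(k < n) a k ^+ 2 =
    \sum_(k < n) a k ^+ 2 + \sum_(k < n) a k ^+ 2 by rewrite mulr_natl mulr2n.
apply: lerD.
  rewrite (exchange_big_dep xpredT)//=; apply: ler_sum => k _.
  rewrite -mulr_suml; have := col k; have := sqr_ge0 (a k); nra.
apply: ler_sum => j _.
rewrite -mulr_suml; have := row j; have := sqr_ge0 (a j); nra.
Qed.

End real_lemmas.

Section triple_cyclic_le.
Context d (T : measurableType d) (R : realType).
Variable mu : {finite_measure set T -> \bar R}.

Lemma bmf_Int3 (F : T -> T -> T -> R) :
  bmf (fun p : T * T * T => F p.1.1 p.1.2 p.2) ->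
  [/\ forall x y, bmf (F x y),
      bmf (fun p : T * T => \int[mu]_z F p.1 p.2 z),
      forall x, bmf (fun y => \int[mu]_z F x y z) &
      bmf (fun x => \int[mu]_y \int[mu]_z F x y z)].
Proof.
move=> bF.
have b2 : bmf (fun p : T * T => \int[mu]_z F p.1 p.2 z) by exact: bmf_int bF.
split => //.
- by move=> x y; exact: (bmf_section (x, y) bF).
- by move=> x; exact: (bmf_section x b2).
- exact: bmf_int b2.
Qed.

Lemma bmf_cycle (F : T -> T -> T -> R) :
  bmf (fun p : T * T * T => F p.1.1 p.1.2 p.2) ->
  bmf (fun p : T * T * T => F p.1.2 p.2 p.1.1).
Proof.
move=> bF; apply: (bmf_comp (g := fun q : (T * T) * T => (q.1.2, q.2, q.1.1)) _ bF).
by do !apply: measurable_fun_pair => //=; exact: measurableT_comp.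
Qed.

Lemma Int3D (F H : T -> T -> T -> R) :
  bmf (fun p : T * T * T => F p.1.1 p.1.2 p.2) ->
  bmf (fun p : T * T * T => H p.1.1 p.1.2 p.2) ->
  Int3 mu (fun x y z => F x y z + H x y z) = Int3 mu F + Int3 mu H.
Proof.
move=> /bmf_Int3[F1 _ F2 F3] /bmf_Int3[H1 _ H2 H3].
rewrite /Int3 -IntD//; apply: eq_Rintegral => x _.
rewrite -IntD//; apply: eq_Rintegral => y _.
by rewrite -IntD.
Qed.

Variables (G : set T) (mG : measurable G) (muG : mu (~` G) = 0%E).

Lemma Int3_le_on (F H : T -> T -> T -> R) :
  bmf (fun p : T * T * T => F p.1.1 p.1.2 p.2) ->
  bmf (fun p : T * T * T => H p.1.1 p.1.2 p.2) ->
  (forall x y z, G x -> G y -> G z -> F x y z <= H x y z) ->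
  Int3 mu F <= Int3 mu H.
Proof.
move=> /bmf_Int3[F1 _ F2 F3] /bmf_Int3[H1 _ H2 H3] FH.
apply: (Int_le_on mG muG) => // x Gx.
apply: (Int_le_on mG muG) => // y Gy.
by apply: (Int_le_on mG muG) => // z Gz; exact: FH.
Qed.

(** The integral of a kernel and of its two cyclic permutations agree, so a
comparison of cyclic sums suffices, even where the kernels themselves are not
comparable.  All cancellation in the quadratic estimates enters here. *)
Lemma Int3_cyclic_le (F H : T -> T -> T -> R) :
  bmf (fun p : T * T * T => F p.1.1 p.1.2 p.2) ->
  bmf (fun p : T * T * T => H p.1.1 p.1.2 p.2) ->
  (forall x y z, G x -> G y -> G z ->
    F x y z + F y z x + F z x y <= H x y z + H y z x + H z x y) ->
  Int3 mu F <= Int3 mu H.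
Proof.
move=> bF bH FH.
have E (K : T -> T -> T -> R) : bmf (fun p : T * T * T => K p.1.1 p.1.2 p.2) ->
    Int3 mu (fun x y z => K x y z + K y z x + K z x y) = Int3 mu K *+ 3.
  move=> bK; have b1 := bmf_cycle bK.
  have b2 := @bmf_cycle (fun x y z => K y z x) b1.
  rewrite (Int3D (F := fun x y z => K x y z + K y z x)
     (H := fun x y z => K z x y))//; last exact: bmfD.
  rewrite (Int3D (H := fun x y z => K y z x))//.
  rewrite (Int3_cycle mu (F := fun x y z => K y z x))// (Int3_cycle mu bK).
  by rewrite !mulrS mulr0n addr0 addrA.
have b3 (K : T -> T -> T -> R) : bmf (fun p : T * T * T => K p.1.1 p.1.2 p.2) ->
    bmf (fun p : T * T * T => K p.1.1 p.1.2 p.2 + K p.1.2 p.2 p.1.1 + K p.2 p.1.1 p.1.2).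
  move=> bK; have b1 := bmf_cycle bK.
  have b2 := @bmf_cycle (fun x y z => K y z x) b1.
  exact: bmfD (bmfD bK b1) b2.
have := Int3_le_on (b3 F bF) (b3 H bH) FH.
by rewrite (E F bF) (E H bH) lerMn2r.
Qed.

End triple_cyclic_le.

(** * Measures with bounded Wolff sums *)

Section wolff_definitions.
Context d (T : measurableType d) (R : realType).

Definition scale (M : R) (k : nat) : R := M * 2^-1 ^+ k.

Definition ball_mass (mu : {finite_measure set T -> \bar R}) (dist : T -> T -> R)
  (x : T) (r : R) : R := \int[mu]_y (dist x y <= r)%R%:R.

(** The properties of the measure and of the Euclidean distance on which the
potential theory rests.  The sums of [wb_wolff] are the dyadic form of Wolff's
potential attached to the kernel of homogeneity -s, squared. *)
Record wolff_bounded (mu : {finite_measure set T -> \bar R})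
    (dist : T -> T -> R) (s M : R) (G : set T) : Prop := {
  wb_s : 0 < s;
  wb_M : 0 < M;
  wb_ge0 : forall x y, 0 <= dist x y;
  wb_refl : forall x, dist x x = 0;
  wb_sym : forall x y, dist x y = dist y x;
  wb_tri : forall x y z, dist x z <= dist x y + dist y z;
  wb_meas : measurable_fun [set: T * T] (fun p => dist p.1 p.2);
  wb_mG : measurable G;
  wb_muG : mu (~` G) = 0%E;
  wb_diam : forall x y, G x -> G y -> dist x y <= M;
  wb_wolff : forall x, G x -> forall N,
    \sum_(k < N) (ball_mass mu dist x (scale M k) / scale M k `^ s) ^+ 2 <= 1
}.

(** An antisymmetric kernel of homogeneity -s, truncated smoothly at [eps].  The
bounds are multiplied out because the distance may vanish; [rt_reg] is the
Lipschitz estimate at the smaller of the two distances. *)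
Record riesz_type (dist : T -> T -> R) (s L eps : R) (k : T -> T -> R) : Prop := {
  rt_meas : measurable_fun [set: T * T] (fun p => k p.1 p.2);
  rt_anti : forall x y, k y x = - k x y;
  rt_size : forall x y, `|k x y| * (Num.max (dist x y) eps) `^ s <= 1;
  rt_reg : forall x y z,
    let W := Num.max (Num.min (dist x z) (dist y z)) eps in
    `|k x z - k y z| * (W `^ s * W) <= L * dist x y
}.

End wolff_definitions.

Section scales.
Context {R : realType} (M : R).
Hypothesis M0 : 0 < M.

Lemma scale_gt0 k : 0 < scale M k.
Proof. by rewrite mulr_gt0// exprn_gt0// invr_gt0. Qed.

Lemma scaleS k : scale M k = 2 * scale M k.+1.
Proof. by rewrite /scale exprS; lra. Qed.

Lemma scale_le j k : (j <= k)%N -> scale M k <= scale M j.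
Proof.
move=> jk; rewrite ler_wpM2l ?(ltW M0)//.
by apply: ler_wiXn2l => //; lra.
Qed.

Lemma scale_ratio j k : (j <= k)%N -> scale M k / scale M j = 2^-1 ^+ (k - j).
Proof.
move=> jk; apply: (canLR (mulfK _)); first by rewrite gt_eqF// scale_gt0.
by rewrite /scale mulrCA -exprD subnK.
Qed.

Lemma scale_small (t : R) : 0 < t -> exists n, scale M n <= t.
Proof.
move=> t0; exists (Num.bound (M / t)).
rewrite /scale exprVn ler_pdivrMr ?exprn_gt0//.
have : M / t < (Num.bound (M / t))%:R by apply: archi_boundP; rewrite divr_ge0 ?ltW.
rewrite ltr_pdivrMr// => /ltW/le_trans; apply.
rewrite mulrC ler_wpM2l ?(ltW t0)//.
by rewrite -natrX ler_nat ltnW// ltn_expl.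
Qed.

(** The last dyadic radius, among the first [n], that is not smaller than [t]. *)
Lemma scale_find n (t : R) : scale M n <= t -> t <= M ->
  exists k, [/\ (k <= n)%N, t <= scale M k, scale M k <= 2 * t &
    forall i, (i <= n)%N -> t <= scale M i -> (i <= k)%N].
Proof.
move=> nt tM.
have ex : exists k, (k <= n)%N && (t <= scale M k).
  by exists 0%N; rewrite leq0n /scale expr0 mulr1.
have ub k : (k <= n)%N && (t <= scale M k) -> (k <= n)%N by case/andP.
case: (ex_maxnP ex ub) => k /andP[kn tk] kmax.
exists k; split => //; last by move=> i ile ti; apply: kmax; rewrite ile.
have := kn; rewrite leq_eqVlt => /predU1P[kE|kltn].
  by have := scale_gt0 k; move: nt; rewrite -kE => ? ?; lra.
rewrite scaleS ler_pM2l//; rewrite leNgt; apply/negP => /ltW lt.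
by have := kmax k.+1; rewrite kltn lt ltnn => /(_ isT).
Qed.

End scales.

Section powR_lemmas.
Context {R : realType}.
Implicit Types s a b : R.

Lemma le_powR s a b : 0 <= s -> 0 <= a -> a <= b -> a `^ s <= b `^ s.
Proof.
move=> s0 a0 ab; apply: ge0_ler_powR => //; rewrite nnegrE//.
exact: le_trans ab.
Qed.

End powR_lemmas.

Section wolff_space.
Context d (T : measurableType d) (R : realType).
Variables (mu : {finite_measure set T -> \bar R}) (dist : T -> T -> R).
Variables (s M : R) (G : set T).
Hypothesis WB : wolff_bounded mu dist s M G.
Let s0 : 0 < s := wb_s WB.
Let M0 : 0 < M := wb_M WB.
Let dC := wb_sym WB.
Let dge0 := wb_ge0 WB.
Let dtri := wb_tri WB.
Let mG := wb_mG WB.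
Let muG := wb_muG WB.
Local Notation V := (ball_mass mu dist).
Local Notation r := (scale M).

Lemma measurable_dist d' (X : measurableType d') (f g : X -> T) :
  measurable_fun [set: X] f -> measurable_fun [set: X] g ->
  measurable_fun [set: X] (fun x => dist (f x) (g x)).
Proof.
move=> mf mg.
exact: (measurableT_comp (wb_meas WB) (measurable_fun_pair mf mg)).
Qed.

Lemma bmf_ball_pair (t : R) : bmf (fun p : T * T => (dist p.1 p.2 <= t)%R%:R : R).
Proof.
by apply: bmf_bool; apply: measurable_fun_ler; [exact: (wb_meas WB)|exact: measurable_cst].
Qed.

Lemma bmf_ball x (t : R) : bmf (fun y => (dist x y <= t)%R%:R : R).
Proof. exact: (bmf_section x (bmf_ball_pair t)). Qed.

Lemma ball_mass_ge0 x t : 0 <= V x t.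
Proof. by apply: Int_ge0 => y; exact: ler0n. Qed.

Lemma ball_mass_le (x : T) (t u : R) : t <= u -> V x t <= V x u.
Proof.
move=> tu; apply: Int_le; [exact: bmf_ball|exact: bmf_ball|] => y.
by rewrite ler_nat; case: (leP (dist x y) t) => // /le_trans ->.
Qed.

Lemma wolff_ball x k : G x -> V x (r k) <= r k `^ s.
Proof.
move=> Gx; have := wb_wolff WB Gx k.+1.
rewrite big_ord_recr/= => h.
have p0 : 0 < r k `^ s by rewrite powR_gt0// scale_gt0.
have : (V x (r k) / r k `^ s) ^+ 2 <= 1.
  by apply: le_trans h; rewrite lerDr sumr_ge0// => i _; exact: sqr_ge0.
rewrite expr_le1// ?divr_ge0 ?ball_mass_ge0 ?powR_ge0//.
by rewrite ler_pdivrMr// mul1r.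
Qed.

(** At dyadic radii around points of [G] a single term of the Wolff sum gives the
growth bound.  A general ball, if it meets [G], lies on [G] in a ball of twice its
radius around a point of [G], and rounding up to a dyadic radius loses another
factor 2. *)
Lemma ball_mass_growth (y : T) (t : R) : 0 < t -> V y t <= 4 `^ s * t `^ s.
Proof.
move=> t0.
have [[x [Gx yx]]|noG] := pselect (exists x, G x /\ dist y x <= t); last first.
  apply: (@le_trans _ _ 0); last by rewrite mulr_ge0 ?powR_ge0.
  rewrite -(Int0 mu); apply: (Int_le_on mG muG); [exact: bmf_ball|exact: bmf_cst|].
  move=> z Gz; case: (leP (dist y z) t) => yz; last by [].
  by exfalso; apply: noG; exists z.
pose u := Num.min (2 * t) M.
have u0 : 0 < u by rewrite lt_min M0 andbT; lra.
have [n nu] := scale_small M0 u0.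
have uM : u <= M by rewrite ge_min lexx orbT.
have [k [_ uk ku _]] := scale_find M0 nu uM.
apply: (@le_trans _ _ (V x (r k))).
  apply: (Int_le_on mG muG); [exact: bmf_ball|exact: bmf_ball|] => z Gz.
  rewrite ler_nat; case: (leP (dist y z) t) => //= yz.
  rewrite lt0b; apply: le_trans uk; rewrite le_min (wb_diam WB Gx Gz) andbT.
  rewrite mulr_natl mulr2n; apply: le_trans (lerD yx yz).
  by rewrite (dC y x).
apply: le_trans (wolff_ball k Gx) _.
rewrite -powRM//; last exact: ltW.
apply: le_powR; [exact: ltW|exact/ltW/scale_gt0|].
apply: le_trans ku _; rewrite /u; have : Num.min (2 * t) M <= 2 * t.
  by rewrite ge_min lexx.
by lra.
Qed.

End wolff_space.

(** * Quadratic estimates for Riesz-type kernels *)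

Section symmetrization.
Context d (T : measurableType d) (R : realType).
Variables (mu : {finite_measure set T -> \bar R}) (dist : T -> T -> R).
Variables (s M : R) (G : set T).
Hypothesis WB : wolff_bounded mu dist s M G.
Let s0 : 0 < s := wb_s WB.
Let M0 : 0 < M := wb_M WB.
Let dC := wb_sym WB.
Let dge0 := wb_ge0 WB.
Let dtri := wb_tri WB.
Let mG := wb_mG WB.
Let muG := wb_muG WB.
Local Notation V := (ball_mass mu dist).
Local Notation r := (scale M).
Local Notation phi t := (t `^ s).
Local Notation c2 := (2 `^ s : R).
Variables (L : R) (n : nat) (k : T -> T -> R).
Hypothesis L0 : 0 <= L.
Hypothesis Hk : riesz_type dist s L (r n) k.
Let k_anti := rt_anti Hk.

Let c2_ge0 : 0 <= c2. Proof. exact: powR_ge0. Qed.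

Let phi2 (t u : R) : 0 <= t -> t <= 2 * u -> phi t <= c2 * phi u.
Proof.
move=> t0 tu; have u0 : 0 <= u by lra.
by rewrite -powRM//; apply: le_powR => //; exact: ltW.
Qed.

(** A dyadic version of |x-y|^(1-s) |x-z|^(-1-s) for |x-y| <= |x-z|: the factor
2^-(i-j) is the ratio of the two radii.  Unlike the product |x-y|^-s |x-z|^-s it
has a bounded integral, since [schur_half] applies to the sum over i and j. *)
Definition wolff_kernel (x y z : T) : R :=
  \sum_(j < n.+1) \sum_(i < n.+1 | (j <= i)%N) 2^-1 ^+ (i - j) *
    ((dist x y <= r i)%R%:R / phi (r i) * ((dist x z <= r j)%R%:R / phi (r j))).

Lemma wolff_kernel_term (i j : nat) x y z : (j <= i)%N -> (i <= n)%N ->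
  dist x y <= r i -> dist x z <= r j ->
  (r i / r j) / (phi (r i) * phi (r j)) <= wolff_kernel x y z.
Proof.
move=> ji ile xy xz.
have t0 (a b : nat) : 0 <= 2^-1 ^+ (b - a) *
    ((dist x y <= r b)%R%:R / phi (r b) * ((dist x z <= r a)%R%:R / phi (r a))).
  by rewrite !mulr_ge0// ?exprn_ge0 ?invr_ge0 ?powR_ge0//; exact: ler0n.
have jn : (j < n.+1)%N by rewrite ltnS (leq_trans ji).
have iln : (i < n.+1)%N by [].
rewrite /wolff_kernel (bigD1 (Ordinal jn))//= (bigD1 (Ordinal iln))//=.
rewrite xy xz -addrA scale_ratio// invfM !mul1r lerDl addr_ge0//.
  apply: sumr_ge0 => b _; rewrite mulr_ge0 ?exprn_ge0 ?invr_ge0//.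
  by rewrite !mulr_ge0 ?invr_ge0 ?powR_ge0//; exact: ler0n.
by apply: sumr_ge0 => a _; apply: sumr_ge0 => b _; exact: t0.
Qed.

Let pkernel x y z := k x y * k x z.

Let D := 4 * L * c2 ^+ 3 + c2 ^+ 3.

(** Let x, y be the closest pair.  By antisymmetry the cyclic sum is
k(x,y)(k(x,z) - k(y,z)) + k(x,z)k(y,z).  Regularity of k makes the first term
of order |x-y|^(1-s)|x-z|^(-1-s), and the second is of order |x-z|^(-2s): both are
terms of [wolff_kernel], the second with i = j. *)
Lemma symmetrized_bound_min x y z : G x -> G y -> G z ->
  dist x y <= dist x z -> dist x y <= dist y z ->
  `|pkernel x y z + pkernel y z x + pkernel z x y| <= D * wolff_kernel x y z.
Proof.
move=> Gx Gy Gz uv uw.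
have rn0 := scale_gt0 M0 n.
have rnM : r n <= M by rewrite -[leRHS]mulr1 -(expr0 2^-1) scale_le.
set u := dist x y in uv uw *; set v := dist x z in uv *.
set w := dist y z in uw *.
pose U := Num.max u (r n); pose Vv := Num.max v (r n).
have vw : v <= 2 * w by have := dtri x y z; rewrite -/u -/v -/w; lra.
have UM : U <= M by rewrite ge_max rnM (wb_diam WB Gx Gy).
have VM : Vv <= M by rewrite ge_max rnM (wb_diam WB Gx Gz).
have nU : r n <= U by rewrite le_max lexx orbT.
have nV : r n <= Vv by rewrite le_max lexx orbT.
have UV : U <= Vv by rewrite ge_max !le_max uv lexx orbT.
have [i [ile Ui iU imax]] := scale_find M0 nU UM.
have [j [jle Vj jV _]] := scale_find M0 nV VM.
have ji : (j <= i)%N by apply: imax => //; exact: le_trans UV Vj.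
have ri0 := scale_gt0 M0 i; have rj0 := scale_gt0 M0 j.
have Fi0 : 0 < phi (r i) by rewrite powR_gt0.
have Fj0 : 0 < phi (r j) by rewrite powR_gt0.
have uU : u <= U by rewrite le_max lexx.
have vV : v <= Vv by rewrite le_max lexx.
have u0 : 0 <= u by exact: dge0.
have U0 : 0 < U by exact: lt_le_trans nU.
have V0 : 0 < Vv by exact: lt_le_trans nV.
have -> : pkernel x y z + pkernel y z x + pkernel z x y =
    k x y * (k x z - k y z) + k x z * k y z.
  by rewrite /pkernel (k_anti x y) (k_anti x z) (k_anti y z); ring.
have FiU : phi (r i) <= c2 * phi U by apply: phi2 => //; exact: ltW.
have FjV : phi (r j) <= c2 * phi Vv by apply: phi2 => //; exact: ltW.
have W1 : Vv <= 2 * Num.max (Num.min v w) (r n).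
  have a1 : Num.min v w <= Num.max (Num.min v w) (r n) by rewrite le_max lexx.
  have a2 : r n <= Num.max (Num.min v w) (r n) by rewrite le_max lexx orbT.
  have a3 : v <= 2 * Num.min v w.
    by case: (leP v w) => _; have := dge0 x z; rewrite -/v; lra.
  rewrite ge_max; apply/andP; split; lra.
have W2 : Vv <= 2 * Num.max w (r n).
  have a1 : w <= Num.max w (r n) by rewrite le_max lexx.
  have a2 : r n <= Num.max w (r n) by rewrite le_max lexx orbT.
  rewrite ge_max; apply/andP; split; lra.
have t1 : `|k x y * (k x z - k y z)| <= 4 * L * c2 ^+ 3 * wolff_kernel x y z.
  rewrite normrM.
  have h1 := rt_size Hk x y; have h2 := rt_reg Hk x y z.
  rewrite -/u -/v -/w -/U in h1 h2.
  move: (Num.max (Num.min v w) (r n)) W1 h2 => W W1 /= h2.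
  have W0 : 0 < W by lra.
  have FV : phi (r j) <= c2 * (c2 * phi W).
    by apply: le_trans FjV _; rewrite ler_wpM2l// phi2// ltW.
  have rW : r j <= 4 * W by lra.
  apply: (@le_trans _ _ (4 * L * c2 ^+ 3 * (r i / r j / (phi (r i) * phi (r j))))).
    rewrite -[r i / r j / _]mulrA -invfM mulrA ler_pdivlMr ?mulr_gt0//.
    set a := `|k x y| in h1 *; set b := `|_ - _| in h2 *.
    have a0 : 0 <= a by exact: normr_ge0.
    have b0 : 0 <= b by exact: normr_ge0.
    apply: (@le_trans _ _ (a * b * ((4 * W) * ((c2 * phi U) * (c2 * (c2 * phi W)))))).
      apply: ler_wpM2l; first exact: mulr_ge0.
      apply: ler_pM => //; [exact: ltW|by rewrite mulr_ge0// ltW|].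
      by apply: ler_pM => //; exact: ltW.
    have -> : a * b * (4 * W * (c2 * phi U * (c2 * (c2 * phi W)))) =
        4 * c2 ^+ 3 * ((a * phi U) * (b * (phi W * W))) by ring.
    have -> : 4 * L * c2 ^+ 3 * r i = 4 * c2 ^+ 3 * (1 * (L * r i)) by ring.
    apply: ler_wpM2l; first by rewrite mulr_ge0// exprn_ge0.
    apply: ler_pM => //.
    - by rewrite mulr_ge0// powR_ge0.
    - by rewrite mulr_ge0// mulr_ge0 ?powR_ge0// ltW.
    - by apply: le_trans h2 _; rewrite ler_wpM2l//; lra.
  apply: ler_wpM2l; first by rewrite !mulr_ge0// exprn_ge0.
  by apply: wolff_kernel_term => //; rewrite -/u -/v; [lra|lra].
have t2 : `|k x z * k y z| <= c2 ^+ 3 * wolff_kernel x y z.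
  rewrite normrM.
  have h1 := rt_size Hk x z; have h2 := rt_size Hk y z.
  rewrite -/u -/v -/w -/Vv in h1 h2.
  move: (Num.max w (r n)) W2 h2 => W W2 /= h2.
  have FV : phi (r j) <= c2 * (c2 * phi W).
    by apply: le_trans FjV _; rewrite ler_wpM2l// phi2// ltW.
  apply: (@le_trans _ _ (c2 ^+ 3 * (r j / r j / (phi (r j) * phi (r j))))).
    rewrite divff ?gt_eqF// mul1r ler_pdivlMr ?mulr_gt0//.
    set a := `|k x z| in h1 *; set b := `|k y z| in h2 *.
    have a0 : 0 <= a by exact: normr_ge0.
    have b0 : 0 <= b by exact: normr_ge0.
    apply: (@le_trans _ _ (a * b * ((c2 * phi Vv) * (c2 * (c2 * phi W))))).
      apply: ler_wpM2l; first exact: mulr_ge0.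
      by apply: ler_pM => //; exact: ltW.
    have -> : a * b * (c2 * phi Vv * (c2 * (c2 * phi W))) =
        c2 ^+ 3 * ((a * phi Vv) * (b * phi W)) by ring.
    by rewrite ler_piMr ?exprn_ge0// mulr_ile1// mulr_ge0// powR_ge0.
  apply: ler_wpM2l; first by rewrite exprn_ge0.
  by apply: wolff_kernel_term => //; rewrite -/u -/v; [lra|lra].
apply: le_trans (ler_normD _ _) _.
by rewrite /D mulrDl lerD.
Qed.

Lemma wolff_kernel_ge0 x y z : 0 <= wolff_kernel x y z.
Proof.
apply: sumr_ge0 => a _; apply: sumr_ge0 => b _.
by rewrite !mulr_ge0// ?exprn_ge0 ?invr_ge0 ?powR_ge0//; exact: ler0n.
Qed.

(** Both sides are invariant under cyclic permutations, so the closest pair may be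
taken to be the first two points. *)
Lemma symmetrized_bound x y z : G x -> G y -> G z ->
  pkernel x y z + pkernel y z x + pkernel z x y <=
  D * (wolff_kernel x y z + wolff_kernel y z x + wolff_kernel z x y).
Proof.
move=> Gx Gy Gz.
have D0 : 0 <= D by rewrite addr_ge0 ?mulr_ge0 ?exprn_ge0.
have q0 := wolff_kernel_ge0.
apply: le_trans (ler_norm _) _.
have [xyz|yxz] := leP (dist x y) (dist x z).
  have [xyy|yyx] := leP (dist x y) (dist y z).
    apply: le_trans (symmetrized_bound_min Gx Gy Gz xyz xyy) _.
    by rewrite ler_wpM2l// -addrA lerDl addr_ge0.
  have := symmetrized_bound_min Gy Gz Gx; rewrite (dC y x) (dC z x) => h.
  rewrite -addrA addrC; apply: le_trans (h _ _) _; [lra|lra|].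
  by rewrite ler_wpM2l// addrAC lerDr addr_ge0.
have [xyy|yyx] := leP (dist x z) (dist y z).
  have := symmetrized_bound_min Gz Gx Gy; rewrite (dC z x) (dC z y) => h.
  rewrite addrC addrA; apply: le_trans (h _ _) _; [lra|lra|].
  by rewrite ler_wpM2l// lerDr addr_ge0.
have := symmetrized_bound_min Gy Gz Gx; rewrite (dC y x) (dC z x) => h.
rewrite -addrA addrC; apply: le_trans (h _ _) _; [lra|lra|].
by rewrite ler_wpM2l// addrAC lerDr addr_ge0.
Qed.

End symmetrization.

Section bmf_projections.
Context d (T : measurableType d) (R : realType).

Lemma bmf_pair_comp d' (S : measurableType d') (F : T * T -> R) (u v : S -> T) :
  measurable_fun [set: S] u -> measurable_fun [set: S] v ->
  bmf F -> bmf (fun p => F (u p, v p)).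
Proof.
by move=> mu mv; apply: bmf_comp; exact: measurable_fun_pair.
Qed.

End bmf_projections.

Section energy.
Context d (T : measurableType d) (R : realType).
Variables (mu : {finite_measure set T -> \bar R}) (dist : T -> T -> R).
Variables (s M : R) (G : set T).
Hypothesis WB : wolff_bounded mu dist s M G.
Let s0 : 0 < s := wb_s WB.
Let M0 : 0 < M := wb_M WB.
Let mG := wb_mG WB.
Let muG := wb_muG WB.
Local Notation V := (ball_mass mu dist).
Local Notation r := (scale M).
Local Notation phi t := (t `^ s).
Variables (L : R) (n : nat) (k : T -> T -> R).
Hypothesis L0 : 0 <= L.
Hypothesis Hk : riesz_type dist s L (r n) k.

Definition kernel_op (k : T -> T -> R) (f : T -> R) (x : T) : R := \int[mu]_y (k x y * f y).

Lemma riesz_type_bounded x y : `|k x y| <= (phi (r n))^-1.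
Proof.
have p0 : 0 < phi (r n) by rewrite powR_gt0// scale_gt0.
rewrite -[leRHS]mul1r ler_pdivlMr//; apply: le_trans (rt_size Hk x y).
rewrite ler_wpM2l//; apply: le_powR; [exact: ltW|exact/ltW/scale_gt0|].
by rewrite le_max lexx orbT.
Qed.

Lemma bmf_riesz_type : bmf (fun p : T * T => k p.1 p.2).
Proof.
by apply: (bmf_le (rt_meas Hk)) => p; exact: riesz_type_bounded.
Qed.

Lemma bmf_kernel_op f : bmf f -> bmf (kernel_op k f).
Proof.
move=> bf; apply: (@bmf_int _ _ _ _ _ mu (fun p => k p.1 p.2 * f p.2)).
by apply: bmfM; [exact: bmf_riesz_type|exact: bmf_comp bf].
Qed.

Lemma bmf_kernel_row x : bmf (k x).
Proof. exact: (bmf_section x bmf_riesz_type). Qed.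

Lemma kernel_opD f g x : bmf f -> bmf g ->
  kernel_op k (fun y => f y + g y) x = kernel_op k f x + kernel_op k g x.
Proof.
move=> bf bg; rewrite /kernel_op -IntD; [|by apply: bmfM => //; exact: bmf_kernel_row..].
by apply: eq_Rintegral => y _; rewrite mulrDr.
Qed.

Let D := 4 * L * (2 `^ s) ^+ 3 + (2 `^ s) ^+ 3 : R.

Let D0 : 0 <= D.
Proof. by rewrite addr_ge0 ?mulr_ge0 ?exprn_ge0 ?powR_ge0. Qed.

Let q := wolff_kernel dist s M n.

Let bmf_q : bmf (fun p : T * T * T => q p.1.1 p.1.2 p.2).
Proof.
apply: bmf_sum => j; apply: bmf_sum => i; apply: bmfZ.
have m11 : measurable_fun [set: T * T * T] (fun p => p.1.1).
  exact: (measurableT_comp measurable_fst measurable_fst).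
have m12 : measurable_fun [set: T * T * T] (fun p => p.1.2).
  exact: (measurableT_comp measurable_snd measurable_fst).
by apply: bmfM; (apply: bmfM; last exact: bmf_cst);
  apply: bmf_bool; apply: measurable_fun_ler; do ?exact: measurable_cst;
  exact: (measurable_dist WB).
Qed.

Lemma wolff_kernel_int x : G x -> \int[mu]_y \int[mu]_z q x y z <= 2.
Proof.
move=> Gx.
have bb t : bmf (fun y => (dist x y <= t)%R%:R : R) by exact: (bmf_ball WB).
have -> : \int[mu]_y \int[mu]_z q x y z =
    \sum_(j < n.+1) \sum_(i < n.+1 | (j <= i)%N) 2^-1 ^+ (i - j) *
      ((V x (r i) / phi (r i)) * (V x (r j) / phi (r j))).
  transitivity (\int[mu]_y \sum_(j < n.+1) \sum_(i < n.+1 | (j <= i)%N)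
      (2^-1 ^+ (i - j) * (V x (r j) / phi (r j)) / phi (r i)) *
       (dist x y <= r i)%R%:R).
    apply: eq_Rintegral => y _; rewrite /q /wolff_kernel Int_sum; last first.
      move=> j; apply: bmf_sum => i; apply: bmfZ; apply: bmfZ.
      by apply: bmfM => //; exact: bmf_cst.
    apply: eq_bigr => j _; rewrite Int_sum; last first.
      move=> i; apply: bmfZ; apply: bmfZ.
      by apply: bmfM => //; exact: bmf_cst.
    apply: eq_bigr => i _.
    under eq_Rintegral do rewrite [_ / phi (r j)]mulrC !mulrA.
    by rewrite IntZ// -/(V x (r j)); ring.
  rewrite Int_sum; last by move=> j; apply: bmf_sum => i; exact: bmfZ.
  apply: eq_bigr => j _; rewrite Int_sum; last by move=> i; exact: bmfZ.
  by apply: eq_bigr => i _; rewrite IntZ// -/(V x (r i)); ring.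
apply: le_trans (schur_half n.+1 (fun i => V x (r i) / phi (r i))) _.
by have := wb_wolff WB Gx n.+1; lra.
Qed.

(** The left-hand side is the triple integral of k(x,y)k(x,z)f(x)f(y)f(z), whose
weight is symmetric, so that only the cyclic sum of the kernels matters.  The
range up to 2 is there for sums of two densities. *)
Lemma energy_bound f : bmf f -> (forall x, 0 <= f x <= 2) ->
  \int[mu]_x (f x * kernel_op k f x ^+ 2) <= 8 * D * \int[mu]_x f x.
Proof.
move=> bf f02.
have f0 x : 0 <= f x by case/andP: (f02 x).
have m11 : measurable_fun [set: T * T * T] (fun p => p.1.1).
  exact: (measurableT_comp measurable_fst measurable_fst).
have m12 : measurable_fun [set: T * T * T] (fun p => p.1.2).
  exact: (measurableT_comp measurable_snd measurable_fst).
have bfff : bmf (fun p : T * T * T => f p.1.1 * (f p.1.2 * f p.2)).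
  apply: bmfM; first exact: (bmf_comp m11).
  apply: bmfM; [exact: (bmf_comp m12)|].
  exact: (bmf_comp (measurable_snd (T1 := (T * T)%type) (T2 := T)) bf).
pose P x y z := k x y * k x z * (f x * (f y * f z)).
pose Q x y z := D * (q x y z * (f x * (f y * f z))).
have bP : bmf (fun p : T * T * T => P p.1.1 p.1.2 p.2).
  apply: bmfM => //; apply: bmfM.
    exact: (bmf_pair_comp m11 m12 bmf_riesz_type).
  exact: (bmf_pair_comp m11 measurable_snd bmf_riesz_type).
have bQ : bmf (fun p : T * T * T => Q p.1.1 p.1.2 p.2).
  by apply: bmfZ; apply: bmfM.
have -> : \int[mu]_x (f x * kernel_op k f x ^+ 2) = Int3 mu P.
  apply: eq_Rintegral => x _.
  have bk : bmf (fun z => k x z * f z) by apply: bmfM => //; exact: bmf_kernel_row.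
  transitivity (\int[mu]_y ((f x * kernel_op k f x) * (k x y * f y))).
    by rewrite IntZ// -/(kernel_op k f x); ring.
  apply: eq_Rintegral => y _.
  transitivity (\int[mu]_z ((f x * (k x y * f y)) * (k x z * f z))).
    by rewrite IntZ// -/(kernel_op k f x); ring.
  by apply: eq_Rintegral => z _; rewrite /P; ring.
apply: (@le_trans _ _ (Int3 mu Q)).
  apply: (Int3_cyclic_le mG muG) => // x y z Gx Gy Gz.
  have := symmetrized_bound WB L0 Hk Gx Gy Gz; rewrite -/D.
  have fff0 : 0 <= f x * (f y * f z) by rewrite !mulr_ge0.
  move=> /(ler_wpM2r fff0); rewrite /P /Q.
  set a := (X in X <= _); set b := (X in _ <= X) => ab.
  have -> : k x y * k x z * (f x * (f y * f z)) +
    k y z * k y x * (f y * (f z * f x)) + k z x * k z y * (f z * (f x * f y)) = a.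
    by rewrite /a; ring.
  by apply: le_trans ab _; rewrite le_eqVlt; apply/orP; left; apply/eqP;
    rewrite /b /q; ring.
have [q1 q2 q3 q4] := bmf_Int3 mu bmf_q.
have bH : bmf (fun p : T * T * T => 4 * D * (f p.1.1 * q p.1.1 p.1.2 p.2)).
  by apply: bmfZ; apply: bmfM => //; exact: (bmf_comp m11).
apply: (@le_trans _ _ (Int3 mu (fun x y z => 4 * D * (f x * q x y z)))).
  apply: (Int3_le_on mG muG) => // x y z _ _ _; rewrite /Q.
  have q0 : 0 <= q x y z by exact: wolff_kernel_ge0.
  have -> : D * (q x y z * (f x * (f y * f z))) =
    D * ((f x * q x y z) * (f y * f z)) by ring.
  have -> : 4 * D * (f x * q x y z) = D * ((f x * q x y z) * (2 * 2)) by ring.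
  do 2 (apply: ler_wpM2l; first by rewrite ?mulr_ge0).
  by have /andP[? ?] := f02 y; have /andP[? ?] := f02 z; exact: ler_pM.
have -> : Int3 mu (fun x y z => 4 * D * (f x * q x y z)) =
    4 * D * \int[mu]_x (f x * \int[mu]_y \int[mu]_z q x y z).
  rewrite -IntZ; last exact: bmfM.
  apply: eq_Rintegral => x _; rewrite mulrA -IntZ//.
  by apply: eq_Rintegral => y _; rewrite -IntZ//; apply: eq_Rintegral => z _; rewrite mulrA.
have -> : 8 * D * \int[mu]_x f x = 4 * D * \int[mu]_x (2 * f x).
  by rewrite IntZ//; ring.
apply: ler_wpM2l; first exact: mulr_ge0.
apply: (Int_le_on mG muG); [exact: bmfM|exact: bmfZ|] => x Gx.
by rewrite mulrC; apply: ler_wpM2r => //; exact: wolff_kernel_int.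
Qed.

(** Where f is positive, Kg = K(f+g) - Kf, and f <= f+g; both squares are covered
by [energy_bound]. *)
Lemma cross_energy_bound f g : bmf f -> bmf g ->
  (forall x, 0 <= f x <= 1) -> (forall x, 0 <= g x <= 1) ->
  \int[mu]_x (f x * kernel_op k g x ^+ 2) <=
    32 * D * (\int[mu]_x f x + \int[mu]_x g x).
Proof.
move=> bf bg f01 g01.
have f0 x : 0 <= f x by case/andP: (f01 x).
have g0 x : 0 <= g x by case/andP: (g01 x).
have bfg := bmfD bf bg.
have e1 := energy_bound bf.
have e2 := energy_bound bfg.
have {}e1 : \int[mu]_x (f x * kernel_op k f x ^+ 2) <= 8 * D * \int[mu]_x f x.
  by apply: e1 => x; have /andP[? ?] := f01 x; apply/andP; split; lra.
have {}e2 : \int[mu]_x ((f x + g x) * kernel_op k (fun x => f x + g x) x ^+ 2) <=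
    8 * D * (\int[mu]_x f x + \int[mu]_x g x).
  rewrite -IntD//; apply: e2 => x; have /andP[? ?] := f01 x.
  by have /andP[? ?] := g01 x; apply/andP; split; lra.
have b1 : bmf (fun x => f x * kernel_op k f x ^+ 2).
  by apply: bmfM => //; apply: bmf_sqr; exact: bmf_kernel_op.
have b2 : bmf (fun x => (f x + g x) * kernel_op k (fun x => f x + g x) x ^+ 2).
  by apply: bmfM => //; apply: bmf_sqr; exact: bmf_kernel_op.
have b3 : bmf (fun x => f x * kernel_op k g x ^+ 2).
  by apply: bmfM => //; apply: bmf_sqr; exact: bmf_kernel_op.
have i0 : 0 <= \int[mu]_x g x by exact: Int_ge0.
have i1 : 0 <= \int[mu]_x f x by exact: Int_ge0.
apply: (@le_trans _ _ (\int[mu]_x (2 * ((f x + g x) * kernel_op k (fun x => f x + g x) x ^+ 2)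
    + 2 * (f x * kernel_op k f x ^+ 2)))).
  apply: Int_le => //; first by apply: bmfD; exact: bmfZ.
  move=> x; rewrite kernel_opD//; move: (kernel_op k f x) (kernel_op k g x) => a b.
  (* a and b are the values of Kf and Kg; the excess is a sum of squares. *)
  have -> : 2 * ((f x + g x) * (a + b) ^+ 2) + 2 * (f x * a ^+ 2) =
     f x * b ^+ 2 + (f x * (2 * a + b) ^+ 2 + 2 * (g x * (a + b) ^+ 2)) by ring.
  rewrite lerDl; apply: addr_ge0; first exact: mulr_ge0 (f0 x) (sqr_ge0 _).
  by apply: mulr_ge0 => //; exact: mulr_ge0 (g0 x) (sqr_ge0 _).
rewrite IntD; [|exact: bmfZ..]; rewrite !IntZ//.
have := mulr_ge0 D0 i0; have := mulr_ge0 D0 i1; move: e1 e2.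
move: (\int[mu]_x f x) (\int[mu]_x g x) D => F H D'.
rewrite !mulrDr -!mulrA; move: (D' * F) (D' * H) => DF DH; lra.
Qed.

End energy.

(** * Removing mass around finitely many points *)

Section selection.
Context d (T : measurableType d) (R : realType).
Variables (mu : {finite_measure set T -> \bar R}) (dist : T -> T -> R).
Variables (s M : R) (G : set T).
Hypothesis WB : wolff_bounded mu dist s M G.
Let s0 : 0 < s := wb_s WB.
Let M0 : 0 < M := wb_M WB.
Let dC := wb_sym WB.
Let dge0 := wb_ge0 WB.
Let dtri := wb_tri WB.
Let mG := wb_mG WB.
Let muG := wb_muG WB.
Local Notation V := (ball_mass mu dist).
Local Notation phi t := (t `^ s).

Lemma enclosing_radius x : exists2 t : R, 0 < t & forall z, G z -> dist x z <= t.
Proof.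
have [[g Gg]|/forallNP noG] := pselect (exists g, G g); last first.
  by exists 1 => // z /noG.
exists (dist x g + M) => [|z Gz]; first by rewrite ltr_wpDl.
by apply: le_trans (dtri x g z) _; rewrite lerD2l; exact: (wb_diam WB).
Qed.

Lemma small_ball x (a : R) : 0 < a -> exists2 t : R, 0 < t & V x t <= a.
Proof.
move=> a0; have f0 : 0 < 4 `^ s :> R by rewrite powR_gt0.
have p0 : 0 < (a / 4 `^ s) `^ s^-1 by rewrite powR_gt0// divr_gt0.
exists ((a / 4 `^ s) `^ s^-1) => //.
apply: le_trans (ball_mass_growth WB x p0) _.
rewrite -powRrM mulVf ?gt_eqF// powRr1; last by rewrite divr_ge0// ltW.
by rewrite mulrC divfK// gt_eqF.
Qed.

(** The first failure along the radii t0 2^k. *)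
Lemma dyadic_crossing (P : R -> bool) (t0 t1 : R) : 0 < t0 -> 0 < t1 ->
  P t0 -> (forall t, t1 <= t -> ~~ P t) ->
  exists2 t, 0 < t & P t && ~~ P (2 * t).
Proof.
move=> t00 t10 P0 P1.
have ex : exists k, ~~ P (t0 * 2 ^+ k).
  have [k] := scale_small t10 t00.
  rewrite /scale exprVn ler_pdivrMr ?exprn_gt0// => h.
  by exists k; exact: P1.
case: (ex_minnP ex) => -[|k] nP kmin; first by rewrite expr0 mulr1 P0 in nP.
exists (t0 * 2 ^+ k); first by rewrite mulr_gt0// exprn_gt0.
rewrite mulrCA -exprS nP andbT; apply/negPn/negP => /kmin.
by rewrite ltnn.
Qed.

Lemma balanced_radius (h : T -> R) x (a : R) : bmf h -> (forall y, 0 <= h y <= 1) ->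
  0 < a -> a < \int[mu]_y h y -> exists2 t : R, 0 < t &
    \int[mu]_y (h y * (dist x y <= t)%R%:R) <= a <
    \int[mu]_y (h y * (dist x y <= 2 * t)%R%:R).
Proof.
move=> bh h01 a0 ah.
have bb t : bmf (fun y => (dist x y <= t)%R%:R : R) by exact: (bmf_ball WB).
have [t0 t00 Vt0] := small_ball x a0.
have [t1 t10 Gt1] := enclosing_radius x.
pose P t := \int[mu]_y (h y * (dist x y <= t)%R%:R) <= a.
have [t tt0 /andP[Pt nPt]] : exists2 t, 0 < t & P t && ~~ P (2 * t).
  apply: (dyadic_crossing t00 t10) => [|t tt1]; rewrite /P.
    apply: le_trans Vt0; apply: Int_le => //; first exact: bmfM.
    by move=> y; rewrite ler_piMl//; have /andP[] := h01 y.
  rewrite -ltNge; apply: lt_le_trans ah _; apply: (Int_le_on mG muG) => //.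
    exact: bmfM.
  by move=> y Gy; rewrite (le_trans (Gt1 _ Gy) tt1) mulr1.
by exists t => //; rewrite -ltNge in nPt; rewrite nPt andbT.
Qed.

(** The mass a of h nearest to x.  A sphere may carry mass, so a ball of exactly
the required mass need not exist; a convex combination of the restrictions to
two concentric balls is used instead.  Their radii differ by a factor 2, which
keeps the removed part comparable to a ball. *)
Lemma fractional_removal (h : T -> R) x (a : R) : bmf h ->
  (forall y, 0 <= h y <= 1) -> 0 < a -> a < \int[mu]_y h y ->
  exists (t : R) (f : T -> R), [/\ 0 < t, bmf f, \int[mu]_y f y = a,
    forall y, 0 <= f y <= h y &
    forall y, (dist x y <= t -> f y = h y) /\ (2 * t < dist x y -> f y = 0)].
Proof.
move=> bh h01 a0 ah.
have bb t : bmf (fun y => (dist x y <= t)%R%:R : R) by exact: (bmf_ball WB).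
have [t t0 /andP[at_ at2]] := balanced_radius x bh h01 a0 ah.
set m1 := \int[mu]_y _ in at_; set m2 := \int[mu]_y _ in at2.
have m12 : 0 < m2 - m1 by lra.
pose l := (a - m1) / (m2 - m1).
have l0 : 0 <= l by apply: divr_ge0; [lra|exact: ltW].
have l1 : l <= 1 by rewrite ler_pdivrMr//; lra.
exists t, (fun y => (1 - l) * (h y * (dist x y <= t)%R%:R) +
  l * (h y * (dist x y <= 2 * t)%R%:R)).
have b1 u : bmf (fun y => h y * (dist x y <= u)%R%:R) by exact: bmfM.
split => //.
- by apply: bmfD; exact: bmfZ.
- rewrite IntD; [|exact: bmfZ..]; rewrite !IntZ// -/m1 -/m2 /l.
  by field; rewrite gt_eqF.
- move=> y; have /andP[h0 _] := h01 y.
  case: (leP (dist x y) t) => c1; case: (leP (dist x y) (2 * t)) => c2 /=;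
    rewrite ?mulr1 ?mulr0 ?addr0 ?add0r.
  + by apply/andP; split; nra.
  + by lra.
  + by apply/andP; split; nra.
  + by rewrite lexx.
- move=> y; split => [c1|c2].
    have c2 : dist x y <= 2 * t by lra.
    by rewrite c1 c2 !mulr1; ring.
  have c1 : t < dist x y by lra.
  by rewrite !leNgt c1 c2/= !mulr0 addr0.
Qed.

(** The pieces f_i are removed one after the other from what the previous steps
left over.  Since h decreases, it stays zero on the balls emptied earlier. *)
Lemma greedy_selection (x : nat -> T) (a : nat -> R) (N : nat) :
  (forall i, (i < N)%N -> 0 < a i) -> \sum_(i < N) a i < \int[mu]_y 1 ->
  exists (t : nat -> R) (f : nat -> T -> R),
    (forall i, bmf (f i)) /\
    let h y := 1 - \sum_(i < N) f i y in
    [/\ forall i, (i < N)%N -> 0 < t i /\ \int[mu]_y f i y = a i,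
        forall i y, (i < N)%N -> 0 <= f i y,
        forall i y, (i < N)%N -> 2 * t i < dist (x i) y -> f i y = 0,
        forall y, 0 <= h y <= 1 &
        forall i y, (i < N)%N -> dist (x i) y <= t i -> h y = 0].
Proof.
elim: N => [|N IH] a0 aN.
  exists (fun=> 1), (fun _ _ => 0); split => [i|/=]; first exact: bmf_cst.
  by split => // y; rewrite big_ord0 subr0 lexx ler01.
rewrite big_ord_recr/= in aN.
have [] := IH.
- by move=> i iN; apply: a0; exact: ltnW.
- by apply: lt_trans aN; rewrite ltrDl; exact: a0.
move=> t [f [bf /= [tf f0 fs h01 hv]]].
pose h y := 1 - \sum_(i < N) f i y.
have bh : bmf h by apply: bmfB; [exact: bmf_cst|exact: bmf_sum].
have Ih : \int[mu]_y h y = \int[mu]_y 1 - \sum_(i < N) a i.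
  rewrite IntB ?Int_sum//; [|exact: bmf_cst|exact: bmf_sum].
  by congr (_ - _); apply: eq_bigr => i _; have [] := tf i (ltn_ord i).
have ah : a N < \int[mu]_y h y by rewrite Ih; lra.
have [u [g [u0 bg Ig gh gP]]] :=
  fractional_removal (x N) bh h01 (a0 N (ltnSn N)) ah.
pose t' i := if (i < N)%N then t i else u.
pose f' i := if (i < N)%N then f i else g.
have E y : \sum_(i < N.+1) f' i y = \sum_(i < N) f i y + g y.
  rewrite big_ord_recr/= /f' ltnn; congr (_ + _).
  by apply: eq_bigr => i _; rewrite ltn_ord.
exists t', f'; split => [i|/=]; first by rewrite /f'; case: ifP.
have iNN i : (i < N.+1)%N -> (i < N)%N \/ i = N.
  by rewrite ltnS leq_eqVlt => /predU1P[->|]; [right|left].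
have hE y : 1 - \sum_(i < N.+1) f' i y = h y - g y by rewrite E /h; ring.
split.
- move=> i /iNN[iN|->]; rewrite /t' /f'; last by rewrite ltnn.
  by rewrite iN; exact: tf.
- move=> i y /iNN[iN|->]; rewrite /f'; first by rewrite iN; exact: f0.
  by rewrite ltnn; have /andP[] := gh y.
- move=> i y /iNN[iN|->]; rewrite /f' /t'; first by rewrite iN; exact: fs.
  by rewrite ltnn; have [_] := gP y.
- move=> y; rewrite hE; have /andP[? ?] := gh y; have /andP[_] := h01 y.
  by rewrite -/(h y) => ?; apply/andP; split; lra.
- move=> i y /iNN[iN|->] ; rewrite /t' hE.
    rewrite iN => /(hv _ _ iN); rewrite -/(h y) => hy0.
    by have := gh y; rewrite hy0 => /andP[? ?]; lra.
  by rewrite ltnn => /(gP y).1 ->; rewrite subrr.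
Qed.

End selection.

(** * Local parts, tails and doubling radii *)

Section local_and_far.
Context d (T : measurableType d) (R : realType).
Variables (mu : {finite_measure set T -> \bar R}) (dist : T -> T -> R).
Variables (s M : R) (G : set T).
Hypothesis WB : wolff_bounded mu dist s M G.
Let s0 : 0 < s := wb_s WB.
Let M0 : 0 < M := wb_M WB.
Let dC := wb_sym WB.
Let dge0 := wb_ge0 WB.
Let dtri := wb_tri WB.
Let mG := wb_mG WB.
Let muG := wb_muG WB.
Local Notation V := (ball_mass mu dist).
Local Notation r := (scale M).
Local Notation phi t := (t `^ s).
Local Notation A := (2 * 4 `^ s : R).

Let bb x (t : R) : bmf (fun y => (dist x y <= t)%R%:R : R).
Proof. exact: (bmf_ball WB). Qed.

Let phi_gt0 (t : R) : 0 < t -> 0 < phi t. Proof. exact: powR_gt0. Qed.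

Let phi4 (t : R) : 0 <= t -> phi (4 * t) = 4 `^ s * phi t.
Proof. by move=> t0; rewrite powRM. Qed.

Lemma bmf_size x (e : R) : 0 < e ->
  bmf (fun y => (phi (Num.max (dist x y) e))^-1).
Proof.
move=> e0; apply: (@bmf_le _ _ _ _ (phi e)^-1).
  under eq_fun do rewrite -powRN.
  apply: (measurableT_comp (measurable_powR _)).
  apply: measurable_maxr; last exact: measurable_cst.
  exact: (measurableT_comp (wb_meas WB) (pair1_measurable x)).
move=> y; have m0 : 0 < Num.max (dist x y) e by rewrite lt_max e0 orbT.
rewrite ger0_norm ?invr_ge0 ?powR_ge0// lef_pV2 ?posrE ?phi_gt0//.
by apply: le_powR; rewrite ?(ltW s0) ?(ltW e0)// le_max lexx orbT.
Qed.

(** Let u_k = 4^k t1, where t1 is the larger of 2 t0 and e, and take the first k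
with V(4u) <= A V(u) at u = u_k; it exists because otherwise the masses would
grow beyond the total mass.  Before it the masses grow by more than
A = 2 4^s per step while radius^s grows by 4^s, so the ratios V(u_i)/u_i^s at
least double and the part of the potential of h inside 4u is dominated by the
last of them, which the growth bound controls. *)
Lemma doubling_radius (h : T -> R) x (e t0 : R) :
  bmf h -> (forall y, 0 <= h y <= 1) -> 0 < e -> 0 < t0 ->
  (forall y, dist x y <= t0 -> h y = 0) -> 0 < V x (2 * t0) ->
  exists t, [/\ Num.max (2 * t0) e <= t, 0 < V x t,
    V x (4 * t) <= A * V x t &
    \int[mu]_y ((phi (Num.max (dist x y) e))^-1 *
      (h y * (dist x y <= 4 * t)%R%:R)) <= 2 * A * 4 `^ s].
Proof.
move=> bh h01 e0 t00 ht0 V0.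
pose t1 := Num.max (2 * t0) e.
have t10 : 0 < t1 by rewrite lt_max e0 orbT.
pose u k := t1 * 4 ^+ k.
have u0 k : 0 < u k by rewrite mulr_gt0// exprn_gt0.
have uS k : u k.+1 = 4 * u k by rewrite /u exprS mulrCA.
have u00 : u 0%N = t1 by rewrite /u expr0 mulr1.
have f40 : 1 <= 4 `^ s :> R.
  by rewrite -{1}(powRr0 4); apply: ler_powR; [lra|exact: ltW].
have A0 : 0 < A by lra.
have Vt1 : 0 < V x t1.
  by apply: lt_le_trans V0 _; apply: (ball_mass_le WB); rewrite le_max lexx.
have Vu k : V x t1 <= V x (u k).
  apply: (ball_mass_le WB); rewrite /u ler_peMr ?(ltW t10)//.
  by apply: exprn_ege1; lra.
have ex : exists k, V x (u k.+1) <= A * V x (u k).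
  apply: contrapT => /forallNP nex.
  have gr k : 2 ^+ k * V x t1 <= V x (u k).
    elim: k => [|k IH]; first by rewrite expr0 mul1r Vu.
    have /negP := nex k; rewrite -ltNge => /ltW; apply: le_trans.
    rewrite exprS -mulrA; apply: (@le_trans _ _ (2 * V x (u k))).
      by rewrite ler_wpM2l.
    by apply: ler_wpM2r; [exact: (ball_mass_ge0 mu dist)|lra].
  pose m := \int[mu]_y 1.
  have mV t : V x t <= m.
    apply: Int_le => //; first exact: bmf_cst.
    by move=> y; case: (dist x y <= t)%R; rewrite ?ler01.
  have [k] := scale_small (lt_le_trans Vt1 (mV t1)) Vt1.
  rewrite /scale exprVn ler_pdivrMr ?exprn_gt0//.
  have := gr k.+1; rewrite exprS => h1 h2.
  have := mV (u k.+1); have := mulr_gt0 (exprn_gt0 k (@ltr0n R 2 : 0 < 2%:R)) Vt1.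
  by move: h1 h2; rewrite -mulrA (mulrC (V x t1)); lra.
pose size y := (phi (Num.max (dist x y) e))^-1.
have bsize : bmf size by exact: bmf_size.
have size0 y : 0 <= size y by rewrite invr_ge0 powR_ge0.
have EV a t c : a * V x t / c = \int[mu]_y (a / c * (dist x y <= t)%R%:R).
  by rewrite IntZ// mulrAC.
pose I t := \int[mu]_y (size y * (h y * (dist x y <= t)%R%:R)).
(* Passing from radius t to 4t adds at most V(4t)/t^s. *)
have step t : 0 < t -> I (4 * t) <= I t + 1 * V x (4 * t) / phi t.
  move=> tt0; rewrite EV /I -IntD; [|by apply: bmfM => //; exact: bmfM|exact: bmfZ].
  apply: Int_le => [||y].
  - by apply: bmfM => //; exact: bmfM.
  - by apply: bmfD; [apply: bmfM => //; exact: bmfM|exact: bmfZ].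
  have /andP[h0 h1] := h01 y.
  rewrite div1r; have p0 : 0 <= (phi t)^-1 by rewrite invr_ge0 powR_ge0.
  have [c1|c1] := leP (dist x y) (4 * t); last first.
    by rewrite !mulr0 addr0 mulr_ge0// mulr_ge0//; exact: ler0n.
  have [c2|c2] := leP (dist x y) t; first by rewrite lerDl mulr_ge0.
  rewrite !mulr0 add0r !mulr1 -[leRHS]mulr1; apply: ler_pM => //.
  rewrite lef_pV2 ?posrE ?phi_gt0//; last by rewrite lt_max e0 orbT.
  by apply: le_powR; rewrite ?(ltW s0) ?(ltW tt0)// le_max (ltW c2).
(* Inside radius t0 the density vanishes, and beyond it the regularized distance
   is at least t1/4. *)
have I0 : I (u 0%N) <= A * V x (u 0%N) / phi (u 0%N).
  rewrite u00 EV; apply: Int_le => [||y].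
  - by apply: bmfM => //; exact: bmfM.
  - exact: bmfZ.
  have /andP[h0 h1] := h01 y.
  have p0 : 0 <= A / phi t1 by rewrite divr_ge0 ?powR_ge0// ltW.
  rewrite mulrA; apply: ler_wpM2r; first exact: ler0n.
  have [c|c] := leP (dist x y) t0; first by rewrite ht0// mulr0.
  apply: (@le_trans _ _ (size y)); first by rewrite ler_piMr.
  rewrite ler_pdivlMr ?phi_gt0// mulrC ler_pdivrMr ?phi_gt0//; last first.
    by rewrite lt_max e0 orbT.
  apply: (@le_trans _ _ (phi (4 * Num.max (dist x y) e))).
    apply: le_powR; [exact: ltW|exact: ltW|].
    have a1 : dist x y <= Num.max (dist x y) e by rewrite le_max lexx.
    have a2 : e <= Num.max (dist x y) e by rewrite le_max lexx orbT.
    by rewrite ge_max; apply/andP; split; lra.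
  rewrite phi4; last by rewrite le_max (ltW e0) orbT.
  by rewrite -mulrA mulr_natl mulr2n lerDl mulr_ge0 ?powR_ge0.
case: (ex_minnP ex) => k Vk kmin.
have Ik i : (i <= k)%N -> I (u i) <= A * V x (u i) / phi (u i).
  elim: i => // i IH ik.
  have Vi : A * V x (u i) < V x (u i.+1).
    by rewrite ltNge; apply/negP => /kmin; rewrite leqNgt ik.
  rewrite uS; apply: le_trans (step _ (u0 i)) _; rewrite -uS mul1r.
  have p0 : 0 < (phi (u i))^-1 by rewrite invr_gt0 phi_gt0.
  rewrite [in phi (u i.+1)]uS phi4 ?(ltW (u0 i))// invfM.
  have -> : A * V x (u i.+1) * ((4 `^ s)^-1 * (phi (u i))^-1) =
    2 * V x (u i.+1) / phi (u i) by field; rewrite !gt_eqF ?phi_gt0//; lra.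
  have : A * V x (u i) / phi (u i) <= V x (u i.+1) / phi (u i).
    by rewrite ler_pM2r// ltW.
  by have := IH (ltnW ik); lra.
exists (u k); split => //.
- by rewrite -/t1 /u ler_peMr ?(ltW t10)//; apply: exprn_ege1; lra.
- exact: lt_le_trans (Vu k).
- by rewrite -uS.
apply: le_trans (step _ (u0 k)) _; rewrite -uS mul1r.
have := Ik k (leqnn k).
have : V x (u k.+1) / phi (u k) <= A * V x (u k) / phi (u k).
  by rewrite ler_pM2r// invr_gt0 phi_gt0.
have : V x (u k) / phi (u k) <= 4 `^ s.
  by rewrite ler_pdivrMr ?phi_gt0//; exact: (ball_mass_growth WB).
move=> /(ler_wpM2l (ltW A0)); rewrite !mulrA; lra.
Qed.

Lemma bmf_tail x (t : R) : 0 < t ->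
  bmf (fun y => (t < dist x y)%R%:R *
    (t / (phi (Num.max (dist x y) t) * Num.max (dist x y) t)) : R).
Proof.
move=> t0.
have md : measurable_fun [set: T] (dist x).
  exact: (measurableT_comp (wb_meas WB) (pair1_measurable x)).
apply: bmfM; first by apply: bmf_bool; apply: measurable_fun_ltr.
apply: bmfZ.
under eq_fun do rewrite invfM.
apply: bmfM; first exact: bmf_size.
have -> : (fun y => (Num.max (dist x y) t)^-1) =
          (fun y => (Num.max (dist x y) t) `^ (-1)).
  apply/funext => y; rewrite powR_inv1// le_max (ltW t0) orbT//.
apply: (@bmf_le _ _ _ _ t^-1).
  apply: (measurableT_comp (measurable_powR _)).
  by apply: measurable_maxr.
move=> y; have m0 : 0 < Num.max (dist x y) t by rewrite lt_max t0 orbT.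
rewrite powR_inv1 ?(ltW m0)// ger0_norm ?invr_ge0 ?(ltW m0)// lef_pV2 ?posrE//.
by rewrite le_max lexx orbT.
Qed.

(** Dyadic shells: by the growth bound the shell at radius 2^i t contributes at
most a constant times 2^-i. *)
Lemma tail_integral x (t : R) : 0 < t ->
  \int[mu]_y ((t < dist x y)%R%:R *
    (t / (phi (Num.max (dist x y) t) * Num.max (dist x y) t))) <= 4 * 8 `^ s.
Proof.
move=> t0.
have [t1 t10 Gt1] := enclosing_radius WB x.
have [N Nt1] : exists N, t1 <= t * 2 ^+ N.
  have [N] := scale_small t10 t0.
  by rewrite /scale exprVn ler_pdivrMr ?exprn_gt0//; exists N.
(* Radii t 2^N, ..., 2t, t as a dyadic scale ending exactly at t. *)
pose M' := t * 2 ^+ N.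
have M'0 : 0 < M' by rewrite mulr_gt0// exprn_gt0.
have tE : scale M' N = t.
  by rewrite /scale /M' -mulrA -exprMn mulfV ?expr1n ?mulr1// pnatr_eq0.
have tM' : t <= M' by rewrite -tE -[leRHS]mulr1 -(expr0 2^-1) scale_le.
pose w k := 2^-1 ^+ (N - k) / phi (scale M' k).
have w0 k : 0 <= w k by rewrite divr_ge0 ?powR_ge0 ?exprn_ge0 ?invr_ge0.
have bF := bmf_tail x t0.
have b1 k : bmf (fun y => 2 * 2 `^ s * w k * (dist x y <= scale M' k)%R%:R).
  exact: bmfZ.
apply: (@le_trans _ _ (\int[mu]_y \sum_(k < N.+1)
    (2 * 2 `^ s * w k * (dist x y <= scale M' k)%R%:R))).
  apply: (Int_le_on mG muG) => //; first exact: bmf_sum.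
  move=> y Gy.
  have S0 (P : pred 'I_N.+1) : 0 <= \sum_(k < N.+1 | P k)
      (2 * 2 `^ s * w k * (dist x y <= scale M' k)%R%:R).
    apply: sumr_ge0 => k _; apply: mulr_ge0 (ler0n _ _).
    by apply: mulr_ge0 (w0 k); rewrite mulr_ge0 ?powR_ge0.
  have [c|c] := ltP t (dist x y); last by rewrite mul0r; exact: S0.
  have yM : dist x y <= M' by apply: le_trans (Gt1 _ Gy) _.
  have tv : scale M' N <= dist x y by rewrite tE ltW.
  have [k [kN yk ky _]] := scale_find M'0 tv yM.
  have kN' : (k < N.+1)%N by [].
  rewrite mul1r.
  rewrite (bigD1 (Ordinal kN'))//= yk mulr1 -[leLHS]addr0.
  apply: lerD; last exact: S0.
  have v0 : 0 < dist x y by lra.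
  have sk0 := scale_gt0 M'0 k.
  rewrite /w -(scale_ratio M'0 kN) tE.
  have -> : 2 * 2 `^ s * (t / scale M' k / phi (scale M' k)) =
     t * ((2 * 2 `^ s) / (scale M' k * phi (scale M' k))).
    by field; rewrite !gt_eqF ?phi_gt0.
  apply: ler_wpM2l; first exact: ltW.
  rewrite ler_pdivlMr ?mulr_gt0 ?phi_gt0// mulrC ler_pdivrMr ?mulr_gt0 ?phi_gt0//.
  have -> : 2 * 2 `^ s * (phi (dist x y) * dist x y) =
    (2 * dist x y) * (phi (2 * dist x y)) by rewrite powRM//; ring.
  apply: ler_pM => //; [exact: ltW|exact: powR_ge0|].
  by apply: le_powR => //; exact: ltW.
rewrite Int_sum//.
apply: (@le_trans _ _ (\sum_(k < N.+1) (2 * 8 `^ s * 2^-1 ^+ (N - k)))).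
  apply: ler_sum => k _; rewrite IntZ// -/(V x (scale M' k)).
  have sk0 := scale_gt0 M'0 k.
  have -> : 8 = 2 * 4 :> R by ring.
  rewrite powRM// /w.
  have -> : 2 * 2 `^ s * (2^-1 ^+ (N - k) / phi (scale M' k)) * V x (scale M' k) =
    2 * 2 `^ s * 2^-1 ^+ (N - k) * (V x (scale M' k) / phi (scale M' k)) by ring.
  have -> : 2 * (2 `^ s * 4 `^ s) * 2^-1 ^+ (N - k) =
    2 * 2 `^ s * 2^-1 ^+ (N - k) * 4 `^ s by ring.
  apply: ler_wpM2l; first by rewrite !mulr_ge0 ?powR_ge0 ?exprn_ge0 ?invr_ge0.
  by rewrite ler_pdivrMr ?phi_gt0//; exact: (ball_mass_growth WB).
rewrite -mulr_sumr (reindex_inj rev_ord_inj)/=.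
have := @geometric_half_le R N.+1; have := powR_ge0 8 s.
rewrite (_ : \sum_(i < N.+1) 2^-1 ^+ i =
  \sum_(i < N.+1) 2^-1 ^+ (N - (N.+1 - i.+1)) :> R); first by nra.
by apply: eq_bigr => i _; rewrite subSS subKn// -ltnS.
Qed.

End local_and_far.

(** * Comparing a potential with its averages *)

Section response.
Context d (T : measurableType d) (R : realType).
Variables (mu : {finite_measure set T -> \bar R}) (dist : T -> T -> R).
Variables (s M : R) (G : set T).
Hypothesis WB : wolff_bounded mu dist s M G.
Let s0 : 0 < s := wb_s WB.
Let M0 : 0 < M := wb_M WB.
Let dC := wb_sym WB.
Let dge0 := wb_ge0 WB.
Let dtri := wb_tri WB.
Let mG := wb_mG WB.
Let muG := wb_muG WB.
Local Notation V := (ball_mass mu dist).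
Local Notation r := (scale M).
Local Notation phi t := (t `^ s).
Local Notation A := (2 * 4 `^ s : R).

Let bb x (t : R) : bmf (fun y => (dist x y <= t)%R%:R : R).
Proof. exact: (bmf_ball WB). Qed.

Let m : R := \int[mu]_y 1.

(** Expand the square into pairs of balls and consider t_l <= t_j.  If the two
balls meet, x_l is within 2 t_j of x_j, and a_l is up to the factor m/2 the
integral of f_l, which is supported within 3 t_j of x_j.  The f_l add up to at
most 1, so summing over l gives the mass of B(x_j, 4 t_j), which the doubling
property compares with that of B(x_j, t_j). *)
Lemma ball_overlap (I : finType) (x : I -> T) (t a : I -> R) (f : I -> T -> R) :
  (forall i, 0 <= a i) -> (forall i, bmf (f i)) -> (forall i y, 0 <= f i y) ->
  (forall y, \sum_i f i y <= 1) -> (forall i y, t i < dist (x i) y -> f i y = 0) ->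
  (forall i, \int[mu]_y f i y = m / 2 * a i) ->
  (forall i, 0 < V (x i) (t i)) -> (forall i, 0 < t i) ->
  (forall i, V (x i) (4 * t i) <= A * V (x i) (t i)) ->
  m * \int[mu]_y (\sum_i a i / V (x i) (t i) * (dist (x i) y <= t i)%R%:R) ^+ 2 <=
    4 * A * \sum_i a i.
Proof.
move=> a0 bf f0 f1 ft If V0 t0 dbl.
pose c i := a i / V (x i) (t i).
have c0 i : 0 <= c i by rewrite divr_ge0// ltW.
pose S j l := \int[mu]_y (c j * c l *
  ((dist (x j) y <= t j)%R%:R * (dist (x l) y <= t l)%R%:R)).
have bS j l : bmf (fun y => c j * c l *
  ((dist (x j) y <= t j)%R%:R * (dist (x l) y <= t l)%R%:R)).
  by apply: bmfZ; apply: bmfM.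
have m0 : 0 <= m by apply: Int_ge0 => y.
have S0 j l : 0 <= S j l.
  apply: Int_ge0 => y; apply: mulr_ge0; first exact: mulr_ge0.
  by apply: mulr_ge0; exact: ler0n.
have SC j l : S j l = S l j.
  by apply: eq_Rintegral => y _; rewrite (mulrC (c j)) [X in _ * X]mulrC.
have -> : \int[mu]_y (\sum_i a i / V (x i) (t i) * (dist (x i) y <= t i)%R%:R) ^+ 2 =
    \sum_j \sum_l S j l.
  transitivity (\int[mu]_y \sum_j \sum_l (c j * c l *
    ((dist (x j) y <= t j)%R%:R * (dist (x l) y <= t l)%R%:R))).
    apply: eq_Rintegral => y _; rewrite expr2 mulr_suml; apply: eq_bigr => j _.
    by rewrite mulr_sumr; apply: eq_bigr => l _; rewrite mulrACA.
  rewrite Int_sum; last by move=> j; exact: bmf_sum.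
  by apply: eq_bigr => j _; rewrite Int_sum.
(* Whether the ball of l may meet that of j, for t_l <= t_j. *)
pose g j l : R := (dist (x j) (x l) <= 2 * t j)%R%:R.
have near j l : t l <= t j -> m * S j l <= 2 * c j * \int[mu]_y (f l y * g j l).
  move=> tlj; rewrite /g; have [cl|cl] := leP (dist (x j) (x l)) (2 * t j).
    under eq_Rintegral do rewrite mulr1.
    rewrite If.
    apply: (@le_trans _ _ (m * (c j * a l))); last first.
      by rewrite le_eqVlt; apply/orP; left; apply/eqP; field.
    apply: ler_wpM2l => //.
    have -> : c j * a l = \int[mu]_y (c j * c l * (dist (x l) y <= t l)%R%:R).
      by rewrite IntZ// -/(V (x l) (t l)) -mulrA divfK// gt_eqF.
    apply: Int_le => //; first exact: bmfZ.
    move=> y; apply: ler_wpM2l; first exact: mulr_ge0.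
    by apply: ler_piMl; [exact: ler0n|rewrite -[1]/(1%:R) ler_nat leq_b1].
  under [X in _ <= _ * X]eq_Rintegral do rewrite mulr0.
  rewrite Int0 mulr0 (_ : S j l = 0) ?mulr0//.
  rewrite -(Int0 mu); apply: eq_Rintegral => y _.
  have [c1|c1] := leP (dist (x j) y) (t j); last by rewrite mul0r mulr0.
  have [c2|c2] := leP (dist (x l) y) (t l); last by rewrite !mulr0.
  by have := dtri (x j) y (x l); rewrite (dC y); lra.
have half j : m * \sum_(l | t l <= t j) S j l <= 2 * A * a j.
  rewrite mulr_sumr; apply: (@le_trans _ _ (\sum_(l | t l <= t j)
      2 * c j * \int[mu]_y (f l y * g j l))).
    by apply: ler_sum => l; exact: near.
  rewrite -mulr_sumr -Int_sum; last by move=> l; apply: bmfM => //; exact: bmf_cst.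
  apply: (@le_trans _ _ (2 * c j * V (x j) (4 * t j))).
    apply: ler_wpM2l; first by rewrite mulr_ge0.
    apply: Int_le => //.
      by apply: bmf_sum => l; apply: bmfM => //; exact: bmf_cst.
    move=> y; have [c1|c1] := leP (dist (x j) y) (4 * t j).
      apply: le_trans (f1 y).
      apply: (@le_trans _ _ (\sum_(l | t l <= t j) f l y)).
        apply: ler_sum => l _; apply: ler_piMr => //.
        by rewrite /g -[1]/(1%:R) ler_nat leq_b1.
      rewrite [leRHS](bigID (fun l => t l <= t j))/= lerDl.
      by apply: sumr_ge0 => l _.
    rewrite big1// => l tl; rewrite /g.
    have [c2|c2] := leP (dist (x j) (x l)) (2 * t j); last by rewrite mulr0.
    rewrite ft ?mul0r//; have := dtri (x j) (x l) y; have := t0 j; lra.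
  have -> : 2 * A * a j = 2 * c j * (A * V (x j) (t j)).
    by rewrite /c; field; rewrite gt_eqF.
  by apply: ler_wpM2l => //; rewrite mulr_ge0.
(* By symmetry of S the pairs with t_l > t_j are counted by the same bound. *)
have split2 : \sum_j \sum_l S j l <=
    \sum_j \sum_(l | t l <= t j) S j l + \sum_j \sum_(l | t l <= t j) S j l.
  apply: (@le_trans _ _ (\sum_j \sum_(l | t l <= t j) S j l +
     \sum_j \sum_(l | t j <= t l) S j l)).
    rewrite -big_split/=; apply: ler_sum => j _.
    rewrite (bigID (fun l => t l <= t j))/= lerD2l.
    rewrite [leRHS](bigID (fun l => ~~ (t l <= t j)))/=.
    rewrite (eq_bigl (fun l => (t j <= t l) && ~~ (t l <= t j))); last first.
      by move=> l; rewrite -ltNge; case: ltP => [/ltW->|]//; rewrite ?andbF.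
    by rewrite lerDl; apply: sumr_ge0 => l _.
  rewrite lerD2l (exchange_big_dep xpredT)//=.
  apply: ler_sum => j _; rewrite le_eqVlt; apply/orP; left; apply/eqP.
  by apply: eq_bigr => l _; exact: SC.
apply: le_trans (ler_wpM2l m0 split2) _.
rewrite mulrDr mulr_sumr.
have -> : 4 * A * \sum_i a i = \sum_i 2 * A * a i + \sum_i 2 * A * a i.
  by rewrite -mulr_sumr; ring.
by apply: lerD; apply: ler_sum => j _.
Qed.

Lemma far_difference (L e : R) (k : T -> T -> R) x y z (t : R) :
  riesz_type dist s L e k -> 0 < t -> 0 <= L ->
  dist x y <= t -> 2 * t < dist x z ->
  `|k x z - k y z| <= 2 * 2 `^ s * L * (t / (phi (dist x z) * dist x z)).
Proof.
move=> Hk t0 L0 xy xz.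
have := rt_reg Hk x y z; cbv zeta.
set W := Num.max _ _.
have v0 : 0 < dist x z by lra.
have W0 : dist x z <= 2 * W.
  have h1 : Num.min (dist x z) (dist y z) <= W by rewrite le_max lexx.
  have h2 : dist x z <= 2 * Num.min (dist x z) (dist y z).
    by case: (leP (dist x z) (dist y z)) => _; have := dtri x y z; lra.
  lra.
have p0 : 0 < phi (dist x z) * dist x z by rewrite mulr_gt0 ?powR_gt0.
move=> h; rewrite mulrA ler_pdivlMr//.
apply: (@le_trans _ _ (`|k x z - k y z| * ((2 `^ s * phi W) * (2 * W)))).
  apply: ler_wpM2l => //; apply: ler_pM => //; first exact: powR_ge0.
  rewrite -powRM//; last lra.
  by apply: le_powR => //; exact: ltW.
have -> : `|k x z - k y z| * ((2 `^ s * phi W) * (2 * W)) =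
  2 * 2 `^ s * (`|k x z - k y z| * (phi W * W)) by ring.
rewrite -[leRHS]mulrA; apply: ler_wpM2l; first by rewrite mulr_ge0 ?powR_ge0.
by apply: le_trans h _; rewrite ler_wpM2l.
Qed.

Let D (L : R) := 4 * L * (2 `^ s) ^+ 3 + (2 `^ s) ^+ 3 : R.

(** The four terms come, in this order, from the part of h near x, the oscillation of
the far part over the ball, and the two terms of the inequality of the means
applied to the potential of the near part on the ball. *)
Definition near_constant (L : R) : R :=
  2 * A * 4 `^ s + 2 * 2 `^ s * L * (4 * 8 `^ s) + 2^-1 + 16 * D L * (1 + A).

(** Split h into a near part N inside B(x,2t) and a far part F.  N contributes a
bounded amount at x by the choice of t.  For F the scale of the kernel is
irrelevant, and Kh - KN = KF varies by a bounded amount over B(x,t)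
([far_difference] and [tail_integral]).  Hence KF(x) is at most the average of
|Kh| plus that of |KN| over B(x,t), and the latter is bounded by
[cross_energy_bound] together with doubling. *)
Lemma potential_le_average (L : R) (k0 k : T -> T -> R) (n0 n : nat)
    (h : T -> R) x (t : R) :
  0 <= L -> riesz_type dist s L (r n0) k0 -> riesz_type dist s L (r n) k ->
  (forall y z, r n0 <= dist y z -> k0 y z = k y z) ->
  bmf h -> (forall y, 0 <= h y <= 1) -> r n0 <= t -> 0 < V x t ->
  V x (4 * t) <= A * V x t ->
  \int[mu]_y ((phi (Num.max (dist x y) (r n0)))^-1 *
      (h y * (dist x y <= 4 * t)%R%:R)) <= 2 * A * 4 `^ s ->
  `|kernel_op mu k0 h x| <= near_constant L +
    (V x t)^-1 * \int[mu]_y ((dist x y <= t)%R%:R * `|kernel_op mu k h y|).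
Proof.
move=> L0 Hk0 Hk k0k bh h01 nt V0 dbl loc.
have h0 y : 0 <= h y by case/andP: (h01 y).
have h1 y : h y <= 1 by case/andP: (h01 y).
have e0 := scale_gt0 M0 n0.
have t0 : 0 < t by lra.
have bk0 := bmf_kernel_row WB Hk0; have bk := bmf_kernel_row WB Hk.
pose N y := h y * (dist x y <= 2 * t)%R%:R.
pose F y := h y * (2 * t < dist x y)%R%:R.
have bN : bmf N by exact: bmfM.
have bF : bmf F.
  have -> : F = fun y => h y - N y.
    apply/funext => y; rewrite /F /N ltNge; case: (_ <= _)%R => /=.
      by rewrite mulr0 mulr1 subrr.
    by rewrite mulr0 mulr1 subr0.
  exact: bmfB.
have hE : h = fun y => N y + F y.
  apply/funext => y; rewrite /F /N ltNge; case: (_ <= _)%R => /=.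
    by rewrite mulr0 mulr1 addr0.
  by rewrite mulr0 mulr1 add0r.
have N0 y : 0 <= N y by rewrite mulr_ge0//; exact: ler0n.
have F0 y : 0 <= F y by rewrite mulr_ge0//; exact: ler0n.
have N1 y : N y <= 1.
  by apply: le_trans (h1 y); apply: ler_piMr => //; rewrite -[1]/(1%:R) ler_nat leq_b1.
have a1 : `|kernel_op mu k0 N x| <= 2 * A * 4 `^ s.
  apply: le_trans loc; apply: le_trans (Int_norm _ _) _; first exact: bmfM.
  apply: Int_le => [||y].
  - by apply: bmf_norm; exact: bmfM.
  - by apply: bmfM; [exact: (bmf_size WB)|exact: bmfM].
  rewrite normrM (ger0_norm (N0 y)).
  have m0 : 0 < Num.max (dist x y) (r n0) by rewrite lt_max e0 orbT.
  apply: ler_pM => //; last first.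
    apply: ler_wpM2l => //; rewrite ler_nat.
    case: (leP (dist x y) (2 * t)) => //= c; rewrite lt0b; lra.
  by rewrite -[leRHS]mul1r ler_pdivlMr ?powR_gt0//; exact: (rt_size Hk0).
have a2 : kernel_op mu k0 F x = kernel_op mu k F x.
  apply: eq_Rintegral => y _; rewrite /F.
  have [c|c] := ltP (2 * t) (dist x y); last by rewrite !mulr0.
  by rewrite k0k//; lra.
have a3 y : dist x y <= t ->
    `|kernel_op mu k F x| <= `|kernel_op mu k h y| + `|kernel_op mu k N y| +
      2 * 2 `^ s * L * (4 * 8 `^ s).
  move=> xy.
  have kh : kernel_op mu k h y = kernel_op mu k N y + kernel_op mu k F y.
    by rewrite {1}hE (kernel_opD WB Hk).
  have -> : kernel_op mu k F x =
      kernel_op mu k h y - kernel_op mu k N y + (kernel_op mu k F x - kernel_op mu k F y).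
    by rewrite kh; ring.
  apply: le_trans (ler_normD _ _) _; apply: lerD; first exact: ler_normB.
  rewrite /kernel_op -IntB; [|by apply: bmfM..].
  apply: le_trans (Int_norm _ _) _; first by apply: bmfB; exact: bmfM.
  pose tail z : R := (t < dist x z)%R%:R *
     (t / (phi (Num.max (dist x z) t) * Num.max (dist x z) t)).
  have btail : bmf tail by exact: (bmf_tail WB).
  apply: (@le_trans _ _ (\int[mu]_z (2 * 2 `^ s * L * tail z))).
    apply: Int_le => [||z].
    - by apply: bmf_norm; apply: bmfB; exact: bmfM.
    - exact: bmfZ.
    rewrite -mulrBl normrM (ger0_norm (F0 z)) /F /tail.
    have [c|c] := ltP (2 * t) (dist x z); last first.
      rewrite !mulr0 !mulr_ge0 ?powR_ge0 ?ler0n// ?invr_ge0 ?mulr_ge0 ?powR_ge0// ?le_max ?(ltW t0) ?orbT//.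
    have c' : t < dist x z by lra.
    rewrite mulr1 c' mul1r (max_idPl (ltW c')).
    apply: (@le_trans _ _ `|k x z - k y z|); first by rewrite ler_piMr.
    exact: far_difference Hk _ _ _ _.
  rewrite IntZ//; apply: ler_wpM2l; first by rewrite !mulr_ge0 ?powR_ge0.
  exact: (tail_integral WB).
have bB := bb x t.
have bkh := bmf_kernel_op WB Hk bh.
have bkN := bmf_kernel_op WB Hk bN.
(* L^2 bound for the potential of the near part on B(x,t). *)
have a4 : \int[mu]_y ((dist x y <= t)%R%:R * kernel_op mu k N y ^+ 2) <=
    32 * D L * (1 + A) * V x t.
  apply: le_trans (cross_energy_bound WB L0 Hk bB bN _ _) _.
  - by move=> y; rewrite ler0n/= -[1]/(1%:R) ler_nat leq_b1.
  - by move=> y; rewrite N0 N1.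
  rewrite -/(D L) -[leRHS]mulrA; apply: ler_wpM2l.
    by rewrite mulr_ge0// addr_ge0// ?mulr_ge0 ?exprn_ge0 ?powR_ge0.
  rewrite mulrDl mul1r; apply: lerD => //.
  apply: le_trans dbl; apply: Int_le => // y.
  apply: (@le_trans _ _ (dist x y <= 2 * t)%R%:R).
    by apply: ler_piMl => //; exact: ler0n.
  by rewrite ler_nat; case: (leP (dist x y) (2 * t)) => //= c; rewrite lt0b; lra.
have a5 : V x t * `|kernel_op mu k F x| <=
    \int[mu]_y ((dist x y <= t)%R%:R * `|kernel_op mu k h y|) +
    (2 * 2 `^ s * L * (4 * 8 `^ s) + 2^-1 + 16 * D L * (1 + A)) * V x t.
  set c := 2 * 2 `^ s * L * (4 * 8 `^ s) in a3 *.
  have b1 : bmf (fun y => (dist x y <= t)%R%:R * `|kernel_op mu k h y|).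
    by apply: bmfM => //; exact: bmf_norm.
  have b2 : bmf (fun y => (dist x y <= t)%R%:R * kernel_op mu k N y ^+ 2).
    by apply: bmfM => //; exact: bmf_sqr.
  have b3 : bmf (fun y => (c + 2^-1) * (dist x y <= t)%R%:R).
    exact: bmfZ.
  apply: (@le_trans _ _ (\int[mu]_y ((dist x y <= t)%R%:R * `|kernel_op mu k h y| +
      ((c + 2^-1) * (dist x y <= t)%R%:R +
       2^-1 * ((dist x y <= t)%R%:R * kernel_op mu k N y ^+ 2))))).
    rewrite mulrC -IntZ//; apply: Int_le => [||y].
    - exact: bmfZ.
    - by apply: bmfD => //; apply: bmfD => //; exact: bmfZ.
    have [cy|cy] := leP (dist x y) t; last by rewrite !mulr0 !mul0r !mulr0 !addr0.
    rewrite !mulr1 !mul1r; apply: le_trans (a3 y cy) _.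
    have : 0 <= (`|kernel_op mu k N y| - 1) ^+ 2 by exact: sqr_ge0.
    by rewrite sqrrB1 real_normK ?num_real// mulr2n; lra.
  rewrite IntD//; last by apply: bmfD => //; exact: bmfZ.
  rewrite lerD2l IntD//; last exact: bmfZ.
  rewrite !IntZ// -/(V x t).
  by move: a4; rewrite -!(mulrA _ (D L)); move: (D L * _) => E; rewrite -/(V x t); lra.
have a6 : `|kernel_op mu k F x| <= (2 * 2 `^ s * L * (4 * 8 `^ s) + 2^-1 +
    16 * D L * (1 + A)) +
    (V x t)^-1 * \int[mu]_y ((dist x y <= t)%R%:R * `|kernel_op mu k h y|).
  rewrite -(ler_pM2l V0); apply: le_trans a5 _.
  by rewrite [leRHS]mulrDr mulVKf ?gt_eqF// [leRHS]addrC lerD2l mulrC.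
have -> : kernel_op mu k0 h x = kernel_op mu k0 N x + kernel_op mu k0 F x.
  by rewrite {1}hE (kernel_opD WB Hk0).
apply: le_trans (ler_normD _ _) _; rewrite a2 /near_constant.
move: a1 a6; move: (16 * D L * (1 + A)) (2 * 2 `^ s * L * _) (2 * A * _) => ? ? ?.
by lra.
Qed.

End response.

(** * The response to a finite system of weighted points *)

Section greedy_response.
Context d (T : measurableType d) (R : realType).
Variables (mu : {finite_measure set T -> \bar R}) (dist : T -> T -> R).
Variables (s M : R) (G : set T).
Hypothesis WB : wolff_bounded mu dist s M G.
Let s0 : 0 < s := wb_s WB.
Let M0 : 0 < M := wb_M WB.
Local Notation V := (ball_mass mu dist).
Local Notation r := (scale M).
Local Notation phi t := (t `^ s).
Local Notation A := (2 * 4 `^ s : R).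
Let m : R := \int[mu]_y 1.
Hypothesis m_gt0 : 0 < m.

Let bb x (t : R) : bmf (fun y => (dist x y <= t)%R%:R : R).
Proof. exact: (bmf_ball WB). Qed.

(** Regularizations of one kernel at the successive dyadic scales: they differ only
below the coarser of the two scales. *)
Definition kernel_family (L : R) (k : nat -> T -> T -> R) : Prop :=
  (forall n, riesz_type dist s L (r n) (k n)) /\
  (forall n n' y z, (n <= n')%N -> r n <= dist y z -> k n y z = k n' y z).

Definition response_constant (L : R) : R :=
  near_constant s L + 32 * (4 * L * (2 `^ s) ^+ 3 + (2 `^ s) ^+ 3) + 2 * A.

(** Summing [potential_le_average] over the points bounds the left-hand side by a
constant plus the integral of Q |Kh|, where Q is the sum of the normalized
indicators of the balls with weights a_i and K is taken at the finest scale that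
occurs.  [ball_overlap] and [cross_energy_bound] bound the L^2 norms of Q and Kh
by multiples of m^(-1/2) and m^(1/2). *)
Lemma greedy_response_pos (N : nat) (x : nat -> T) (e : nat -> nat) (a : nat -> R) :
  (forall i, (i < N)%N -> 0 < a i) -> \sum_(i < N) a i <= 1 ->
  exists h : T -> R, [/\ bmf h, forall y, 0 <= h y <= 1, m / 2 <= \int[mu]_y h y &
    forall L k, 0 <= L -> kernel_family L k ->
      \sum_(i < N) a i * `|kernel_op mu (k (e i)) h (x i)| <= response_constant L].
Proof.
move=> a0 a1.
have [] := @greedy_selection _ _ _ _ _ _ _ _ WB x (fun i => m / 2 * a i) N.
- by move=> i iN; rewrite mulr_gt0 ?a0// divr_gt0.
- rewrite -mulr_sumr -/m; apply: (@le_lt_trans _ _ (m / 2)); last by rewrite gtr_pMr// invf_lt1// ltr1n.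
  by rewrite ler_piMr// divr_ge0// ltW.
move=> t [f [bf /= [tf f0 ft h01 hv]]].
pose h y := 1 - \sum_(i < N) f i y.
have bh : bmf h by apply: bmfB; [exact: bmf_cst|exact: bmf_sum].
have hE y : h y = 1 - \sum_(i < N) f i y by [].
have f1 y : \sum_(i < N) f i y <= 1.
  by have /andP[+ _] := h01 y; rewrite subr_ge0.
have Ih : m / 2 <= \int[mu]_y h y.
  rewrite /h IntB ?Int_sum//; [|exact: bmf_cst|exact: bmf_sum].
  rewrite (eq_bigr (fun i : 'I_N => m / 2 * a i)); last first.
    by move=> i _; have [] := tf i (ltn_ord i).
  rewrite -mulr_sumr -/m.
  have : m / 2 * \sum_(i < N) a i <= m / 2 by rewrite ler_piMr// divr_ge0// ltW.
  by lra.
exists h; split => //.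
have /choice[u uP] (i : 'I_N) : exists u, [/\ Num.max (2 * t i) (r (e i)) <= u,
    0 < V (x i) u, V (x i) (4 * u) <= A * V (x i) u &
    \int[mu]_y ((phi (Num.max (dist (x i) y) (r (e i))))^-1 *
      (h y * (dist (x i) y <= 4 * u)%R%:R)) <= 2 * A * 4 `^ s].
  have [ti If] := tf i (ltn_ord i).
  apply: (doubling_radius WB) => //; first exact: scale_gt0.
    by move=> y; exact: hv.
  apply: (@lt_le_trans _ _ (\int[mu]_y f i y)).
    by rewrite If mulr_gt0 ?a0// divr_gt0.
  apply: Int_le => // y.
  have [c|c] := leP (dist (x i) y) (2 * t i); last by rewrite ft.
  apply: le_trans (f1 y); rewrite (bigD1 i)//= lerDl.
  by apply: sumr_ge0 => j _; exact: f0.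
have V0 (i : 'I_N) : 0 < V (x i) (u i) by have [] := uP i.
have u2 (i : 'I_N) : 2 * t i <= u i.
  by have [+ _ _ _] := uP i; rewrite ge_max => /andP[].
have ue (i : 'I_N) : r (e i) <= u i.
  by have [+ _ _ _] := uP i; rewrite ge_max => /andP[].
move=> L k L0 [kR kC].
pose n := (\max_(i < N) e i)%N.
have en (i : 'I_N) : (e i <= n)%N by exact: (leq_bigmax_cond (F := fun i : 'I_N => e i)).
pose Q y := \sum_(i < N) a i / V (x i) (u i) * (dist (x i) y <= u i)%R%:R.
have bQ : bmf Q by apply: bmf_sum => i; exact: bmfZ.
have bk : bmf (kernel_op mu (k n) h) by exact: (bmf_kernel_op WB (kR n) bh).
have IQ : m * \int[mu]_y (Q y ^+ 2) <= 4 * A.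
  apply: (@le_trans _ _ (4 * A * \sum_(i < N) a i)); last first.
    by rewrite ler_piMr// !mulr_ge0 ?powR_ge0.
  apply: (ball_overlap WB (x := fun i : 'I_N => x i) (t := u)
    (a := fun i : 'I_N => a i) (f := fun i : 'I_N => f i)) => //.
  - by move=> i; apply/ltW/a0.
  - by move=> i y; exact: f0.
  - by move=> i y uy; apply: ft => //; apply: le_lt_trans uy; exact: u2.
  - by move=> i; have [] := tf i (ltn_ord i).
  - by move=> i; apply: lt_le_trans (ue i); exact: scale_gt0.
  - by move=> i; have [] := uP i.
have Ik : \int[mu]_y (kernel_op mu (k n) h y ^+ 2) <=
    64 * (4 * L * (2 `^ s) ^+ 3 + (2 `^ s) ^+ 3) * m.
  have := cross_energy_bound WB L0 (kR n) (bmf_cst T 1) bh _ h01.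
  have -> : \int[mu]_x (1 * kernel_op mu (k n) h x ^+ 2) =
     \int[mu]_x (kernel_op mu (k n) h x ^+ 2).
    by apply: eq_Rintegral => y _; rewrite mul1r.
  move=> /(_ _)/le_trans; apply; first by move=> y; rewrite ler01 lexx.
  rewrite -/m; have : \int[mu]_x h x <= m.
    by apply: Int_le => //; [exact: bmf_cst|move=> y; have /andP[] := h01 y].
  have : 0 <= 4 * L * (2 `^ s) ^+ 3 + (2 `^ s) ^+ 3.
    by rewrite addr_ge0 ?mulr_ge0 ?exprn_ge0 ?powR_ge0.
  by move: (4 * L * _ + _) => E; nra.
apply: (@le_trans _ _ (near_constant s L + \int[mu]_y (Q y * `|kernel_op mu (k n) h y|))).
  have -> : \int[mu]_y (Q y * `|kernel_op mu (k n) h y|) = \sum_(i < N) a i *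
     ((V (x i) (u i))^-1 * \int[mu]_y ((dist (x i) y <= u i)%R%:R * `|kernel_op mu (k n) h y|)).
    transitivity (\int[mu]_y \sum_(i < N) (a i / V (x i) (u i)) *
        ((dist (x i) y <= u i)%R%:R * `|kernel_op mu (k n) h y|)).
      apply: eq_Rintegral => y _; rewrite /Q mulr_suml.
      by apply: eq_bigr => i _; rewrite mulrA.
    rewrite Int_sum; last first.
      by move=> i; apply: bmfZ; apply: bmfM => //; exact: bmf_norm.
    apply: eq_bigr => i _; rewrite IntZ ?mulrA//.
    by apply: bmfM => //; exact: bmf_norm.
  apply: (@le_trans _ _ (\sum_(i < N) (a i * near_constant s L + a i *
     ((V (x i) (u i))^-1 * \int[mu]_y ((dist (x i) y <= u i)%R%:R * `|kernel_op mu (k n) h y|))))).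
    apply: ler_sum => i _; rewrite -mulrDr; apply: ler_wpM2l; first exact/ltW/a0.
    have [_ _ dbl loc] := uP i.
    apply: (potential_le_average WB L0 (kR (e i)) (kR n)) => //.
    by move=> y z; exact: kC.
  rewrite big_split/= lerD2r -mulr_suml ler_piMl//.
  rewrite /near_constant !addr_ge0 ?invr_ge0 ?mulr_ge0 ?addr_ge0 ?mulr_ge0 ?exprn_ge0 ?powR_ge0//.
rewrite /response_constant -[leRHS]addrA lerD2l.
move: Ik; set E := 4 * L * _ + _; move=> Ik.
apply: (@le_trans _ _ (\int[mu]_y (m / 2 * Q y ^+ 2 +
    (m^-1 / 2) * kernel_op mu (k n) h y ^+ 2))).
  have b1 : bmf (fun y => Q y * `|kernel_op mu (k n) h y|).
    by apply: bmfM => //; exact: bmf_norm.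
  apply: Int_le => // [|y]; first by apply: bmfD; apply: bmfZ; exact: bmf_sqr.
  rewrite -[kernel_op mu (k n) h y ^+ 2]real_normK ?num_real//.
  move: (Q y) `|kernel_op _ _ _ _| => p q.
  have -> : m / 2 * p ^+ 2 + m^-1 / 2 * q ^+ 2 = p * q + m^-1 / 2 * (m * p - q) ^+ 2.
    by field; rewrite gt_eqF.
  rewrite lerDl; apply: mulr_ge0 (sqr_ge0 _).
  by rewrite divr_ge0// invr_ge0 ltW.
rewrite IntD; [|by apply: bmfZ; exact: bmf_sqr..].
rewrite !IntZ; [|exact: bmf_sqr..].
rewrite [leRHS]addrC; apply: lerD.
  rewrite mulrAC ler_pdivrMr//; apply: le_trans IQ _.
  by rewrite le_eqVlt; apply/orP; left; apply/eqP; ring.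
rewrite mulrAC ler_pdivrMr// [leLHS]mulrC ler_pdivrMr//.
by apply: le_trans Ik _; rewrite le_eqVlt; apply/orP; left; apply/eqP; ring.
Qed.

(** Points of weight zero are admitted by mixing the weights with uniform ones, at
the price of a factor 2. *)
Lemma greedy_response (N : nat) (x : nat -> T) (e : nat -> nat) (a : nat -> R) :
  (forall i, (i < N)%N -> 0 <= a i) -> \sum_(i < N) a i <= 1 ->
  exists h : T -> R, [/\ bmf h, forall y, 0 <= h y <= 1, m / 2 <= \int[mu]_y h y &
    forall L k, 0 <= L -> kernel_family L k ->
      \sum_(i < N) a i * `|kernel_op mu (k (e i)) h (x i)| <= 2 * response_constant L].
Proof.
case: N => [|N] a0 a1.
  have a0' i : (i < 0)%N -> 0 < a i by [].
  have [h [? ? ? hP]] := greedy_response_pos x e a0' a1.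
  exists h; split => // L k L0 kf; have := hP L k L0 kf; rewrite !big_ord0; lra.
pose b i := (a i + N.+1%:R^-1) / 2.
have N0 : 0 < N.+1%:R^-1 :> R by rewrite invr_gt0.
have [i iN||h [bh h01 Ih hP]] := @greedy_response_pos N.+1 x e b.
- by rewrite divr_gt0// ltr_wpDl// a0.
- have E : \sum_(i < N.+1) N.+1%:R^-1 = 1 :> R.
    by rewrite sumr_const card_ord -[LHS]mulr_natl divff// pnatr_eq0.
  rewrite -mulr_suml big_split/= E ler_pdivrMr// mul1r.
  by rewrite -[leRHS]/(1 + 1) lerD2r.
exists h; split => // L k L0 kf; rewrite -ler_pdivrMl// mulr_sumr.
apply: le_trans (hP L k L0 kf); apply: ler_sum => i _; rewrite mulrA.
apply: ler_wpM2r => //; rewrite mulrC; apply: ler_wpM2r; first by rewrite invr_ge0.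
by rewrite lerDl ltW.
Qed.

End greedy_response.

(** * Approachability *)

Section approachability.
Context {R : realType}.

(** One step of the recursion for the squared distance to the half-line below C:
the mixture exceeds C by at most (1-eta) times the excess of x plus eta (y-C). *)
Lemma excess_step (x y C eta : R) : 0 <= eta <= 1 ->
  Num.max 0 ((1 - eta) * x + eta * y - C) ^+ 2 <=
  (1 - eta) ^+ 2 * Num.max 0 (x - C) ^+ 2 +
  2 * eta * (1 - eta) * (Num.max 0 (x - C) * (y - C)) + eta ^+ 2 * (y - C) ^+ 2.
Proof.
move=> /andP[e0 e1].
have -> : (1 - eta) ^+ 2 * Num.max 0 (x - C) ^+ 2 +
  2 * eta * (1 - eta) * (Num.max 0 (x - C) * (y - C)) + eta ^+ 2 * (y - C) ^+ 2 =
  ((1 - eta) * Num.max 0 (x - C) + eta * (y - C)) ^+ 2 by ring.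
set a := (1 - eta) * x + eta * y - C.
set b := (1 - eta) * Num.max 0 (x - C) + eta * (y - C).
have ab : a <= b.
  have h : x - C <= Num.max 0 (x - C) by rewrite le_max lexx orbT.
  have : (1 - eta) * (x - C) <= (1 - eta) * Num.max 0 (x - C).
    by apply: ler_wpM2l => //; lra.
  by rewrite /a /b; lra.
have [a0|a0] := leP a 0; first by rewrite expr0n/= sqr_ge0.
by rewrite ler_sqr ?nnegrE; lra.
Qed.

Variables (H : Type) (Hs : H -> Prop) (mix : R -> H -> H -> H) (l : nat -> H -> R).
Variables (C : R) (B : nat -> R).
Hypothesis mixP : forall eta x y, 0 <= eta <= 1 -> Hs x -> Hs y -> Hs (mix eta x y).
Hypothesis lin : forall i eta x y, 0 <= eta <= 1 -> Hs x -> Hs y ->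
  l i (mix eta x y) = (1 - eta) * l i x + eta * l i y.
Hypothesis lB : forall i x, Hs x -> `|l i x| <= B i.
Hypothesis resp : forall N (a : nat -> R), (forall i, 0 <= a i) ->
  \sum_(i < N) a i = 1 -> exists2 x, Hs x & \sum_(i < N) a i * l i x <= C.

(** Let e_i(x) be the excess of l_i(x) over C, and respond to the weights
proportional to e_i(x) by y.  Then the sum of e_i(x)(l_i(y) - C) is nonpositive,
so mixing y into x with weight 1/(n+2) changes the potential, the sum of the
squares of the e_i, as averaging orthogonal vectors would; it is at most K/(n+1)
after n steps. *)
Lemma approach (x0 : H) N : Hs x0 ->
  exists2 x, Hs x & forall i, (i < N)%N -> l i x <= C + 1.
Proof.
move=> Hx0; pose ex i x := Num.max 0 (l i x - C).
have ex0 i x : 0 <= ex i x by rewrite le_max lexx.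
pose K := \sum_(i < N) (B i + `|C|) ^+ 2.
have KP x : Hs x -> \sum_(i < N) (l i x - C) ^+ 2 <= K.
  move=> Hx; apply: ler_sum => i _; rewrite -real_normK ?num_real//.
  have h : `|l i x - C| <= B i + `|C| by apply: le_trans (ler_normB _ _) _; rewrite lerD2r lB.
  by rewrite ler_sqr ?nnegrE//; apply: le_trans h.
have K0 : 0 <= K by apply: sumr_ge0 => i _; exact: sqr_ge0.
have main n : exists2 x, Hs x & \sum_(i < N) ex i x ^+ 2 <= K / n.+1%:R.
  elim: n => [|n [x Hx IH]].
    exists x0 => //; rewrite divr1; apply: le_trans (KP _ Hx0).
    apply: ler_sum => i _; rewrite /ex.
    by case: (leP 0 (l i x0 - C)) => // _; rewrite expr0n/= sqr_ge0.
  have [Se0|Se0] := eqVneq (\sum_(i < N) ex i x) 0.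
    exists x => //; rewrite big1 ?divr_ge0// => i _.
    have /psumr_eq0P : \sum_(i < N) ex i x = 0 by [].
    by move=> -> //; rewrite expr0n.
  have Spos : 0 < \sum_(i < N) ex i x.
    by rewrite lt_def Se0 sumr_ge0.
  set Se := \sum_(i < N) _ in Se0 Spos.
  have [||y Hy yC] := @resp N (fun i => ex i x / Se).
  - by move=> i; rewrite divr_ge0// ltW.
  - by rewrite -mulr_suml divff.
  (* The response makes the cross terms of [excess_step] harmless. *)
  have neg : \sum_(i < N) ex i x * (l i y - C) <= 0.
    have : \sum_(i < N) (ex i x / Se * l i y) * Se <= C * Se.
      by rewrite -mulr_suml; apply: ler_wpM2r => //; exact: ltW.
    under eq_bigr do rewrite mulrAC divfK//.
    by under [X in _ -> X <= _]eq_bigr do rewrite mulrBr;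
      rewrite sumrB -mulr_suml -/Se subr_le0 mulrC.
  pose eta : R := n.+2%:R^-1.
  have n2 : 0 < n.+2%:R :> R by [].
  have e01 : 0 <= eta <= 1 by rewrite invr_ge0 ltW//= invf_le1// ler1n.
  exists (mix eta x y); first exact: mixP.
  apply: (@le_trans _ _ ((1 - eta) ^+ 2 * (\sum_(i < N) ex i x ^+ 2) +
    2 * eta * (1 - eta) * (\sum_(i < N) ex i x * (l i y - C)) +
    eta ^+ 2 * \sum_(i < N) (l i y - C) ^+ 2)).
    rewrite !mulr_sumr -!big_split/=; apply: ler_sum => i _.
    by rewrite /ex lin//; exact: excess_step.
  have /andP[e0 e1] := e01.
  have t1 : (1 - eta) ^+ 2 * \sum_(i < N) ex i x ^+ 2 <= (1 - eta) ^+ 2 * (K / n.+1%:R).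
    by apply: ler_wpM2l => //; exact: sqr_ge0.
  have t2 : 2 * eta * (1 - eta) * (\sum_(i < N) ex i x * (l i y - C)) <= 0.
    by rewrite mulr_ge0_le0// !mulr_ge0// subr_ge0.
  have t3 : eta ^+ 2 * (\sum_(i < N) (l i y - C) ^+ 2) <= eta ^+ 2 * K.
    by apply: ler_wpM2l; [exact: sqr_ge0|exact: KP].
  apply: le_trans (lerD (lerD t1 t2) t3) _.
  rewrite le_eqVlt; apply/orP; left; apply/eqP; rewrite /eta.
  have n1 : n.+1%:R != 0 :> R by rewrite pnatr_eq0.
  have -> : n.+2%:R = n.+1%:R + 1 :> R by rewrite natr1.
  have n1' : n.+1%:R + 1 != 0 :> R by rewrite natr1 pnatr_eq0.
  move: (n.+1%:R) n1 n1' => p p0 p1.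
  by field; rewrite p0 p1.
have [n Kn] : exists n, K <= n.+1%:R.
  exists (Num.bound K); have := archi_boundP K0 => /ltW/le_trans; apply.
  by rewrite ler_nat.
have [x Hx xP] := main n; exists x => // i iN.
have : ex i x ^+ 2 <= 1.
  apply: (@le_trans _ _ (\sum_(i < N) ex i x ^+ 2)).
    rewrite (bigD1 (Ordinal iN))//= lerDl; apply: sumr_ge0 => j _; exact: sqr_ge0.
  by apply: le_trans xP _; rewrite ler_pdivrMr// mul1r.
rewrite expr_le1// => h.
have : l i x - C <= ex i x by rewrite le_max lexx orbT.
lra.
Qed.

End approachability.

Section ae_limit.
Context d (T : measurableType d) (R : realType).
Variable mu : {finite_measure set T -> \bar R}.

(** Summable L^1 gaps give convergence almost everywhere; the limit is clipped to
[0,1] so that it is defined and bounded everywhere. *)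
Lemma fast_cauchy_limit (h : nat -> T -> R) (K : R) :
  (forall n, bmf (h n)) -> (forall n x, 0 <= h n x <= 1) ->
  (forall n, \int[mu]_x `|h n.+1 x - h n x| <= K * 2^-1 ^+ n) ->
  exists f : T -> R, [/\ bmf f, forall x, 0 <= f x <= 1 &
    forall g, bmf g -> \int[mu]_x (g x * h n x) @[n --> \oo] --> \int[mu]_x (g x * f x)].
Proof.
move=> bh h01 hK.
pose D n x := `|h n.+1 x - h n x|.
have bD n : bmf (D n) by apply: bmf_norm; exact: bmfB.
have mD n : measurable_fun [set: T] (fun x => (D n x)%:E).
  by apply/measurable_EFinP; have [] := bD n.
pose S x := (\sum_(n <oo) (D n x)%:E)%E.
have D0 n x : (0 <= (D n x)%:E)%E by rewrite lee_fin; exact: normr_ge0.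
have iS : mu.-integrable [set: T] S.
  apply/integrableP; split.
    apply: ge0_emeasurable_sum => //.
  rewrite (eq_integral S); last first.
    by move=> x _; rewrite gee0_abs//; exact: nneseries_ge0.
  rewrite integral_nneseries//.
  apply: (@le_lt_trans _ _ (\sum_(n <oo) (K * 2^-1 ^+ n)%:E)%E).
    apply: lee_nneseries => [n _ _|n _].
      by apply: integral_ge0 => x _; exact: D0.
    by rewrite -(Int_EFin mu (bD n)) lee_fin; exact: hK.
  have K0 : 0 <= K.
    by have := hK 0%N; rewrite expr0 mulr1; apply: le_trans; exact: Int_ge0.
  apply: (@le_lt_trans _ _ (K * 2)%:E); last by rewrite ltry.
  apply: lime_le.
    apply: is_cvg_nneseries => n _ _.
    by rewrite lee_fin mulr_ge0// exprn_ge0 ?invr_ge0.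
  apply: nearW => n; rewrite sumEFin lee_fin -mulr_sumr; apply: ler_wpM2l => //.
  rewrite big_mkord; exact: geometric_half_le.
have aeS := integrable_ae measurableT iS.
pose f x := Num.max 0 (Num.min 1 (fine (limn_esup (fun n => (h n x)%:E)))).
have mf : measurable_fun [set: T] f.
  apply: measurable_maxr; first exact: measurable_cst.
  apply: measurable_minr; first exact: measurable_cst.
  apply: (measurableT_comp (fine_measurable measurableT)) => //.
  apply: measurable_fun_limn_esup => n.
  by apply/measurable_EFinP; have [] := bh n.
have f01 x : 0 <= f x <= 1.
  by rewrite le_max lexx/= ge_max ler01/= ge_min lexx.
have bf : bmf f.
  by apply: (bmf_le mf (M := 1)) => x; have /andP[? ?] := f01 x; rewrite ger0_norm.
have hf : {ae mu, forall x, h n x @[n --> \oo] --> f x}.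
  apply: filterS aeS => x /(_ I) Sx.
  have cD : cvgn (series (fun n => D n x)).
    apply: nnseries_is_cvg => [n|]; first exact: normr_ge0.
    by move: Sx; rewrite ge0_fin_numE//; exact: nneseries_ge0.
  have /cvg_ex[/= l hl] : cvgn (fun n => h n x).
    have : cvgn (series (telescope (fun n => h n x))) by exact: normed_cvg.
    rewrite telescopeK => c.
    have -> : (fun n => h n x) = (fun n => (h n x - h 0%N x) + h 0%N x).
      by apply/funext => n; rewrite subrK.
    by apply: is_cvgD => //; exact: is_cvg_cst.
  suff -> : f x = l by [].
  have l0 : 0 <= l.
    by apply: (cvgr_to_ge hl); apply: nearW => n; have /andP[] := h01 n x.
  have l1 : l <= 1.
    by apply: (cvgr_to_le hl); apply: nearW => n; have /andP[] := h01 n x.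
  have hlE : (h n x)%:E @[n --> \oo] --> l%:E by apply: cvg_EFin => //; exact: nearW.
  rewrite /f; have [_ ->] := cvg_limn_einf_sup hlE.
  by rewrite /= (min_idPr l1) (max_idPr l0).
exists f; split => // g bg.
have [mg [N gN]] := bg.
have bgh n : bmf (fun x => g x * h n x) by exact: bmfM.
have bgf : bmf (fun x => g x * f x) by exact: bmfM.
have [|||||_ _] := @dominated_convergence _ _ _ mu setT measurableT
  (fun n x => (g x * h n x)%:E) (fun x => (g x * f x)%:E) (fun=> `|N|%:E).
- by move=> n; apply/measurable_EFinP; have [] := bgh n.
- by apply/measurable_EFinP; have [] := bgf.
- apply: filterS hf => x hx _; apply: cvg_EFin; first exact: nearW.
  exact: cvgMr.
- exact: bmf_integrable (bmf_cst _ _).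
- apply: aeW => x n _; rewrite lee_fin normrM -[leRHS]mulr1; apply: ler_pM => //.
    exact: le_trans (gN x) (ler_norm _).
  by have /andP[? ?] := h01 n x; rewrite ger0_norm.
by move=> dom; apply: fine_cvg; rewrite (Int_EFin mu bgf).
Qed.

End ae_limit.

(** * From weighted averages to uniform bounds *)

Section countable_constraints.
Context d (T : measurableType d) (R : realType).
Variable mu : {finite_measure set T -> \bar R}.

Definition test_density (lo : R) (h : T -> R) : Prop :=
  [/\ bmf h, forall x, 0 <= h x <= 1 & lo <= \int[mu]_x h x].

Definition mixture (eta : R) (f g : T -> R) (x : T) : R := (1 - eta) * f x + eta * g x.

Lemma Int_mixture (eta : R) (k f g : T -> R) : bmf k -> bmf f -> bmf g ->
  \int[mu]_x (k x * mixture eta f g x) =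
  (1 - eta) * \int[mu]_x (k x * f x) + eta * \int[mu]_x (k x * g x).
Proof.
move=> bk bf bg; rewrite -!IntZ; [|by apply: bmfM..].
rewrite -IntD; [|by apply: bmfZ; apply: bmfM..].
by apply: eq_Rintegral => x _; rewrite /mixture; ring.
Qed.

Lemma test_density_mixture (lo eta : R) (f g : T -> R) : 0 <= eta <= 1 ->
  test_density lo f -> test_density lo g -> test_density lo (mixture eta f g).
Proof.
move=> /andP[e0 e1] [bf f01 lf] [bg g01 lg]; split.
- by apply: bmfD; exact: bmfZ.
- move=> x; have /andP[? ?] := f01 x; have /andP[? ?] := g01 x.
  by rewrite /mixture; apply/andP; split; nra.
- have := @Int_mixture eta (fun=> 1) f g (bmf_cst _ _) bf bg.
  have E1 (h : T -> R) : \int[mu]_x (1 * h x) = \int[mu]_x h x.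
    by apply: eq_Rintegral => x _; rewrite mul1r.
  by rewrite !E1 => ->; nra.
Qed.

(** The densities satisfying the first N constraints form decreasing convex sets.
Their minimal squared L^2 norms increase to a finite limit.  Two densities from
far out in the sequence whose squared norms almost attain this limit have a
midpoint whose norm is not much smaller, so they are close by the parallelogram
identity. *)
Lemma countable_constraints (lo C : R) (k : nat -> T -> R) : (forall i, bmf (k i)) ->
  (forall N, exists2 h, test_density lo h &
     forall i, (i < N)%N -> \int[mu]_x (k i x * h x) <= C) ->
  exists2 h, test_density lo h & forall i, \int[mu]_x (k i x * h x) <= C.
Proof.
move=> bk fin.
pose m := \int[mu]_x 1.
pose A N h := test_density lo h /\
  forall i, (i < N)%N -> \int[mu]_x (k i x * h x) <= C.
(* dl N below is the infimum of the squared norms under N constraints, and dlt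
   the limit of these infima. *)
pose E N := [set \int[mu]_x (h x ^+ 2) | h in [set h | A N h]].
have E0 N : E N !=set0.
  by have [h Hh hP] := fin N; exists (\int[mu]_x (h x ^+ 2)), h.
have Elb N : has_lbound (E N).
  by exists 0 => _ [h _ <-]; apply: Int_ge0 => x; exact: sqr_ge0.
have Einf N : has_inf (E N) by split.
pose dl N := inf (E N).
have AS N N' h : (N <= N')%N -> A N' h -> A N h.
  by move=> NN [Hh hP]; split => // i iN; apply: hP; exact: leq_trans NN.
have dlE N h : A N h -> dl N <= \int[mu]_x (h x ^+ 2).
  by move=> Ah; apply: ge_inf => //; exists h.
have dlm N N' : (N <= N')%N -> dl N <= dl N'.
  move=> NN; apply: lb_le_inf => // _ [h Ah <-]; apply: dlE; exact: AS Ah.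
have dlub N : dl N <= m.
  have [h Hh hP] := fin N; apply: le_trans (dlE N h _) _ => //.
  have [bh h01 _] := Hh; apply: Int_le; [exact: bmf_sqr|exact: bmf_cst|].
  by move=> x; have /andP[? ?] := h01 x; rewrite expr_le1.
have Rsup : has_sup (range dl).
  by split; [exists (dl 0%N), 0%N|exists m => _ [N _ <-]].
pose dlt := sup (range dl).
have dl_le N : dl N <= dlt by apply: ub_le_sup; [case: Rsup|exists N].
have e4 (n : nat) : 0 < (4^-1 : R) ^+ n by rewrite exprn_gt0// invr_gt0.
have pick n : exists p : nat * (T -> R), [/\ (n <= p.1)%N, A p.1 p.2,
    dlt - 4^-1 ^+ n <= dl p.1 & \int[mu]_x (p.2 x ^+ 2) <= dlt + 4^-1 ^+ n].
  have [_ [N _ <-] NP] := sup_adherent (e4 n) Rsup.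
  pose N' := maxn N n.
  have [_ [h Ah <-] hP] := inf_adherent (e4 n) (Einf N').
  exists (N', h); split => //=.
  - exact: leq_maxr.
  - by apply/ltW/(lt_le_trans NP); apply: dlm; exact: leq_maxl.
  - by apply: le_trans (ltW hP) _; rewrite lerD2r; exact: dl_le.
have /choice[p pP] := pick.
pose h n := (p n).2.
have Hh n : test_density lo (h n) by have [_ [+ _] _ _] := pP n.
have bh n : bmf (h n) by have [] := Hh n.
have h01 n x : 0 <= h n x <= 1 by have [_ + _] := Hh n.
have gap n : \int[mu]_x ((h n.+1 x - h n x) ^+ 2) <= 8 * 4^-1 ^+ n.
  pose mid := mixture 2^-1 (h n) (h n.+1).
  have Amid : A (minn (p n).1 (p n.+1).1) mid.
    have [_ A1 _ _] := pP n; have [_ A2 _ _] := pP n.+1.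
    have [H1 P1] := AS _ _ _ (geq_minl (p n).1 (p n.+1).1) A1.
    have [H2 P2] := AS _ _ _ (geq_minr (p n).1 (p n.+1).1) A2.
    split; first by apply: test_density_mixture => //; apply/andP; split; lra.
    move=> i iN; rewrite Int_mixture//.
    have := P1 i iN; have := P2 i iN; rewrite -/(h n) -/(h n.+1); lra.
  have b2 f : bmf f -> bmf (fun x => f x ^+ 2 : R) by exact: bmf_sqr.
  have bmid : bmf mid by have [[]] := Amid.
  have le4 : (4^-1 : R) ^+ n.+1 <= 4^-1 ^+ n.
    by rewrite exprS ler_piMl ?(ltW (e4 n))//; lra.
  have lomid : dlt - 4^-1 ^+ n <= \int[mu]_x (mid x ^+ 2).
    apply: le_trans (dlE _ _ Amid).
    have [_ _ d1 _] := pP n; have [_ _ d2 _] := pP n.+1.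
    by rewrite /minn; case: ifP => _ //; lra.
  have [_ _ _ u1] := pP n; have [_ _ _ u2] := pP n.+1.
  rewrite -/(h n) in u1; rewrite -/(h n.+1) in u2.
  have -> : \int[mu]_x ((h n.+1 x - h n x) ^+ 2) =
      2 * \int[mu]_x (h n x ^+ 2) + 2 * \int[mu]_x (h n.+1 x ^+ 2) -
      4 * \int[mu]_x (mid x ^+ 2).
    rewrite -!IntZ; [|by apply: b2..].
    rewrite -IntD; [|by apply: bmfZ; apply: b2..].
    rewrite -IntB; [|by apply: bmfD; apply: bmfZ; apply: b2|by apply: bmfZ; apply: b2].
    by apply: eq_Rintegral => x _; rewrite /mid /mixture; field.
  lra.
(* Inequality of the means: t <= 2^n t^2/2 + 2^-n/2. *)
have fast n : \int[mu]_x `|h n.+1 x - h n x| <= (8 + m) / 2 * 2^-1 ^+ n.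
  have bdiff : bmf (fun x => h n.+1 x - h n x) by exact: bmfB.
  have p2 : 0 < (2 : R) ^+ n by rewrite exprn_gt0.
  apply: (@le_trans _ _ (\int[mu]_x (2 ^+ n / 2 * (h n.+1 x - h n x) ^+ 2 +
     (2^-1 ^+ n / 2) * 1))).
    apply: Int_le => [||x].
    - exact: bmf_norm.
    - by apply: bmfD; [apply: bmfZ; exact: bmf_sqr|apply: bmfZ; exact: bmf_cst].
    rewrite -[(h n.+1 x - h n x) ^+ 2]real_normK ?num_real//.
    move: `|_| => t; rewrite mulr1.
    have -> : 2 ^+ n / 2 * t ^+ 2 + 2^-1 ^+ n / 2 =
      t + 2 ^+ n / 2 * (t - 2^-1 ^+ n) ^+ 2.
      rewrite exprVn; move: (2 ^+ n) p2 => q q0; field; by rewrite gt_eqF.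
    by rewrite lerDl mulr_ge0// ?sqr_ge0// divr_ge0// ltW.
  rewrite IntD; [|by apply: bmfZ; exact: bmf_sqr|by apply: bmfZ; exact: bmf_cst].
  rewrite !IntZ; [|exact: bmf_cst|exact: bmf_sqr].
  rewrite -/m; have := gap n; move: (\int[mu]_x _) => I.
  have -> : (4^-1 : R) ^+ n = 2^-1 ^+ n * 2^-1 ^+ n.
    by rewrite -exprMn; congr (_ ^+ _); lra.
  move=> gI; have : 2 ^+ n / 2 * I <= 2 ^+ n / 2 * (8 * (2^-1 ^+ n * 2^-1 ^+ n)).
    by apply: ler_wpM2l gI; rewrite divr_ge0// ltW.
  have -> : 2 ^+ n / 2 * (8 * (2^-1 ^+ n * 2^-1 ^+ n)) = 4 * 2^-1 ^+ n :> R.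
    by rewrite exprVn; move: (2 ^+ n) p2 => q q0; field; rewrite gt_eqF.
  by move: (2^-1 ^+ n) => v; lra.
have [f [bf f01 fP]] := fast_cauchy_limit bh h01 fast.
exists f.
  split => //; have := fP (fun=> 1) (bmf_cst _ _).
  under eq_Rintegral do rewrite mul1r.
  move=> c; apply: (cvgr_to_ge c); apply: nearW => n /=.
  by under eq_Rintegral do rewrite mul1r; have [] := Hh n.
move=> i; apply: (cvgr_to_le (fP (k i) (bk i))).
exists i.+1 => // n /= iN.
have [np [_ AP] _ _] := pP n.
by apply: AP; apply: leq_trans np.
Qed.

End countable_constraints.

Section bounded_potentials.
Context d (T : measurableType d) (R : realType).
Variables (mu : {finite_measure set T -> \bar R}) (dist : T -> T -> R).
Variables (s M : R) (G : set T).
Hypothesis WB : wolff_bounded mu dist s M G.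
Hypothesis m_gt0 : 0 < \int[mu]_y 1.
Local Notation r := (scale M).

(** The constraints are indexed by the coordinate, the scale, the point and a sign;
each is dominated by the sum over the coordinates of the absolute values that
[greedy_response] bounds on average. *)
Theorem bounded_potentials (D : nat) (L : R) (k : 'I_D -> nat -> T -> T -> R)
    (x : nat -> T) : 0 <= L -> (forall c, kernel_family dist s M L (k c)) ->
  exists2 h, test_density mu (\int[mu]_y 1 / 2) h &
    forall c n j, `|kernel_op mu (k c n) h (x j)| <= D%:R * (2 * response_constant s L) + 1.
Proof.
move=> L0 kf.
pose C := D%:R * (2 * response_constant s L).
pose m := \int[mu]_y (1 : R).
pose code := ('I_D * nat * nat * bool)%type.
pose g i : T -> R := if unpickle i is Some q then
   fun y => (-1) ^+ (q : code).2 * k q.1.1.1 q.1.1.2 (x q.1.2) y else fun=> 0.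
have bg i : bmf (g i).
  rewrite /g; case: unpickle => [q|]; last exact: bmf_cst.
  by apply: bmfZ; exact: (bmf_kernel_row WB ((kf q.1.1.1).1 q.1.1.2)).
pose e i := if unpickle i is Some q then (q : code).1.1.2 else 0%N.
pose pt i := x (if unpickle i is Some q then (q : code).1.2 else 0%N).
have gle i h : bmf h -> \int[mu]_y (g i y * h y) <=
    \sum_(c < D) `|kernel_op mu (k c (e i)) h (pt i)|.
  move=> bh; rewrite /g /e /pt; case: unpickle => [q|]; last first.
    under eq_Rintegral do rewrite mul0r.
    by rewrite Int0; apply: sumr_ge0 => c _; exact: normr_ge0.
  under eq_Rintegral do rewrite -mulrA.
  have bkh := bmfM (bmf_kernel_row WB ((kf q.1.1.1).1 q.1.1.2) (x q.1.2)) bh.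
  rewrite IntZ// (bigD1 q.1.1.1)//= -[leLHS]addr0; apply: lerD; last by apply: sumr_ge0 => c _; exact: normr_ge0.
  by apply: le_trans (ler_norm _) _; rewrite normrMsign.
have [h Hh hP] : exists2 h, test_density mu (m / 2) h &
    forall i, \int[mu]_y (g i y * h y) <= C + 1.
  apply: (countable_constraints bg) => N.
  pose B i := \int[mu]_y `|g i y|.
  apply: (@approach R (T -> R) (test_density mu (m / 2)) (@mixture _ T R)
    (fun i h => \int[mu]_y (g i y * h y)) C B _ _ _ _ (fun=> 1)).
  - by move=> *; exact: test_density_mixture.
  - by move=> i eta f1 f2 _ [b1 _ _] [b2 _ _]; exact: (Int_mixture mu eta (bg i) b1 b2).
  - move=> i f [bf f01 _]; apply: le_trans (Int_norm _ _) _; first exact: bmfM.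
    apply: Int_le => [||y]; [by apply: bmf_norm; exact: bmfM|exact: bmf_norm|].
    by have /andP[? ?] := f01 y; rewrite normrM ler_piMr// ger0_norm.
  - move=> N' a a0 a1.
    have [|h [bh h01 Ih hP]] := @greedy_response _ _ _ _ _ _ _ _ WB m_gt0 N' pt e a (fun i _ => a0 i).
      by rewrite a1.
    exists h => //.
    apply: (@le_trans _ _ (\sum_(i < N') \sum_(c < D) a i * `|kernel_op mu (k c (e i)) h (pt i)|)).
      by apply: ler_sum => i _; rewrite -mulr_sumr; apply: ler_wpM2l => //; exact: gle.
    rewrite exchange_big/= /C mulr_natl -[X in _ *+ X]card_ord -sumr_const.
    by apply: ler_sum => c _; exact: hP.
  - split; [exact: bmf_cst|by move=> y; rewrite ler01 lexx|].
    by rewrite -/m ler_pdivrMr// ler_peMr ?ler1n//; exact: ltW.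
exists h => // c n j; have [bh _ _] := Hh.
have bkh := bmfM (bmf_kernel_row WB ((kf c).1 n) (x j)) bh.
have key (b : bool) : (-1) ^+ b * kernel_op mu (k c n) h (x j) <= C + 1.
  have := hP (pickle ((c, n, j, b) : code)); rewrite /g pickleK/=.
  by under eq_Rintegral do rewrite -mulrA; rewrite IntZ.
rewrite ler_norml; have := key false; have := key true.
by rewrite expr0 expr1 mulN1r mul1r -/C => ? ?; apply/andP; split; lra.
Qed.

End bounded_potentials.

(** * Measures with bounded density *)

Section density_measure.
Context d (T : measurableType d) (R : realType).
Variables (mu : {finite_measure set T -> \bar R}) (h : T -> R).
Hypothesis bh : bmf h.
Hypothesis h0 : forall x, 0 <= h x.

(** The conditions on h are arguments so that the structure of a finite measure can
be inferred from the term. *)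
Definition density of bmf h & (forall x, 0 <= h x) : set T -> \bar R :=
  fun A => (\int[mu]_(x in A) (h x)%:E)%E.

Let nu := density bh h0.

Let nu0 : nu set0 = 0%E.
Proof. exact: integral_set0. Qed.

Let nu_ge0 A : (0 <= nu A)%E.
Proof. by apply: integral_ge0 => x _; rewrite lee_fin. Qed.

Let nu_sigma : semi_sigma_additive nu.
Proof.
apply: (semi_sigma_additive_nng_induced (f := EFin \o h)) => [|x].
  by apply/measurable_EFinP; have [] := bh.
by rewrite /= lee_fin.
Qed.

HB.instance Definition _ := isMeasure.Build _ _ _ (density bh h0) nu0 nu_ge0 nu_sigma.

Let nu_fin : fin_num_fun nu.
Proof.
move=> A mA; apply: integrable_fin_num => //.
by apply: (@integrableS _ _ _ mu setT) => //; exact: bmf_integrable.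
Qed.

HB.instance Definition _ := @Measure_isFinite.Build _ _ _ (density bh h0) nu_fin.

Lemma density_integral (g : T -> R) : bmf g ->
  \int[density bh h0]_x g x = \int[mu]_x (g x * h x).
Proof.
move=> bg; rewrite /Rintegral; congr fine.
have dom : (density bh h0 : {measure set T -> \bar R}) `<< mu.
  apply/null_content_dominatesP => A mA A0 /=.
  apply: null_set_integral => //; apply: measurable_funTS.
  by apply/measurable_EFinP; have [] := bh.
have ig : (density bh h0 : {finite_measure set T -> \bar R}).-integrable setT (EFin \o g).
  exact: bmf_integrable.
rewrite -(Radon_Nikodym_change_of_variables dom measurableT ig).
apply: ae_eq_integral => //.
- apply: emeasurable_funM; first exact: measurable_int ig.
  by apply: (@measurable_int _ _ _ mu); exact: Radon_Nikodym_integrable.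
- exact: measurable_int (bmf_integrable mu (bmfM bg bh)).
apply: (ae_eq_trans (g := fun x => (g x)%:E * (h x)%:E)%E); last exact: aeW.
apply: ae_eqe_mul2l.
apply: integral_ae_eq => //.
- exact: Radon_Nikodym_integrable.
- by apply/measurable_EFinP; have [] := bh.
- by move=> E _ mE; rewrite -Radon_Nikodym_integral.
Qed.

End density_measure.

(** * Regularized Riesz kernels *)

Section euclidean_norm.
Context {R : realType} {d : nat}.
Implicit Types x y : 'rV[R]_d.

Lemma enorm_ge0 x : 0 <= enorm x. Proof. exact: sqrtr_ge0. Qed.

Lemma sqr_enorm x : enorm x ^+ 2 = \sum_(i < d) x ord0 i ^+ 2.
Proof. by rewrite sqr_sqrtr// sumr_ge0// => i _; exact: sqr_ge0. Qed.

Lemma enorm0 : enorm (0 : 'rV[R]_d) = 0.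
Proof. by rewrite /enorm big1 ?sqrtr0// => i _; rewrite mxE expr0n. Qed.

Lemma enormN x : enorm (- x) = enorm x.
Proof. by congr Num.sqrt; apply: eq_bigr => i _; rewrite mxE sqrrN. Qed.

Lemma coord_le_enorm x i : `|x ord0 i| <= enorm x.
Proof.
rewrite -(ler_pXn2r (n := 2))// ?nnegrE ?enorm_ge0// real_normK ?num_real//.
rewrite sqr_enorm (bigD1 i)//= lerDl; apply: sumr_ge0 => j _; exact: sqr_ge0.
Qed.

Lemma enorm_eq0 x : enorm x = 0 -> x = 0.
Proof.
move=> x0; apply/rowP => i; rewrite mxE; apply/eqP; rewrite -normr_le0 -x0.
exact: coord_le_enorm.
Qed.

Lemma enorm_cauchy_schwarz x y : \sum_(i < d) x ord0 i * y ord0 i <= enorm x * enorm y.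
Proof.
have [x0|x0] := eqVneq (enorm x) 0.
  by rewrite x0 mul0r (enorm_eq0 x0) big1// => i _; rewrite mxE mul0r.
have [y0|y0] := eqVneq (enorm y) 0.
  by rewrite y0 mulr0 (enorm_eq0 y0) big1// => i _; rewrite mxE mulr0.
have xp : 0 < enorm x by rewrite lt_def x0 enorm_ge0.
have yp : 0 < enorm y by rewrite lt_def y0 enorm_ge0.
set a := enorm x in x0 xp *; set b := enorm y in y0 yp *.
apply: (@le_trans _ _ (\sum_(i < d) (b / a / 2 * x ord0 i ^+ 2 + a / b / 2 * y ord0 i ^+ 2))).
  apply: ler_sum => i _; move: (x ord0 i) (y ord0 i) => u v.
  have -> : b / a / 2 * u ^+ 2 + a / b / 2 * v ^+ 2 =
    u * v + (b * u - a * v) ^+ 2 / (2 * a * b) by field; rewrite x0 y0.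
  by rewrite lerDl divr_ge0 ?sqr_ge0// !mulr_ge0// ltW.
rewrite big_split/= -!mulr_sumr -!sqr_enorm -/a -/b.
by rewrite le_eqVlt; apply/orP; left; apply/eqP; field; rewrite x0 y0.
Qed.

Lemma enormD x y : enorm (x + y) <= enorm x + enorm y.
Proof.
rewrite -(ler_pXn2r (n := 2))// ?nnegrE ?enorm_ge0 ?addr_ge0 ?enorm_ge0//.
have -> : enorm (x + y) ^+ 2 =
    enorm x ^+ 2 + 2 * (\sum_(i < d) x ord0 i * y ord0 i) + enorm y ^+ 2.
  rewrite !sqr_enorm mulr_sumr -!big_split/=; apply: eq_bigr => i _.
  by rewrite mxE; ring.
by have := enorm_cauchy_schwarz x y; rewrite sqrrD; lra.
Qed.

Lemma enormB x y : enorm (x - y) = enorm (y - x).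
Proof. by rewrite -enormN opprB. Qed.

Lemma enorm_le_sum x : enorm x <= \sum_(i < d) `|x ord0 i|.
Proof.
rewrite -(ler_pXn2r (n := 2))// ?nnegrE ?enorm_ge0 ?sumr_ge0//.
rewrite sqr_enorm expr2 mulr_suml; apply: ler_sum => i _.
rewrite -real_normK ?num_real// expr2; apply: ler_wpM2l => //.
by rewrite (bigD1 i)//= lerDl sumr_ge0.
Qed.

Lemma measurable_enorm : measurable_fun [set: 'rV[R]_d] (@enorm R d).
Proof.
have -> : @enorm R d = fun x => (\sum_(i < d) x ord0 i ^+ 2) `^ (2^-1).
  apply/funext => x; rewrite /enorm powR12_sqrt//.
  by apply: sumr_ge0 => i _; exact: sqr_ge0.
apply: (measurableT_comp (measurable_powR _)).
apply: measurable_sum => i; apply: measurable_funX; exact: measurable_coord.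
Qed.

Lemma measurable_rV_sub d' (T : measurableType d') (f g : T -> 'rV[R]_d) :
  measurable_fun [set: T] f -> measurable_fun [set: T] g ->
  measurable_fun [set: T] (fun t => f t - g t).
Proof.
move=> mf mg; apply: measurable_rV => i.
under eq_fun do rewrite !mxE.
by apply: measurable_funB; exact: (measurableT_comp (measurable_coord i)).
Qed.

End euclidean_norm.

Section regularized_kernel.
Context {R : realType}.

(** From exp(u) >= 1 + u and ln(u) <= u - 1. *)
Lemma powR_bernoulli (q t : R) : 0 <= q -> 0 < t -> t <= 1 -> 1 - q * (t^-1 - 1) <= t `^ q.
Proof.
move=> q0 t0 t1; rewrite /powR gt_eqF//.
apply: le_trans (expR_ge1Dx _); rewrite lerD2l -mulrN; apply: ler_wpM2l => //.
rewrite lerNl -lnV ?posrE//.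
have := @le_ln1Dx R (t^-1 - 1); rewrite (addrC 1) subrK; apply.
by have := invr_gt0 t; rewrite t0 => ?; lra.
Qed.

Lemma inv_powR_diff (q a b : R) : 0 <= q -> 0 < b -> b <= a ->
  (b `^ q)^-1 - (a `^ q)^-1 <= q * (a - b) / b / (b `^ q).
Proof.
move=> q0 b0 ba; have a0 : 0 < a by exact: lt_le_trans ba.
have p0 : 0 < b `^ q by rewrite powR_gt0.
rewrite ler_pdivlMr// mulrBl mulVf ?gt_eqF//.
have -> : (a `^ q)^-1 * b `^ q = (b / a) `^ q.
  rewrite powRM ?invr_ge0 ?(ltW a0) ?(ltW b0)// mulrC; congr (_ * _).
  by rewrite -(powR_inv1 (ltW a0)) -powRrM mulN1r powRN.
have ba0 : 0 < b / a by rewrite divr_gt0.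
have ba1 : b / a <= 1 by rewrite ler_pdivrMr// mul1r.
have := powR_bernoulli q0 ba0 ba1; rewrite invf_div.
have -> : q * (a / b - 1) = q * (a - b) / b by field; rewrite gt_eqF.
lra.
Qed.

Context {d : nat}.
Implicit Types x y z : 'rV[R]_d.

(** The i-th coordinate of the Riesz kernel, made Lipschitz by freezing the
denominator in the ball of radius [e]. *)
Definition reg_kernel (s e : R) (i : 'I_d) x : R :=
  x ord0 i / (Num.max (enorm x) e) `^ (s + 1).

Lemma reg_kernelN s e i x : reg_kernel s e i (- x) = - reg_kernel s e i x.
Proof. by rewrite /reg_kernel enormN mxE mulNr. Qed.

(** Change the numerator at the larger denominator A and the denominator from A to
B at the smaller numerator, which is at most B; the second change is
controlled by [inv_powR_diff]. *)
Lemma reg_kernel_lip (s e : R) i x y : 0 < s -> 0 < e ->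
  enorm y <= enorm x ->
  `|reg_kernel s e i x - reg_kernel s e i y| *
    (Num.max (enorm y) e) `^ (s + 1) <= (s + 2) * enorm (x - y).
Proof.
move=> s0 e0 yx; rewrite /reg_kernel.
set A := Num.max (enorm x) e; set B := Num.max (enorm y) e.
have BA : B <= A by rewrite ge_max !le_max yx lexx orbT.
have B0 : 0 < B by rewrite lt_max e0 orbT.
have A0 : 0 < A by rewrite lt_max e0 orbT.
set q := s + 1; have q0 : 0 <= q by rewrite /q; lra.
have pB : 0 < B `^ q by rewrite powR_gt0.
have pA : 0 < A `^ q by rewrite powR_gt0.
have pAB : B `^ q <= A `^ q by apply: le_powR => //; exact: ltW.
have AB : A - B <= enorm (x - y).
  have h : enorm x - enorm y <= enorm (x - y).
    by have := enormD (x - y) y; rewrite subrK; lra.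
  have : A <= B + enorm (x - y).
    rewrite ge_max; apply/andP; split.
      have : enorm y <= B by rewrite le_max lexx. lra.
    have : e <= B by rewrite le_max lexx orbT.
    have := enorm_ge0 (x - y). lra.
  lra.
have E : x ord0 i / A `^ q - y ord0 i / B `^ q =
   (x - y) ord0 i / A `^ q - y ord0 i * ((B `^ q)^-1 - (A `^ q)^-1).
  by rewrite !mxE; ring.
rewrite E; apply: (@le_trans _ _ ((enorm (x - y) / A `^ q +
    B * (q * (A - B) / B / (B `^ q))) * B `^ q)).
  apply: ler_wpM2r; first exact: ltW.
  apply: le_trans (ler_normB _ _) _; apply: lerD.
    rewrite normrM; apply: ler_pM => //; first exact: coord_le_enorm.
    by rewrite ger0_norm// invr_ge0 ltW.
  rewrite normrM; apply: ler_pM => //.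
    by apply: le_trans (coord_le_enorm y i) _; rewrite le_max lexx.
  rewrite ger0_norm; first exact: inv_powR_diff.
  by rewrite subr_ge0 lef_pV2 ?posrE.
have -> : (enorm (x - y) / A `^ q + B * (q * (A - B) / B / B `^ q)) * B `^ q =
  enorm (x - y) * (B `^ q / A `^ q) + q * (A - B).
  by field; rewrite !gt_eqF.
have -> : (s + 2) * enorm (x - y) = enorm (x - y) * 1 + q * enorm (x - y).
  by rewrite /q; ring.
apply: lerD; last exact: ler_wpM2l.
by apply: ler_wpM2l; [exact: enorm_ge0|rewrite ler_pdivrMr// mul1r].
Qed.

Lemma measurable_reg_kernel (s e : R) i : 0 < e ->
  measurable_fun [set: 'rV[R]_d] (reg_kernel s e i).
Proof.
move=> e0; apply: measurable_funM; first exact: measurable_coord.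
under eq_fun do rewrite -powRN.
apply: (measurableT_comp (measurable_powR _)).
by apply: measurable_maxr; [exact: measurable_enorm|exact: measurable_cst].
Qed.

Definition rV_dist x y : R := enorm (y - x).

Lemma reg_kernel_family (s M : R) i : 0 < s -> 0 < M ->
  kernel_family rV_dist s M (s + 2)
    (fun n x y => reg_kernel s (scale M n) i (y - x)).
Proof.
move=> s0 M0; have r0 := scale_gt0 M0.
have powE (W : R) : 0 < W -> W `^ s * W = W `^ (s + 1).
  by move=> W0; rewrite powRD ?powRr1 ?(ltW W0)// (gt_eqF W0) implybT.
split=> [n|n n' y z nn' ryz]; last first.
  rewrite /reg_kernel; have := scale_le M0 nn'; rewrite /rV_dist in ryz.
  by move=> /le_trans/(_ ryz) h; rewrite !(max_idPl _).
split => [|x y|x y|x y z]; last (cbv zeta; set W := Num.max (Num.min _ _) _).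
- apply: (measurableT_comp (measurable_reg_kernel _ _ (r0 n))).
  exact: (measurable_rV_sub measurable_snd measurable_fst).
- by rewrite -reg_kernelN opprB.
- rewrite /reg_kernel -/(rV_dist x y).
  set m := Num.max _ _; have m0 : 0 < m by rewrite lt_max r0 orbT.
  rewrite normrM [X in _ * X * _]ger0_norm ?invr_ge0 ?powR_ge0// -(powE _ m0).
  have -> (a : R) : a / (m `^ s * m) * m `^ s = a / m.
    by field; rewrite (gt_eqF m0) gt_eqF// powR_gt0.
  rewrite ler_pdivrMr// mul1r.
  by apply: le_trans (coord_le_enorm _ _) _; rewrite le_max lexx.
- have W0 : 0 < W by rewrite lt_max r0 orbT.
  rewrite powE// /W /rV_dist.
  have D : (z - x) - (z - y) = y - x by rewrite opprB addrC addrA subrK.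
  have [h|h] := leP (enorm (z - x)) (enorm (z - y)).
    rewrite distrC; apply: le_trans (reg_kernel_lip _ _ _ h) _ => //.
    by rewrite -opprB D enormN.
  by apply: le_trans (reg_kernel_lip _ _ _ (ltW h)) _ => //; rewrite D.
Qed.

End regularized_kernel.

(** * The lower bound for the capacity of the Riesz transform *)

Section constants.
Context {R : realType}.
Variables (d : nat) (s : R).

Definition potential_constant : R :=
  d%:R * (2 * response_constant s (s + 2)) + 1.

(** Dividing a density by this constant brings every coordinate of every truncated
transform below 1/d; the summand 4^s pays for the difference between the
sharp and the regularized truncation. *)
Definition normalization : R := d%:R * (potential_constant + 4 `^ s).

Hypothesis d_gt0 : (0 < d)%N.
Hypothesis s0 : 0 < s.

Lemma normalization_gt0 : 0 < normalization.
Proof.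
have s20 : 0 <= s + 2 by rewrite addr_ge0// ltW.
rewrite mulr_gt0 ?ltr0n//; apply: ltr_wpDl; last exact: powR_gt0.
rewrite /potential_constant /response_constant /near_constant.
have p0 (x : R) : 0 <= x `^ s by exact: powR_ge0.
have q0 : 0 <= 4 * (s + 2) * (2 `^ s) ^+ 3 + (2 `^ s) ^+ 3 :> R.
  by rewrite addr_ge0 ?mulr_ge0 ?exprn_ge0.
move: (4 * (s + 2) * _ + _) q0 => E E0.
do ?[apply: addr_ge0|apply: mulr_ge0]; rewrite ?invr_ge0 //.
exact: ltW.
Qed.

Variable M : R.
Hypothesis M0 : 0 < M.
Local Notation r := (scale M).
Notation X := 'rV[R]_d.

Lemma rV_point : enorm (point : X) = 0.
Proof.
rewrite (_ : point = 0) ?enorm0//.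
by apply/rowP => i; rewrite !mxE.
Qed.

(** It suffices to control one sequence of truncation radii tending to 0.  Where
the limit does not exist, the default value of the transform is the zero
vector. *)
Lemma transform_bound (nu : {measure set X -> \bar R}) x :
  (forall n c, `|riesz_truncated s nu (r n) x ord0 c| <= d%:R^-1) ->
  enorm (riesz_transform s nu x) <= 1.
Proof.
move=> tb; rewrite /riesz_transform.
have [cv|ncv] := pselect (cvg (riesz_truncated s nu eps x @[eps --> 0^'+])); last first.
  by rewrite dvgP// rV_point ler01.
apply: le_trans (enorm_le_sum _) _.
apply: (@le_trans _ _ (\sum_(i < d) d%:R^-1)); last first.
  by rewrite sumr_const card_ord -[leLHS]mulr_natl mulfV// pnatr_eq0 -lt0n.
apply: ler_sum => c _.
set l := lim _.
have cl : (riesz_truncated s nu eps x ord0 c) @[eps --> 0^'+] --> l ord0 c.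
  apply: (@continuous_cvg _ _ _ _ _ _ (fun v : X => v ord0 c)) => //.
  exact: coord_continuous.
have /cvg_at_rightP/(_ r) := cl.
have r0 : r n @[n --> \oo] --> 0.
  by apply: cvg_geometric; rewrite ger0_norm ?invr_ge0// invf_lt1// ltr1n.
move=> /(_ (conj (fun n => scale_gt0 M0 n) r0)) crn.
by apply: (cvgr_to_le (cvg_norm crn)); apply: nearW => n; exact: tb.
Qed.

End constants.

Section gamma_lower_bound.
Context {R : realType} {d : nat}.
Notation X := 'rV[R]_d.

Lemma rational_approx (x : X) (e : R) : 0 < e ->
  exists q : 'rV[rat]_d, enorm (\row_i ratr (q ord0 i) - x) <= e.
Proof.
move=> e0.
have D0 : 0 < d.+1%:R :> R by [].
have /choice[q qP] : forall i : 'I_d, exists q : rat, `|ratr q - x ord0 i| <= e / d.+1%:R :> R.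
  move=> i; have ed : 0 < e / d.+1%:R by rewrite divr_gt0.
  have /rat_in_itvoo[q] : x ord0 i - e / d.+1%:R < x ord0 i + e / d.+1%:R.
    by rewrite ltrD2l gtrN.
  rewrite in_itv/= => /andP[]; move: (e / _) => e' q1 q2; exists q.
  by rewrite ler_norml; apply/andP; split; lra.
exists (\row_i q i); apply: le_trans (enorm_le_sum _) _.
apply: (@le_trans _ _ (\sum_(i < d) e / d.+1%:R)).
  by apply: ler_sum => i _; rewrite !mxE; exact: qP.
rewrite sumr_const card_ord -[leLHS]mulr_natl mulrCA ler_piMr ?(ltW e0)//.
by rewrite ler_pdivrMr// mul1r ler_nat.
Qed.

Variables (mu : {finite_measure set X -> \bar R}) (s M : R) (G : set X).
Hypothesis WB : wolff_bounded mu rV_dist s M G.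
Let s0 : 0 < s := wb_s WB.
Let M0 : 0 < M := wb_M WB.
Local Notation r := (scale M).

Let kern (c : 'I_d) n (x y : X) := reg_kernel s (r n) c (y - x).

Let kf c : kernel_family rV_dist s M (s + 2) (kern c).
Proof. exact: reg_kernel_family. Qed.

Lemma potential_lipschitz c n (h : X -> R) x x' : bmf h -> (forall y, 0 <= h y <= 1) ->
  `|kernel_op mu (kern c n) h x - kernel_op mu (kern c n) h x'| <=
  (s + 2) / r n `^ (s + 1) * \int[mu]_y 1 * enorm (x - x').
Proof.
move=> bh h01; have r0 := scale_gt0 M0 n.
have p0 : 0 < r n `^ (s + 1) by rewrite powR_gt0.
have bk z := bmfM (bmf_kernel_row WB ((kf c).1 n) z) bh.
rewrite /kernel_op -IntB//; apply: le_trans (Int_norm _ _) _; first exact: bmfB.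
rewrite mulrAC -IntZ; last exact: bmf_cst.
apply: Int_le => [||y]; [by apply: bmf_norm; exact: bmfB|by apply: bmfZ; exact: bmf_cst|].
have /andP[h0 h1] := h01 y.
rewrite mulr1 -mulrBl normrM (ger0_norm h0).
apply: (@le_trans _ _ `|kern c n x y - kern c n x' y|); first by rewrite ler_piMr.
rewrite mulrAC ler_pdivlMr//.
have D (z z' : X) : (y - z) - (y - z') = z' - z by rewrite opprB addrC addrA subrK.
have key z z' : enorm (y - z') <= enorm (y - z) ->
    `|kern c n z y - kern c n z' y| * r n `^ (s + 1) <= (s + 2) * enorm (z - z').
  move=> zz'; have := reg_kernel_lip c s0 r0 zz'.
  rewrite D (enormB z' z); apply: le_trans; apply: ler_wpM2l => //.
  apply: le_powR; [by have := s0; lra|exact: ltW|by rewrite le_max lexx orbT].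
have [le_xx'|lt_xx'] := leP (enorm (y - x')) (enorm (y - x)); first exact: key.
by rewrite distrC (enormB x x'); apply: key; exact: ltW.
Qed.

Hypothesis m_gt0 : 0 < \int[mu]_y 1.

(** Points with rational coordinates are countable and dense, and for a fixed scale
the potential is Lipschitz, with a constant that may depend on the scale. *)
Lemma everywhere_bounded_density :
  exists2 h, test_density mu (\int[mu]_y 1 / 2) h &
    forall c n x, `|kernel_op mu (kern c n) h x| <= (potential_constant d s).
Proof.
pose x j : X := if unpickle j is Some q then \row_i ratr ((q : 'rV[rat]_d) ord0 i) else 0.
have s20 : 0 <= s + 2 by have := s0; lra.
have [h Hh hP] := bounded_potentials WB m_gt0 x s20 kf.
exists h => // c n z; have [bh h01 _] := Hh.
apply/ler_addgt0Pr => e e0.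
set K := (s + 2) / r n `^ (s + 1) * \int[mu]_y 1.
have K0 : 0 < K.
  by rewrite mulr_gt0// divr_gt0 ?powR_gt0 ?scale_gt0//; have := s0; lra.
have eK : 0 < e / K by rewrite divr_gt0.
have [q qz] := rational_approx z eK.
have xq : x (pickle q) = \row_i ratr (q ord0 i) by rewrite /x pickleK.
have := potential_lipschitz c n (x (pickle q)) z bh h01; rewrite -/K xq => lip.
have {}lip := le_trans lip (ler_wpM2l (ltW K0) qz).
rewrite mulrC divfK ?gt_eqF// in lip.
have := hP c n (pickle q); rewrite xq -/(potential_constant d s) => b.
move: lip b; move: (kernel_op _ _ _ z) (kernel_op _ _ _ _) => u v lip b.
rewrite -(subKr v u).
by apply: le_trans (ler_normB _ _) _; exact: lerD.
Qed.

Hypothesis d_gt0 : (0 < d)%N.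
Let N0 := normalization_gt0 d_gt0 s0.

(** The two truncations differ only inside B(x,r), where the regularized kernel is
at most r^-s while the mass is at most 4^s r^s. *)
Lemma truncated_bound (h : X -> R) (bh : bmf (fun x => h x / (normalization d s)))
    (h0 : forall x, 0 <= h x / (normalization d s)) c n x :
  test_density mu (\int[mu]_y 1 / 2) h ->
  `|kernel_op mu (kern c n) h x| <= (potential_constant d s) ->
  `|riesz_truncated s (density mu bh h0) (r n) x ord0 c| <= d%:R^-1.
Proof.
move=> [bh' h01 _] hx.
have r0 := scale_gt0 M0 n.
have md : measurable_fun [set: X] (fun y => enorm (y - x)).
  apply: (measurableT_comp measurable_enorm).
  exact: measurable_rV_sub.
pose I (y : X) : R := (r n < enorm (y - x))%R%:R.
have bI : bmf I by apply: bmf_bool; apply: measurable_fun_ltr.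
have bk : bmf (kern c n x) := bmf_kernel_row WB ((kf c).1 n) x.
have bE : bmf (fun y : X => (enorm (y - x) <= r n)%R%:R : R).
  by apply: bmf_bool; apply: measurable_fun_ler.
have -> : riesz_truncated s (density mu bh h0) (r n) x ord0 c =
    \int[mu]_y (kern c n x y * I y * (h y / (normalization d s))).
  rewrite mxE Rintegral_mkcond -density_integral; last exact: bmfM.
  apply: eq_Rintegral => y _; rewrite patchE /I /kern /reg_kernel.
  have [c1|c1] := ltP (r n) (enorm (y - x)).
    by rewrite mem_set// mulr1.
  by rewrite memNset ?mulr0//=; apply/negP; rewrite -leNgt.
have -> : \int[mu]_y (kern c n x y * I y * (h y / (normalization d s))) =
    (normalization d s)^-1 * (kernel_op mu (kern c n) h x -
      \int[mu]_y (kern c n x y * (enorm (y - x) <= r n)%R%:R * h y)).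
  rewrite /kernel_op -IntB; [|exact: bmfM|by apply: bmfM => //; exact: bmfM].
  rewrite -IntZ; last by apply: bmfB; [exact: bmfM|apply: bmfM => //; exact: bmfM].
  apply: eq_Rintegral => y _; rewrite /I leNgt.
  by case: (r n < enorm (y - x))%R => /=; rewrite ?mulr1 ?mulr0; ring.
rewrite normrM ger0_norm ?invr_ge0 ?(ltW N0)// ler_pdivrMl// /normalization.
rewrite mulrC mulKf ?pnatr_eq0 -?lt0n//.
apply: le_trans (ler_normB _ _) _; apply: lerD => //.
have b3 : bmf (fun y => kern c n x y * (enorm (y - x) <= r n)%R%:R * h y).
  by apply: bmfM => //; exact: bmfM.
apply: le_trans (Int_norm _ b3) _.
apply: (@le_trans _ _ ((r n `^ s)^-1 * ball_mass mu rV_dist x (r n))).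
  rewrite -IntZ//; apply: Int_le => [||y]; [exact: bmf_norm|exact: bmfZ|].
  have /andP[y0 y1] := h01 y.
  have := riesz_type_bounded WB ((kf c).1 n) x y; move: (kern c n x y) => q qr.
  rewrite !normrM (ger0_norm y0) (ger0_norm (ler0n _ _)).
  apply: (@le_trans _ _ (`|q| * (enorm (y - x) <= r n)%R%:R)).
    by rewrite ler_piMr// mulr_ge0// ler0n.
  by apply: ler_wpM2r; first exact: ler0n.
rewrite mulrC ler_pdivrMr ?powR_gt0//.
exact: (ball_mass_growth WB).
Qed.

Lemma compact_measurable (E : set X) : compact E -> measurable E.
Proof.
move=> cE; rewrite -(setCK E); apply: measurableC; apply: open_measurable_rV.
by apply: closed_openC; apply: compact_closed => //; exact: norm_hausdorff.
Qed.

Lemma gamma_plus_ge (E : set X) : compact E -> G `<=` E ->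
  (((2 * (normalization d s))^-1 * \int[mu]_y 1)%:E <= gamma_plus s E :> \bar R)%E.
Proof.
move=> cE GE.
have mE := compact_measurable cE.
have [h Hh hP] := everywhere_bounded_density.
have [bh h01 Ih] := Hh.
have bh' : bmf (fun x => h x / (normalization d s)) by apply: bmfM => //; exact: bmf_cst.
have h0 x : 0 <= h x / (normalization d s).
  by have /andP[? _] := h01 x; rewrite divr_ge0// ltW.
pose nu := density mu bh' h0 : {finite_measure set X -> \bar R}.
have muE : mu (~` E) = 0%E.
  apply: (subset_measure0 _ _ _ (wb_muG WB)); [exact: measurableC|..].
    by apply: measurableC; exact: (wb_mG WB).
  by apply: subsetC.
have nuE : nu (~` E) = 0%E.
  apply: null_set_integral => //; first exact: measurableC.
  by apply: measurable_funTS; apply/measurable_EFinP; have [] := bh'.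
have nuT : nu E = (\int[mu]_x (h x / (normalization d s)))%:E.
  rewrite Int_EFin//; transitivity (nu setT); last by [].
  rewrite -(setUv E) measureU//; last by rewrite setICr.
    by rewrite [X in (_ + X)%E]nuE adde0.
  exact: measurableC.
apply: (@le_trans _ _ (nu E)).
  rewrite nuT lee_fin; under [leRHS]eq_Rintegral do rewrite mulrC.
  rewrite IntZ// invfM mulrAC [leLHS]mulrC (mulrC 2^-1).
  by apply: ler_wpM2l => //; rewrite invr_ge0 ltW.
apply: ereal_sup_ubound; exists nu => //; split.
  split=> // K cK; rewrite -ge0_fin_numE//.
  by apply: fin_num_measure; exact: compact_measurable.
rewrite unlock /=; case: ifPn => // _.
apply/ess_supP; apply: aeW => x /=; rewrite lee_fin ger0_norm ?enorm_ge0//.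
apply: (transform_bound d_gt0 M0) => n c; exact: truncated_bound.
Qed.

End gamma_lower_bound.

(** * Energy and the Riesz potential *)

Section energy_lower_bound.
Context {R : realType} {d : nat}.
Notation X := 'rV[R]_d.
Variables (mu : {finite_measure set X -> \bar R}).
Variables (s M c : R).
Hypothesis s_gt0 : 0 < s.
Hypothesis s_ltd : s < d%:R.
Hypothesis M0 : 0 < M.
Hypothesis c0 : 0 < c.
Let alpha : R := 2 / 3 * (d%:R - s).
Let beta : R := d%:R - alpha.
Local Notation r := (scale M).
Local Notation a := (d.+1%:R : R).
Local Notation lam := (@lebesgue_rV R d).
Local Notation V := (ball_mass mu rV_dist).

Let beta0 : 0 < beta.
Proof.
rewrite /beta /alpha; move: s_gt0 s_ltd; move: (d%:R : R) => D ? ?; lra.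
Qed.

Let a0 : 0 < a. Proof. by rewrite ltr0n. Qed.

Let rho : R := (2 `^ beta)^-1.

Let rho01 : 0 < rho < 1.
Proof.
rewrite invr_gt0 powR_gt0//= invf_lt1 ?powR_gt0//.
have : 1 `^ beta < 2 `^ beta by apply: gt0_ltr_powR => //; rewrite ?nnegrE ?ltr1n.
by rewrite powR1.
Qed.

Let tau k : R := ((a * r k) `^ beta)^-1.

Let tau_gt0 k : 0 < tau k.
Proof. by rewrite invr_gt0 powR_gt0 ?mulr_gt0 ?scale_gt0. Qed.

Let tauS k : rho * tau k.+1 = tau k.
Proof.
have p : 0 <= a * r k.+1 by rewrite ltW// mulr_gt0// scale_gt0.
by rewrite /tau (scaleS M k) (mulrCA a 2) (powRM beta (ler0n R 2) p) invfM.
Qed.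

(** The coefficients grow geometrically, so the sum over the scales with
t <= a r_k is dominated by its last term, which is at most t^-beta. *)
Lemma dyadic_sum_le (t : R) N : 0 < t ->
  (1 - rho) * \sum_(k < N) tau k * (t <= a * r k)%R%:R <= (t `^ beta)^-1.
Proof.
move=> t0; have /andP[r0 r1] := rho01.
(* The first bound is the one that propagates; the second uses that tau N is at
   most t^-beta whenever the N-th term occurs. *)
suff [] : (1 - rho) * \sum_(k < N) tau k * (t <= a * r k)%R%:R <= rho * tau N /\
  (1 - rho) * \sum_(k < N) tau k * (t <= a * r k)%R%:R <= (t `^ beta)^-1 by [].
elim: N => [|N [IH1 IH2]].
  rewrite big_ord0 mulr0 invr_ge0 powR_ge0; split => //.
  by rewrite mulr_ge0// ltW.
have tN := tau_gt0 N.
rewrite big_ord_recr/= mulrDr; have [h|h] := leP t (a * r N); last first.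
  rewrite !mulr0 addr0; split => //; apply: le_trans IH1 _.
  by rewrite tauS ler_piMl// ltW.
rewrite mulr1.
have k1 : (1 - rho) * \sum_(k < N) tau k * (t <= a * r k)%R%:R + (1 - rho) * tau N <= tau N.
  by have := IH1; nra.
split; first by rewrite tauS.
apply: le_trans k1 _; rewrite /tau lef_pV2 ?posrE ?powR_gt0 ?mulr_gt0 ?scale_gt0//.
by apply: le_powR => //; exact: ltW.
Qed.

Lemma sum_cube (N : nat) (b : nat -> R) : (forall k, 0 <= b k) ->
  \sum_(k < N) b k ^+ 3 <= (\sum_(k < N) b k) ^+ 3.
Proof.
move=> b0; elim: N => [|N IH]; first by rewrite !big_ord0 expr0n.
rewrite !big_ord_recr/=; apply: (@le_trans _ _ ((\sum_(k < N) b k) ^+ 3 + b N ^+ 3)).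
  by rewrite lerD2r.
have : 0 <= \sum_(k < N) b k by apply: sumr_ge0.
move: (\sum_(k < N) b k) (b N) (b0 N) => x y y0 x0.
have -> : (x + y) ^+ 3 = x ^+ 3 + y ^+ 3 + 3 * (x * y * (x + y)) by ring.
by rewrite lerDl !mulr_ge0// addr_ge0.
Qed.

Local Open Scope ereal_scope.

Lemma measurable_riesz_kernel :
  measurable_fun [set: X] (riesz_kernel c alpha : X -> \bar R).
Proof.
have -> : (riesz_kernel c alpha : X -> \bar R) = fun x : X =>
    if (enorm x <= 0)%R then +oo else (c / enorm x `^ beta)%R%:E.
  apply/funext => x; rewrite /riesz_kernel -/beta.
  have [->|x0] := eqVneq x 0%R; first by rewrite enorm0 lexx.
  case: ifPn => // h; have /eqP : enorm x = 0%R.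
    by apply/eqP; rewrite eq_le h enorm_ge0.
  by move=> /eqP/enorm_eq0 xE; rewrite xE eqxx in x0.
apply: measurable_fun_ifT.
- by apply: measurable_fun_ler => //; exact: measurable_enorm.
- exact: measurable_cst.
- apply/measurable_EFinP; apply: measurable_funM; first exact: measurable_cst.
  under eq_fun do rewrite -powRN.
  exact: (measurableT_comp (measurable_powR _) measurable_enorm).
Qed.

Lemma riesz_kernel_ge0 (x : X) : 0 <= riesz_kernel c alpha x :> \bar R.
Proof.
rewrite /riesz_kernel; case: ifPn => // _.
by rewrite lee_fin divr_ge0 ?powR_ge0// ltW.
Qed.

Lemma measurable_riesz_kernel2 :
  measurable_fun [set: X * X] (fun p : X * X => riesz_kernel c alpha (p.1 - p.2)%R).
Proof.
by apply: (measurableT_comp measurable_riesz_kernel); exact: measurable_rV_sub.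
Qed.

Lemma measurable_riesz_potential : measurable_fun [set: X] (riesz_potential c alpha mu).
Proof.
apply: (@measurable_fun_fubini_tonelli_F _ _ _ _ _ mu
  (fun p : X * X => riesz_kernel c alpha (p.1 - p.2)%R)).
  exact: measurable_riesz_kernel2.
by move=> p; exact: riesz_kernel_ge0.
Qed.

Let coef : R := c * (1 - rho).

Let coef0 : (0 < coef)%R.
Proof. by rewrite mulr_gt0// subr_gt0; have /andP[] := rho01. Qed.

Let bV t : bmf (fun x => V x t).
Proof.
apply: (@bmf_int _ _ _ _ _ mu (fun p : X * X => (rV_dist p.1 p.2 <= t)%R%:R)).
apply: bmf_bool; apply: measurable_fun_ler => //.
by apply: (measurableT_comp measurable_enorm); exact: measurable_rV_sub.
Qed.

Let bB (x : X) t : bmf (fun y => (rV_dist x y <= t)%R%:R : R).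
Proof.
apply: bmf_bool; apply: measurable_fun_ler => //.
by apply: (measurableT_comp measurable_enorm); exact: measurable_rV_sub.
Qed.

(** [dyadic_sum_le] under the integral sign. *)
Lemma riesz_potential_ge N xi :
  (coef * \sum_(k < N) tau k * V xi (a * r k))%:E <= riesz_potential c alpha mu xi.
Proof.
have -> : (coef * \sum_(k < N) tau k * V xi (a * r k))%R =
    (\int[mu]_y (coef * \sum_(k < N) tau k * (rV_dist xi y <= a * r k)%R%:R))%R.
  rewrite IntZ; last by apply: bmf_sum => k; exact: bmfZ.
  rewrite Int_sum; last by move=> k; exact: bmfZ.
  by congr (_ * _)%R; apply: eq_bigr => k _; rewrite IntZ.
have bS : bmf (fun y => coef * \sum_(k < N) tau k * (rV_dist xi y <= a * r k)%R%:R)%R.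
  by apply: bmfZ; apply: bmf_sum => k; exact: bmfZ.
rewrite Int_EFin//; apply: ge0_le_integral => //.
- move=> y _; rewrite lee_fin mulr_ge0 ?(ltW coef0)// sumr_ge0// => k _.
  by rewrite mulr_ge0 ?ler0n// ltW.
- by apply/measurable_EFinP; have [] := bS.
- apply: (measurableT_comp measurable_riesz_kernel2 (pair1_measurable xi)).
- move=> y _; rewrite /riesz_kernel -/beta.
  case: ifPn => [_|xy]; first exact: leey.
  have t0 : (0 < rV_dist xi y)%R.
    rewrite lt_def enorm_ge0 andbT; apply: contraNneq xy => /enorm_eq0/eqP.
    by rewrite subr_eq0 => /eqP ->; rewrite subrr.
  rewrite lee_fin (enormB xi y) -/(rV_dist xi y) /coef -mulrA.
  by apply: ler_wpM2l; [exact: ltW|exact: dyadic_sum_le].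
Qed.

(** One factor of the cube is written as an integral over x in B(xi,at) and the
integrals are exchanged.  For fixed x the box of side 2t around x lies in the
ball of radius d t, and B(xi,at) contains B(x,t) for xi in it because a = d+1. *)
Lemma ball_mass_cube_ge (t : R) : (0 < t)%R ->
  ((2 * t) ^+ d * \int[mu]_x (V x t ^+ 2))%:E <=
  \int[lam]_xi (V xi (a * t) ^+ 3)%:E.
Proof.
move=> t0.
pose J (p : X * X) : R := ((rV_dist p.1 p.2 <= a * t)%R%:R * V p.1 (a * t) ^+ 2)%R.
have mJ : measurable_fun [set: X * X] (EFin \o J).
  apply/measurable_EFinP; apply: measurable_funM.
    have [] // : bmf (fun p : X * X => (rV_dist p.1 p.2 <= a * t)%R%:R : R).
    apply: bmf_bool; apply: measurable_fun_ler => //.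
    by apply: (measurableT_comp measurable_enorm); exact: measurable_rV_sub.
  have [mV _] := bmf_sqr (bV (a * t)).
  exact: (measurableT_comp mV measurable_fst).
have J0 p : 0 <= (EFin \o J) p.
  by rewrite lee_fin mulr_ge0 ?ler0n// sqr_ge0.
have -> : \int[lam]_xi (V xi (a * t) ^+ 3)%:E =
    \int[lam]_xi \int[mu]_x (EFin \o J) (xi, x).
  apply: eq_integral => xi _; rewrite -Int_EFin; last first.
    by apply: bmfM; [exact: bB|exact: (bmf_cst X (V xi (a * t) ^+ 2)%R)].
  congr EFin; rewrite /J/=; under eq_Rintegral do rewrite mulrC.
  by rewrite IntZ// -/(V xi (a * t)) exprSr.
rewrite (@fubini_tonelli _ _ _ _ _ lam mu _ mJ J0).
rewrite -IntZ ?Int_EFin; last 2 first.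
- by apply: bmfZ; exact: bmf_sqr.
- exact: bmf_sqr.
have bl : bmf (fun x => (2 * t) ^+ d * V x t ^+ 2)%R by apply: bmfZ; exact: bmf_sqr.
apply: ge0_le_integral => //.
- by move=> x _; rewrite lee_fin mulr_ge0 ?sqr_ge0// exprn_ge0// mulr_ge0// ltW.
- by apply/measurable_EFinP; have [] := bl.
- exact: (@measurable_fun_fubini_tonelli_G _ _ _ _ _ lam _ mJ J0).
move=> x _.
pose lo : X := (\row_i (x ord0 i - t))%R; pose hi : X := (\row_i (x ord0 i + t))%R.
pose box := [set v : X | forall i, (lo ord0 i <= v ord0 i <= hi ord0 i)%R].
have mbox : measurable box.
  have -> : box = \bigcap_(i in [set: 'I_d])
      ((fun v : X => v ord0 i) @^-1` `[lo ord0 i, hi ord0 i]).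
    apply/seteqP; split => [v h i _|v h i] /=; first by rewrite in_itv/=; exact: h.
    by have := h i I; rewrite /= in_itv.
  apply: fin_bigcap_measurable => [|i _]; first exact: finite_finset.
  by rewrite -[X in measurable X]setTI; apply: measurable_coord.
have -> : ((2 * t) ^+ d * V x t ^+ 2)%:E = \int[lam]_(xi in box) (V x t ^+ 2)%:E.
  have vol : lam box = ((2 * t) ^+ d)%:E.
    apply: etrans (lebesgue_rV_box _) _ => [i|].
      by rewrite !mxE; move: t0 => ?; lra.
    congr EFin; rewrite (eq_bigr (fun=> 2 * t)%R); last by move=> i _; rewrite !mxE; ring.
    by rewrite prodr_const card_ord.
  by rewrite integral_cst// [X in _ * X]vol -EFinM mulrC.
apply: (@le_trans _ _ (\int[lam]_(xi in box) (EFin \o J) (xi, x))); last first.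
  apply: ge0_subset_integral => //.
  exact: (measurableT_comp mJ (pair2_measurable x)).
apply: ge0_le_integral => //.
- by move=> xi _; rewrite lee_fin sqr_ge0.
- by apply: measurable_funTS; exact: (measurableT_comp mJ (pair2_measurable x)).
move=> xi bxi.
have dx : (rV_dist xi x <= d%:R * t)%R.
  apply: le_trans (enorm_le_sum _) _.
  have -> : (d%:R * t = \sum_(i < d) t)%R by rewrite sumr_const card_ord mulr_natl.
  apply: ler_sum => i _.
  have := bxi i; rewrite !mxE ler_norml => /andP[? ?]; apply/andP; split; lra.
have aE : a = (d%:R + 1)%R by rewrite natr1.
rewrite /= lee_fin /J /=.
rewrite (le_trans dx) ?mul1r; last by rewrite aE; have := t0; lra.
rewrite ler_sqr ?nnegrE; try by apply: Int_ge0 => y; exact: ler0n.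
apply: Int_le => [||y]; [exact: bB|exact: bB|rewrite ler_nat].
case: (leP (rV_dist x y) t) => //= h; rewrite lt0b.
have -> : rV_dist xi y = enorm ((y - x) + (x - xi)) by rewrite /rV_dist addrA subrK.
by apply: le_trans (enormD _ _) _; rewrite aE mulrDl mul1r addrC lerD.
Qed.

(** Product of the normalization of the kernel, the scale-free part of the
coefficients tau and the volume factor 2^d of the box of [ball_mass_cube_ge]. *)
Definition energy_constant : R := coef ^+ 3 * ((a `^ beta)^-1) ^+ 3 * 2 ^+ d.

Lemma energy_constant_gt0 : (0 < energy_constant)%R.
Proof.
have p0 : (0 < a `^ beta)%R by rewrite powR_gt0.
apply: mulr_gt0; last by rewrite exprn_gt0.
by apply: mulr_gt0; rewrite exprn_gt0// invr_gt0.
Qed.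

(* The powers of the radius match because 3 beta = d + 2s. *)
Let scale_exponents k : (energy_constant / (r k `^ s) ^+ 2)%R =
  ((coef * tau k) ^+ 3 * (2 * r k) ^+ d)%R.
Proof.
have rk0 := scale_gt0 M0 k.
have E : ((r k `^ beta) ^+ 3 = r k ^+ d * (r k `^ s) ^+ 2)%R.
  have Ex (u : R) n : ((r k `^ u) ^+ n = r k `^ (u * n%:R))%R.
    by rewrite powRrM powR_mulrn// powR_ge0.
  rewrite !Ex -(powR_mulrn d (ltW rk0)) -powRD; last by rewrite (gt_eqF rk0) implybT.
  apply: (congr1 (powR (r k))); rewrite /beta /alpha.
  by move: (d%:R : R) => D; lra.
have T : (tau k ^+ 3 = (a `^ beta)^-1 ^+ 3 / (r k ^+ d * (r k `^ s) ^+ 2))%R.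
  by rewrite /tau powRM ?(ltW a0) ?(ltW rk0)// invfM [LHS]exprMn -E -[in RHS]exprVn.
rewrite /energy_constant [((coef * _) ^+ 3)%R]exprMn T [((2 * _) ^+ d)%R]exprMn.
have p1 : (0 < r k ^+ d)%R by rewrite exprn_gt0.
have p2 : (0 < r k `^ s)%R by rewrite powR_gt0.
move: ((a `^ beta)^-1)%R (r k ^+ d)%R (r k `^ s)%R p1 p2 => x y z y0 z0.
by field; rewrite !gt_eqF.
Qed.

Lemma energy_le_potential N :
  (energy_constant * \sum_(k < N) \int[mu]_x (V x (r k) / r k `^ s) ^+ 2)%:E <=
  \int[lam]_xi (`|riesz_potential c alpha mu xi| `^ 3).
Proof.
have V0 x t : (0 <= V x t)%R by apply: Int_ge0 => y; exact: ler0n.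
have ct0 k : (0 <= coef * tau k)%R by rewrite mulr_ge0// ltW.
have mV3 t : measurable_fun [set: X] (fun xi => (V xi t ^+ 3)%R).
  under eq_fun do rewrite exprSr.
  by have [] := bmfM (bmf_sqr (bV t)) (bV t).
apply: (@le_trans _ _ (\int[lam]_xi (\sum_(k < N)
    ((coef * tau k) ^+ 3)%:E * (V xi (a * r k) ^+ 3)%:E))).
  rewrite ge0_integral_sum//; last 2 first.
  - move=> k; apply/measurable_EFinP; apply: measurable_funM => //.
  - move=> k x _; rewrite -EFinM lee_fin mulr_ge0// exprn_ge0//.
  rewrite mulr_sumr -sumEFin; apply: lee_sum => k _.
  rewrite ge0_integralZl_EFin//; last 3 first.
  - by move=> x _; rewrite lee_fin exprn_ge0.
  - exact/measurable_EFinP.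
  - exact: exprn_ge0.
  apply: (@le_trans _ _ (((coef * tau k) ^+ 3)%:E *
      ((2 * r k) ^+ d * \int[mu]_x (V x (r k) ^+ 2))%:E)); last first.
    apply: lee_wpmul2l; first by rewrite lee_fin exprn_ge0.
    by apply: ball_mass_cube_ge; exact: scale_gt0.
  rewrite -EFinM lee_fin [leRHS]mulrA -scale_exponents -[leRHS]mulrA; apply: ler_wpM2l.
    by rewrite ltW// energy_constant_gt0.
  rewrite -IntZ; last exact: bmf_sqr.
  rewrite le_eqVlt; apply/orP; left; apply/eqP; apply: eq_Rintegral => x _.
  by rewrite expr_div_n mulrC.
have mI := measurable_riesz_potential.
apply: ge0_le_integral => //.
- move=> xi _; apply: sume_ge0 => k _.
  by rewrite -EFinM lee_fin mulr_ge0// exprn_ge0.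
- apply: emeasurable_sum => k; apply/measurable_EFinP; exact: measurable_funM.
- apply: (measurableT_comp (measurable_poweR _)).
  exact: measurableT_comp mI.
move=> xi _; have := riesz_potential_ge N xi.
set S := (coef * _)%R => SI.
have S0 : (0 <= S)%R.
  by rewrite mulr_ge0 ?(ltW coef0)// sumr_ge0// => k _; rewrite mulr_ge0// ltW.
apply: (@le_trans _ _ (S%:E `^ 3)).
  rewrite poweR_EFin (powR_mulrn 3)//.
  under eq_bigr do rewrite -EFinM -exprMn.
  rewrite sumEFin lee_fin /S mulr_sumr.
  under [leRHS in (_ <= leRHS ^+ _)%R]eq_bigr do rewrite mulrA.
  by apply: (sum_cube N (b := fun k => (coef * tau k * V xi (a * r k))%R)) => k; rewrite mulr_ge0.
have I0 : 0 <= riesz_potential c alpha mu xi by apply: le_trans SI; rewrite lee_fin.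
rewrite gee0_abs//; apply: gt0_ler_poweR => //.
- by rewrite in_itv/= lee_fin S0 leey.
- by rewrite in_itv/= I0 leey.
Qed.

End energy_lower_bound.

(** * Comparison of the capacities *)

Section good_set.
Context {R : realType} {d : nat}.
Notation X := 'rV[R]_d.
Variables (mu : {finite_measure set X -> \bar R}) (s M : R) (E : set X).
Hypothesis s_gt0 : 0 < s.
Hypothesis M0 : 0 < M.
Hypothesis mE : measurable E.
Hypothesis muE : mu (~` E) = 0%E.
Hypothesis diamE : forall x y, E x -> E y -> rV_dist x y <= M.
Local Notation r := (scale M).
Local Notation V := (ball_mass mu rV_dist).
Let m : R := \int[mu]_x 1.
Hypothesis m_gt0 : 0 < m.

Let theta k x : R := (V x (r k) / r k `^ s) ^+ 2.

Lemma measurable_rV_dist : measurable_fun [set: X * X] (fun p => rV_dist p.1 p.2 : R).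
Proof. by apply: (measurableT_comp measurable_enorm); exact: measurable_rV_sub. Qed.

Let bB (x : X) t : bmf (fun y => (rV_dist x y <= t)%R%:R : R).
Proof.
apply: bmf_bool; apply: measurable_fun_ler => //.
exact: (measurableT_comp measurable_rV_dist (pair1_measurable x)).
Qed.

Let bV t : bmf (fun x => V x t).
Proof.
apply: (@bmf_int _ _ _ _ _ mu (fun p : X * X => (rV_dist p.1 p.2 <= t)%R%:R)).
by apply: bmf_bool; apply: measurable_fun_ler => //; exact: measurable_rV_dist.
Qed.

Let btheta k : bmf (theta k).
Proof. by apply: bmf_sqr; apply: bmfM => //; exact: bmf_cst. Qed.

Let theta0 k x : 0 <= theta k x. Proof. exact: sqr_ge0. Qed.

(** Chebyshev's inequality for the full Wolff sum W. *)
Lemma good_set (j : R) : 0 < j ->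
  (forall N, \sum_(k < N) \int[mu]_x theta k x <= j) ->
  exists G : set X, [/\ measurable G, G `<=` E,
    m / 2 <= \int[mu]_x \1_G x &
    forall x, G x -> forall N, \sum_(k < N) theta k x <= 2 * j / m].
Proof.
move=> j0 sj.
pose W x := (\sum_(k <oo) (theta k x)%:E)%E.
have W0 x : (0 <= W x)%E by apply: nneseries_ge0 => k _ _; rewrite lee_fin.
have mth k : measurable_fun [set: X] (fun x => (theta k x)%:E).
  by apply/measurable_EFinP; have [] := btheta k.
have mW : measurable_fun [set: X] W.
  by apply: ge0_emeasurable_sum => // k x _; rewrite lee_fin.
have IW : (\int[mu]_x W x <= j%:E)%E.
  rewrite integral_nneseries// => [|k x _]; last by rewrite lee_fin.
  apply: lime_le.
    apply: is_cvg_nneseries => k _ _; apply: integral_ge0 => x _.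
    by rewrite lee_fin.
  apply: nearW => N; under eq_bigr do rewrite -Int_EFin//.
  by rewrite sumEFin lee_fin big_mkord.
pose l := 2 * j / m.
have l0 : 0 < l by rewrite divr_gt0// mulr_gt0.
pose Bad := [set x : X | (l%:E <= `|W x|)%E].
have mBad : measurable Bad.
  rewrite -[Bad]setTI; apply: emeasurable_fun_c_infty => //.
  exact: measurableT_comp.
have muBad : (mu Bad <= (m / 2)%:E)%E.
  have := le_integral_abse mu measurableT mW l0.
  rewrite setTI -/Bad => h.
  have {h} : (l%:E * mu Bad <= j%:E)%E.
    apply: le_trans h _; rewrite (eq_integral W)// => x _.
    by rewrite gee0_abs.
  have -> : mu Bad = (fine (mu Bad))%:E by rewrite fineK// fin_num_measure.
  rewrite -EFinM !lee_fin => h.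
  rewrite -(ler_pM2l l0); apply: le_trans h _.
  by rewrite le_eqVlt; apply/orP; left; apply/eqP; rewrite /l; field; rewrite gt_eqF.
exists (E `\` Bad); split.
- exact: measurableD.
- by move=> x [].
- have bI (A : set X) : measurable A -> bmf (\1_A : X -> R).
    move=> mA; apply: (bmf_le (M := 1)) => [|x]; first exact: measurable_indic.
    by rewrite ger0_norm// ?indicE ?ler0n// ler_nat leq_b1.
  have mG : measurable (E `\` Bad) by exact: measurableD.
  have IA (A : set X) : measurable A -> (\int[mu]_x \1_A x)%:E = mu A.
    by move=> mA; rewrite Int_EFin ?integral_indic ?setIT//; exact: bI.
  have : m <= \int[mu]_x \1_(E `\` Bad) x + \int[mu]_x \1_Bad x.
    rewrite -IntD; [|exact: bI..].
    apply: (Int_le_on mE muE); [exact: bmf_cst|by apply: bmfD; exact: bI|].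
    move=> x Ex; rewrite !indicE.
    have [xB|xB] := pselect (Bad x).
      by rewrite [_ \in Bad]mem_set// lerDr ler0n.
    by rewrite mem_set// lerDl ler0n.
  have : \int[mu]_x \1_Bad x <= m / 2 by rewrite -lee_fin IA.
  lra.
- move=> x [Ex nB] N; rewrite -lee_fin -sumEFin.
  have /ltW : (W x < l%:E)%E.
    by move: nB; rewrite /Bad/= gee0_abs// => /negP; rewrite -ltNge.
  apply: le_trans; rewrite -(big_mkord xpredT (fun k => (theta k x)%:E)).
  by apply: nneseries_lim_ge => k _ _; rewrite lee_fin.
Qed.

(** The Wolff sum is quadratic in the measure: restricting does not increase it,
and dividing the measure by l divides it by l^2. *)
Lemma restricted_wolff (G : set X) (l : R) (bh : bmf (fun x => \1_G x / l : R))
    (h0 : forall x, 0 <= \1_G x / l) :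
  measurable G -> G `<=` E -> 0 < l ->
  (forall x, G x -> forall N, \sum_(k < N) theta k x <= l ^+ 2) ->
  wolff_bounded (density mu bh h0) rV_dist s M G.
Proof.
move=> mG GE l0 Gth; split => //.
- by move=> x y; exact: enorm_ge0.
- by move=> x; rewrite /rV_dist subrr enorm0.
- by move=> x y; rewrite /rV_dist enormB.
- move=> x y z; rewrite /rV_dist [leRHS]addrC.
  by have := enormD (z - y) (y - x); rewrite addrA subrK.
- exact: measurable_rV_dist.
- have mGC : measurable (~` G) by exact: measurableC.
  rewrite /= /density (eq_integral (cst 0%E)) ?integral0// => x.
  rewrite inE => /= nG; rewrite indicE memNset// mul0r//.
- by move=> x y Gx Gy; apply: diamE; exact: GE.
- move=> x Gx N; apply: (@le_trans _ _ (\sum_(k < N) theta k x / l ^+ 2)); last first.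
    by rewrite -mulr_suml ler_pdivrMr ?exprn_gt0// mul1r; exact: Gth.
  apply: ler_sum => k _; rewrite /theta -expr_div_n.
  rewrite ler_sqr ?nnegrE; last 2 first.
  - by rewrite divr_ge0 ?powR_ge0//; apply: Int_ge0 => y; exact: ler0n.
  - rewrite !divr_ge0 ?powR_ge0//; last exact: ltW.
    by apply: Int_ge0 => y; exact: ler0n.
  rewrite mulrAC; apply: ler_wpM2r; first by rewrite invr_ge0 powR_ge0.
  rewrite /ball_mass density_integral//.
  rewrite mulrC -IntZ//; apply: Int_le => [||y]; [exact: bmfM|exact: bmfZ|].
  rewrite mulrC; apply: ler_wpM2r; first exact: ler0n.
  rewrite -[leRHS]mul1r; apply: ler_wpM2r; first by rewrite invr_ge0 ltW.
  by rewrite indicE -[1]/(1%:R) ler_nat leq_b1.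
Qed.

End good_set.

Section capacity_comparison.
Context {R : realType} {d : nat}.
Notation X := 'rV[R]_d.
Variables (s c : R).
Hypothesis d_gt0 : (0 < d)%N.
Hypothesis s_gt0 : 0 < s.
Hypothesis s_ltd : s < d%:R.
Hypothesis c_gt0 : 0 < c.
Let alpha : R := 2 / 3 * (d%:R - s).
Local Notation lam := (@lebesgue_rV R d).

Let c1 : R := @energy_constant R d s c.

(** With [l] as in the proof of [finite_comparison], the mass obtained is at least
m/(4 l normalization), and m/l is sqrt(c1/2) m^(3/2) j^(-1/2). *)
Definition comparison_constant : R :=
  Num.sqrt (c1 / 2) / (4 * normalization d s).

Lemma compact_diam (E : set X) : compact E ->
  exists2 M : R, 0 < M & forall x y, E x -> E y -> rV_dist x y <= M.
Proof.
move=> cE; have [B [_ BE]] := compact_bounded cE.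
pose K := Num.max B 0 + 1.
have BK : B < K by rewrite ltr_pwDr// le_max lexx.
have K0 : 0 < K by rewrite ltr_pwDr// le_max lexx orbT.
have EK x i : E x -> `|x ord0 i| <= K.
  move=> Ex; apply: le_trans (BE _ BK _ Ex).
  rewrite [leRHS]mx_normrE.
  exact: (le_bigmax _ (fun ij : 'I_1 * 'I_d => `|x ij.1 ij.2|) (ord0, i)).
exists (d%:R * (2 * K) + 1).
  by rewrite ltr_wpDl// mulr_ge0// mulr_ge0// ltW.
move=> x y Ex Ey; apply: le_trans (enorm_le_sum _) _.
apply: (@le_trans _ _ (d%:R * (2 * K))); last by rewrite lerDl.
have -> : d%:R * (2 * K) = \sum_(i < d) 2 * K by rewrite sumr_const card_ord mulr_natl.
apply: ler_sum => i _; rewrite !mxE; apply: le_trans (ler_normB _ _) _.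
by have := EK x i Ex; have := EK y i Ey; lra.
Qed.

(** For a finite measure with finite third moment j of the potential, [good_set]
provides a part of E with at least half of the mass, on which the Wolff sum is at
most l^2 = 2j/(c1 m); the part is then divided by l. *)
Lemma finite_comparison (mu : {finite_measure set X -> \bar R}) (E : set X) (j : R) :
  compact E -> mu (~` E) = 0%E -> 0 < \int[mu]_x 1 ->
  (\int[lam]_xi (`|riesz_potential c alpha mu xi| `^ 3) = j%:E)%E ->
  0 < j /\
  ((comparison_constant * ((\int[mu]_x 1) / j `^ 3^-1) `^ (3 / 2))%:E
    <= gamma_plus s E)%E.
Proof.
move=> cE muE m0 Ij; set m := \int[mu]_x 1 in m0 *.
have [M M0 diamE] := compact_diam cE.
have mE := compact_measurable cE.
have c10 : 0 < c1 by exact: energy_constant_gt0.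
have en N := energy_le_potential mu s_gt0 s_ltd M0 c_gt0 N.
rewrite -/alpha Ij in en.
pose V := ball_mass mu rV_dist; pose r := scale M.
have {}en N : c1 * \sum_(k < N) \int[mu]_x (V x (r k) / r k `^ s) ^+ 2 <= j.
  by rewrite -lee_fin; exact: en.
have j0 : 0 < j.
  apply: lt_le_trans (en 1%N); rewrite big_ord_recl big_ord0 addr0.
  apply: mulr_gt0 => //.
  have rM : r 0%N = M by rewrite /r /scale expr0 mulr1.
  have bV0 : bmf (fun x => (V x (r 0%N) / r 0%N `^ s) ^+ 2).
    apply: bmf_sqr; apply: bmfM; last exact: bmf_cst.
    apply: (@bmf_int _ _ _ _ _ mu (fun p : X * X => (rV_dist p.1 p.2 <= r 0%N)%R%:R)).
    by apply: bmf_bool; apply: measurable_fun_ler => //; exact: measurable_rV_dist.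
  have q0 : 0 < m / M `^ s by rewrite divr_gt0// powR_gt0.
  apply: (@lt_le_trans _ _ (\int[mu]_x ((m / M `^ s) ^+ 2 * 1))).
    by rewrite IntZ; [rewrite mulr_gt0// exprn_gt0|exact: bmf_cst].
  apply: (Int_le_on mE muE) => // [|x Ex]; first exact: bmf_cst.
  have Vm : m <= V x (r 0%N).
    apply: (Int_le_on mE muE) => [||y Ey]; first exact: bmf_cst.
      apply: bmf_bool; apply: measurable_fun_ler => //.
      exact: (measurableT_comp measurable_rV_dist (pair1_measurable x)).
    by rewrite rM diamE.
  have le_q : m / M `^ s <= V x (r 0%N) / r 0%N `^ s.
    by rewrite rM in Vm *; apply: ler_wpM2r => //; rewrite invr_ge0 powR_ge0.
  by rewrite mulr1 ler_sqr ?nnegrE ?(ltW q0)//; apply: le_trans le_q; exact: ltW.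
split=> //.
have [G [mG GE IG Gth]] : exists G : set X, [/\ measurable G, G `<=` E,
    m / 2 <= \int[mu]_x \1_G x & forall x, G x -> forall N,
    \sum_(k < N) (V x (r k) / r k `^ s) ^+ 2 <= 2 * (j / c1) / m].
  apply: (good_set mE muE m0); first by rewrite divr_gt0.
  by move=> N; rewrite ler_pdivlMr// mulrC; exact: en.
pose l := Num.sqrt (2 * (j / c1) / m).
have l0 : 0 < l by rewrite sqrtr_gt0 divr_gt0// mulr_gt0// divr_gt0.
have l2 : l ^+ 2 = 2 * (j / c1) / m.
  by rewrite sqr_sqrtr// divr_ge0 ?(ltW m0)// mulr_ge0// divr_ge0// ltW.
have bI : bmf (\1_G : X -> R).
  apply: (bmf_le (M := 1)) => [|x]; first exact: measurable_indic.
  by rewrite ger0_norm// ?indicE ?ler0n// ler_nat leq_b1.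
have bh : bmf (fun x => \1_G x / l : R) by apply: bmfM => //; exact: bmf_cst.
have h0 x : 0 <= \1_G x / l :> R by rewrite divr_ge0 ?(ltW l0)// indicE ler0n.
have WB : wolff_bounded (density mu bh h0) rV_dist s M G.
  apply: (restricted_wolff s_gt0 M0 diamE) => //.
  by move=> x Gx N; rewrite l2; exact: Gth.
have m1 : \int[density mu bh h0]_y 1 = (\int[mu]_x \1_G x) / l.
  rewrite density_integral; last exact: bmf_cst.
  rewrite [RHS]mulrC -IntZ//; apply: eq_Rintegral => x _.
  by rewrite mul1r mulrC.
have m10 : 0 < \int[density mu bh h0]_y 1.
  by rewrite m1 divr_gt0//; apply: lt_le_trans IG; rewrite divr_gt0.
have := gamma_plus_ge WB m10 d_gt0 cE GE.
apply: le_trans; rewrite lee_fin m1.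
have N0 : 0 < normalization d s by exact: normalization_gt0.
have j30 : 0 < j `^ 3^-1 by rewrite powR_gt0.
have mj0 : 0 <= m / j `^ 3^-1 by rewrite divr_ge0// ltW.
(* (m / j^(1/3))^(3/2) is homogeneous of the same degrees as m / l. *)
have key : Num.sqrt (c1 / 2) * (m / j `^ 3^-1) `^ (3 / 2) = m / l.
  apply/eqP; rewrite -(eqrXn2 (n := 2))//; last 2 first.
  - by rewrite mulr_ge0 ?sqrtr_ge0 ?powR_ge0.
  - by rewrite divr_ge0// ltW.
  rewrite exprMn sqr_sqrtr; last by rewrite divr_ge0// ltW.
  rewrite -[((_ `^ (3 / 2)) ^+ 2)]powR_mulrn ?powR_ge0// -powRrM.
  have -> : 3 / 2 * 2%:R = 3%:R :> R by lra.
  rewrite powR_mulrn// expr_div_n -[(j `^ _) ^+ 3]powR_mulrn ?powR_ge0//.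
  rewrite -powRrM mulVf// powRr1 ?(ltW j0)// expr_div_n l2.
  by apply/eqP; field; rewrite !gt_eqF.
rewrite /comparison_constant mulrAC key.
have -> : m / l / (4 * normalization d s) =
  (2 * normalization d s)^-1 * ((m / 2) / l).
  by field; rewrite !gt_eqF.
apply: ler_wpM2l; first by rewrite invr_ge0 mulr_ge0// ltW.
by apply: ler_wpM2r => //; rewrite invr_ge0 ltW.
Qed.

Lemma comparison_constant_gt0 : 0 < normalization d s -> 0 < comparison_constant.
Proof.
move=> N0; apply: divr_gt0; last by rewrite mulr_gt0.
by rewrite sqrtr_gt0 divr_gt0//; exact: energy_constant_gt0.
Qed.

End capacity_comparison.

Section gamma_plus_facts.
Context {R : realType} {d : nat}.
Notation X := 'rV[R]_d.
Local Open Scope ereal_scope.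

(** The zero measure is admissible. *)
Lemma gamma_plus_ge0 (s : R) (E : set X) : (0 < d)%N -> 0 <= gamma_plus s E.
Proof.
move=> d0; apply: ereal_sup_ubound; exists mzero => //; split.
  by split => // K _; rewrite /mzero/= ltry.
rewrite unlock /=; case: ifPn => // _.
apply/ess_supP; apply: aeW => x /=; rewrite lee_fin ger0_norm ?enorm_ge0//.
apply: (transform_bound d0 (@ltr01 R)) => n c.
by rewrite mxE /Rintegral integral_measure_zero/= normr0 invr_ge0.
Qed.

Lemma conjugate_three_halves : hoelder_conjugate (3 / 2 : R)%:E = 3%:E.
Proof.
rewrite /hoelder_conjugate eqe mulf_eq0 invr_eq0 !pnatr_eq0/=.
have -> : (3 / 2)%:E - 1 = (2^-1 : R)%:E by rewrite -EFinB; congr EFin; lra.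
rewrite inver invr_eq0 pnatr_eq0/= -EFinM; congr EFin; lra.
Qed.

Lemma finite_version (mu : {measure set X -> \bar R}) : mu setT < +oo ->
  exists nu : {finite_measure set X -> \bar R}, forall A, nu A = mu A.
Proof.
move=> muT; exists (mfrestr measurableT muT : {finite_measure set X -> \bar R}) => A.
by rewrite /= /mfrestr /mrestr setIT.
Qed.

End gamma_plus_facts.

(* [A n alpha] is the normalizing constant of the Riesz kernel. *)
Theorem corollary11p4 (R : realType) (A : nat -> R -> R)
    (A_gt0 : forall (n : nat) (alpha : R), 0 < alpha -> alpha < n%:R ->
      0 < A n alpha)
    (d : nat) (s : R) (d_ge1 : (1 <= d)%N) (s_gt0 : 0 < s) (s_ltd : s < d%:R) :
  exists c : R, 0 < c /\
    forall E : set 'rV[R]_d, compact E ->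
      (c%:E * riesz_capacity (A d (2 / 3 * (d%:R - s))%R)
                (2 / 3 * (d%:R - s))%R (3 / 2)%R E <= gamma_plus s E)%E.
Proof.
set alpha := 2 / 3 * (d%:R - s).
have alpha0 : 0 < alpha by rewrite /alpha; move: (d%:R : R) s_ltd => D ?; lra.
have alphad : alpha < d%:R.
  by rewrite /alpha; move: (d%:R : R) s_ltd => D ?; move: s_gt0 => ?; lra.
have A0 := A_gt0 d alpha alpha0 alphad.
pose c := @comparison_constant R d s (A d alpha).
have c0 : 0 < c by apply: comparison_constant_gt0 => //; exact: normalization_gt0.
exists c; split => // E cE.
have mE := compact_measurable cE.
have g0 := gamma_plus_ge0 s E d_ge1.
rewrite -lee_pdivlMl//; apply: ge_ereal_sup => _ [->|[mu [[rmu muE] muE0] <-]].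
  by rewrite mule_ge0// lee_fin invr_ge0 ltW.
rewrite conjugate_three_halves lee_pdivlMl//.
have muT : mu setT = mu E.
  rewrite -(setUv E) measureU//; last by rewrite setICr.
    by rewrite [X in (_ + X)%E]muE adde0.
  exact: measurableC.
have [nu nuE] : exists nu : {finite_measure set 'rV[R]_d -> \bar R},
    forall B, nu B = mu B.
  by apply: finite_version; rewrite muT; exact: rmu.
have potE x : riesz_potential (A d alpha) alpha mu x = riesz_potential (A d alpha) alpha nu x.
  by apply: eq_measure_integral => B _ _; exact/esym/nuE.
rewrite (eq_Lnorm _ _ potE).
have mnu : (\int[nu]_x (1 : R))%:E = mu E.
  rewrite Int_EFin; last exact: bmf_cst.
  rewrite integral_cst// mul1e -muT; exact: nuE.
have m0 : 0 < \int[nu]_x (1 : R).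
  by rewrite -lte_fin mnu lt_def muE0 measure_ge0.
rewrite -mnu unlock.
set J := (\int[_]_x _)%E.
have J0 : (0 <= J)%E by apply: integral_ge0 => x _; exact: poweR_ge0.
(* An infinite norm makes the quotient vanish. *)
have [JE|JE] := eqVneq J +oo%E.
  by rewrite JE poweRyr ?invr_eq0// invey mule0 poweR0r ?mule0// mulf_neq0.
have Jfin : J \is a fin_num by rewrite ge0_fin_numE// ltey.
have nuE0 : nu (~` E) = 0%E by apply: etrans (nuE _) _.
have [j0 le_gamma] := finite_comparison d_ge1 s_gt0 s_ltd A0 cE nuE0 m0 (esym (fineK Jfin)).
by rewrite -(fineK Jfin) poweR_EFin inver gt_eqF ?powR_gt0.
Qed.
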